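(* Let $\Lambda=kQ/J$ be a locally finite dimensional algebra over a field $k$, where $Q$ is a locally finite quiver and $J$ is a weakly admissible ideal in $kQ$. (1) If $P^\bullet\in K^b(\mathrm{proj}\,\Lambda)$ is indecomposable, then $D^b(\mathrm{Mod}\,\Lambda)$ has an almost split triangle $\nu_\Lambda P^\bullet[-1]\to M^\bullet\to P^\bullet\to\nu_\Lambda P^\bullet$, which is almost split in $D(\mathrm{Mod}\,\Lambda)$. (2) If $I^\bullet\in K^b(\mathrm{inj}\,\Lambda)$ is indecomposable, then $D^b(\mathrm{Mod}\,\Lambda)$ has an almost split triangle $I^\bullet\to M^\bullet\to\nu_\Lambda^{-}I^\bullet[1]\to I^\bullet[1]$, which is almost split in $D(\mathrm{Mod}\,\Lambda)$.
   Context: An ideal $J$ of the path algebra $kQ$ is weakly admissible if it lies in the ideal generated by the paths of length two. $\Lambda=kQ/J$ has a complete set of pairwise orthogonal primitive idempotents $\{e_x\mid x\in Q_0\}$ ($Q_0$ the vertex set); it is locally finite dimensional if $e_x\Lambda e_y$ is finite dimensional for all $x,y\in Q_0$ ($\Lambda$ need not have an identity). $\mathrm{Mod}\,\Lambda$ is the category of left $\Lambda$-modules $M$ with $M=\bigoplus_{x\in Q_0}e_xM$. For $x\in Q_0$, $P_x=\Lambda e_x$ is projective and $I_x=D(\Lambda^{\mathrm{op}}e_x)=\bigoplus_{y\in Q_0}\mathrm{Hom}_k(e_x\Lambda e_y,k)$ (the graded dual of the right module $e_x\Lambda$) is injective. $\mathrm{proj}\,\Lambda$ and $\mathrm{inj}\,\Lambda$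 are the strictly additive subcategories of $\mathrm{Mod}\,\Lambda$ (full, closed under finite direct sums, summands, isomorphisms) generated by the $P_x$ and by the $I_x$, $x\in Q_0$, respectively. $\nu_\Lambda:\mathrm{proj}\,\Lambda\to\mathrm{Mod}\,\Lambda$ is the Nakayama functor sending $P_x$ to $I_x$, i.e. the functor with binatural isomorphisms $\mathrm{Hom}_\Lambda(X,\nu_\Lambda P)\cong\mathrm{Hom}_k(\mathrm{Hom}_\Lambda(P,X),k)$ for $P\in\mathrm{proj}\,\Lambda$, $X\in\mathrm{Mod}\,\Lambda$; it induces an equivalence $\mathrm{proj}\,\Lambda\to\mathrm{inj}\,\Lambda$ with quasi-inverse $\nu_\Lambda^{-}$, sending $I_x$ to $P_x$. Both are extended componentwise to complexes. $K^b$ is the bounded homotopy category. In a triangulated category, an exact triangle $X\xrightarrow{f}Y\xrightarrow{g}Z\to X[1]$ is almost split if $f$ is minimal left almost split and $g$ is minimal right almost split. Here $f:X\to Y$ is left minimal if every $h:Y\to Y$ with $hf=f$ is an automorphism, left almost split if it is not a section and every non-section $X\to M$ factors through $f$, minimal left almost split if both; the right versions are dual. *)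

(* Defs.v *)
From HB Require Import structures.
From mathcomp Require Import all_boot all_order all_algebra.
From mathcomp Require Import finmap.
From mathcomp.multinomials Require Import monalg.
From mathcomp Require Import boolp functions.
From mathcomp Require Import zify.

Set Implicit Arguments.
Unset Strict Implicit.
Unset Printing Implicit Defensive.

Import GRing.Theory.
Local Open Scope ring_scope.

(* Algebras need not have an identity: the identity is replaced by a family of
   pairwise orthogonal idempotents acting as local units. *)
Record lualgebra (k : fieldType) := LUAlgebra {
  acar :> lmodType k;
  avert : choiceType;
  amul : acar -> acar -> acar;
  aid : avert -> acar;
  amul_linl : forall b, linear (fun a => amul a b);
  amul_linr : forall a, linear (amul a);
  amulA : associative amul;
  aid_idem : forall x, amul (aid x) (aid x) = aid x;
  aid_orth : forall x y, x != y -> amul (aid x) (aid y) = 0;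
  alunit : forall a, exists s : seq avert,
    uniq s /\ a = \sum_(x <- s) amul (aid x) a;
  arunit : forall a, exists s : seq avert,
    uniq s /\ a = \sum_(x <- s) amul a (aid x)
}.

Definition finite_dim (k : fieldType) (V : lmodType k) (S : V -> Prop) :=
  exists (n : nat) (b : 'I_n -> V), (forall i, S (b i)) /\
    forall v, S v -> exists c : 'I_n -> k, v = \sum_i c i *: b i.

Definition locally_finite_dim (k : fieldType) (A : lualgebra k) :=
  forall x y : avert A,
    finite_dim (fun a : A => exists b : A, a = amul (amul (aid x) b) (aid y)).

Record quiver := Quiver {
  qvert : choiceType;
  qarr : choiceType;
  qsrc : qarr -> qvert;
  qtgt : qarr -> qvert
}.

Definition locally_finite_quiver (Q : quiver) := forall x : qvert Q,
  exists s : seq (qarr Q), forall a, qsrc a = x \/ qtgt a = x -> a \in s.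

Section PathAlgebra.
Variables (k : fieldType) (Q : quiver).

(* The list of arrows of a path is in order of traversal, so that the trivial
   path at x is (x, [::]). *)
Fixpoint walk (x : qvert Q) (s : seq (qarr Q)) : bool :=
  if s is a :: s' then (qsrc a == x) && walk (qtgt a) s' else true.

Record qpath := QPath {
  qpval : qvert Q * seq (qarr Q);
  qpvalP : walk qpval.1 qpval.2
}.
HB.instance Definition _ := [isSub for qpval].
HB.instance Definition _ := [Choice of qpath by <:].

Definition psrc (p : qpath) : qvert Q := (qpval p).1.
Definition parr (p : qpath) : seq (qarr Q) := (qpval p).2.
Definition ptgt (p : qpath) : qvert Q := last (psrc p) (map (@qtgt Q) (parr p)).
Definition plen (p : qpath) : nat := size (parr p).
Definition ptriv (x : qvert Q) : qpath := @QPath (x, [::]) isT.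

(* Paths compose from right to left: [pcomp p q] is "q, then p". *)
Definition pcomp (p q : qpath) : option qpath :=
  if ptgt q == psrc p then insub (psrc q, parr q ++ parr p) else None.

Definition kQ : lmodType k := {malg k[qpath]}.
Definition pelt (p : qpath) : kQ := << p >>.
Definition opelt (o : option qpath) : kQ := if o is Some p then pelt p else 0.

Definition pmul (f g : kQ) : kQ :=
  \sum_(p <- msupp f) \sum_(q <- msupp g) (f@_p * g@_q) *: opelt (pcomp p q).

Definition lext (V : lmodType k) (F : qpath -> V) (f : kQ) : V :=
  \sum_(p <- msupp f) f@_p *: F p.

Lemma lextw (V : lmodType k) (F : qpath -> V) (f : kQ) (d : {fset qpath}) :
  fsubset (msupp f) d -> lext F f = \sum_(p <- d) f@_p *: F p.
Proof.
move=> sd; rewrite /lext; apply: big_fset_incl => // p _ pn.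
by rewrite mcoeff_outdom // scale0r.
Qed.

Lemma lext_linear (V : lmodType k) (F : qpath -> V) : linear (lext F).
Proof.
move=> c f g.
pose d := fsetU (msupp (c *: f + g)) (fsetU (msupp f) (msupp g)).
rewrite (@lextw _ _ _ d) ?fsubsetUl // (@lextw _ _ f d); last first.
  by rewrite /d fsetUC -fsetUA fsubsetUl.
rewrite (@lextw _ _ g d); last first.
  by rewrite /d fsetUA fsetUC fsubsetUl.
rewrite scaler_sumr -big_split /=; apply: eq_bigr => p _.
by rewrite scalerA -scalerDl mcoeffD mcoeffZ.
Qed.
HB.instance Definition _ (V : lmodType k) (F : qpath -> V) :=
  GRing.isLinear.Build k kQ V _ (lext F) (lext_linear F).

Lemma lext_pelt (V : lmodType k) (F : qpath -> V) p : lext F (pelt p) = F p.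
Proof.
by rewrite /lext /pelt msuppU oner_eq0 big_seq_fset1 mcoeffUU scale1r.
Qed.

Lemma lext_id (f : kQ) : lext pelt f = f.
Proof.
rewrite [RHS]monalgE /lext; apply: eq_bigr => p _.
by apply/malgP => q; rewrite mcoeffZ /pelt !mcoeffU mulr_natr.
Qed.

Lemma eq_lext (V : lmodType k) (F G : qpath -> V) :
  F =1 G -> lext F =1 lext G.
Proof. by move=> FG f; apply: eq_bigr => p _; rewrite FG. Qed.

Lemma kQ_ext (V : lmodType k) (F G : kQ -> V) : linear F -> linear G ->
  (forall p, F (pelt p) = G (pelt p)) -> F =1 G.
Proof.
move=> lF lG FG f.
pose F' : {linear kQ -> V} := HB.pack F (GRing.isLinear.Build k kQ V _ F lF).
pose G' : {linear kQ -> V} := HB.pack G (GRing.isLinear.Build k kQ V _ G lG).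
rewrite -[f]lext_id -[F _]/(F' _) -[G _]/(G' _) /lext !linear_sum.
by apply: eq_bigr => p _; rewrite !linearZ /= FG.
Qed.

Lemma pmulEl f g : pmul f g = lext (fun p => lext (fun q => opelt (pcomp p q)) g) f.
Proof.
apply: eq_bigr => p _; rewrite scaler_sumr.
by apply: eq_bigr => q _; rewrite scalerA.
Qed.

Lemma pmul_linl g : linear (fun f => pmul f g).
Proof. by move=> c f f'; rewrite !pmulEl linearP. Qed.

Lemma pmul_linr f : linear (pmul f).
Proof.
move=> c g g'; rewrite !pmulEl /lext scaler_sumr -big_split /=.
apply: eq_bigr => p _.
by rewrite -!/(lext _ _) linearP scalerDr !scalerA mulrC.
Qed.

HB.instance Definition _ f :=
  GRing.isLinear.Build k kQ kQ _ (pmul f) (pmul_linr f).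

Lemma pmulU p q : pmul (pelt p) (pelt q) = opelt (pcomp p q).
Proof. by rewrite pmulEl !lext_pelt. Qed.

Lemma pmul0 f : pmul f 0 = 0.
Proof. by rewrite pmulEl /lext msupp0 !big1 // => p _; rewrite big_seq_fset0 scaler0. Qed.

Lemma p0mul f : pmul 0 f = 0.
Proof. by rewrite /pmul msupp0 big_seq_fset0. Qed.

Lemma walk_cat x s t :
  walk x (s ++ t) = walk x s && walk (last x (map (@qtgt Q) s)) t.
Proof. by elim: s x => //= a s IH x; rewrite IH andbA. Qed.

Lemma pcompT p q : ptgt q = psrc p -> exists r,
  [/\ pcomp p q = Some r, psrc r = psrc q, ptgt r = ptgt p &
      parr r = parr q ++ parr p].
Proof.
move=> e; rewrite /pcomp e eqxx.
have w : walk (psrc q, parr q ++ parr p).1 (psrc q, parr q ++ parr p).2.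
  rewrite /= walk_cat; apply/andP; split; first exact: (qpvalP q).
  by rewrite -/(ptgt q) e; apply: (qpvalP p).
rewrite insubT; eexists; split=> //.
by rewrite /ptgt /= /psrc /parr /= map_cat last_cat -/(ptgt q) e.
Qed.

Lemma pcompF p q : ptgt q <> psrc p -> pcomp p q = None.
Proof. by rewrite /pcomp; case: eqP. Qed.

Lemma pathP p q : psrc p = psrc q -> parr p = parr q -> p = q.
Proof.
case: p q => [[x s] wp] [[y t] wq]; rewrite /psrc /parr /= => e1 e2.
by apply: val_inj; rewrite /= e1 e2.
Qed.

Lemma pmulA : associative pmul.
Proof.
move=> f g h; move: f; apply: kQ_ext.
- by move=> c f f'; rewrite pmul_linl.
- by move=> c f f'; rewrite !pmul_linl.
move=> p; move: g; apply: kQ_ext.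
- by move=> c f f'; rewrite pmul_linl pmul_linr.
- by move=> c f f'; rewrite pmul_linr pmul_linl.
move=> q; move: h; apply: kQ_ext.
- by move=> c f f'; rewrite !pmul_linr.
- by move=> c f f'; rewrite !pmul_linr.
move=> r; rewrite !pmulU.
have -> : pmul (pelt p) (opelt (pcomp q r)) = opelt (obind (pcomp p) (pcomp q r)).
  by case: pcomp => [s|] /=; rewrite ?pmulU ?pmul0.
have -> : pmul (opelt (pcomp p q)) (pelt r) =
          opelt (obind (pcomp^~ r) (pcomp p q)).
  by case: pcomp => [s|] /=; rewrite ?pmulU ?p0mul.
congr opelt.
case: (eqVneq (ptgt r) (psrc q)) => [e1|/eqP n1];
case: (eqVneq (ptgt q) (psrc p)) => [e2|/eqP n2].
- have [qr [-> s1 t1 a1]] := pcompT e1; have [pq [-> s2 t2 a2]] := pcompT e2.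
  have /pcompT [u [/= -> s3 t3 a3]] : ptgt qr = psrc p by rewrite t1.
  have /pcompT [v [-> s4 t4 a4]] : ptgt r = psrc pq by rewrite s2.
  by congr Some; apply: pathP; rewrite ?s3 ?s4 ?s1 // a3 a4 a1 a2 catA.
- have [qr [-> s1 t1 a1]] := pcompT e1.
  by rewrite (pcompF n2) /= pcompF // t1.
- have [pq [-> s2 t2 a2]] := pcompT e2.
  by rewrite (pcompF n1) /= pcompF // s2.
- by rewrite !pcompF.
Qed.

Definition pid (x : qvert Q) : kQ := pelt (ptriv x).

Lemma pid_pelt x p : pmul (pid x) (pelt p) = if ptgt p == x then pelt p else 0.
Proof.
rewrite pmulU; case: eqP => [e|n]; last by rewrite pcompF.
have /pcompT [r [-> s1 t1 a1]] : ptgt p = psrc (ptriv x) by [].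
by congr pelt; apply: pathP; rewrite // a1 cats0.
Qed.

Lemma pelt_pid x p : pmul (pelt p) (pid x) = if psrc p == x then pelt p else 0.
Proof.
rewrite pmulU; case: eqP => [e|n].
  have /pcompT [r [-> s1 t1 a1]] : ptgt (ptriv x) = psrc p by rewrite e.
  by congr pelt; apply: pathP; rewrite // s1.
by rewrite pcompF //; apply/nesym.
Qed.

Lemma pid_idem x : pmul (pid x) (pid x) = pid x.
Proof. by rewrite pid_pelt eqxx. Qed.

Lemma pid_orth x y : x != y -> pmul (pid x) (pid y) = 0.
Proof. by rewrite pid_pelt eq_sym => /negPf ->. Qed.

Lemma pmul_suml (I : Type) (s : seq I) (F : I -> kQ) g :
  pmul (\sum_(i <- s) F i) g = \sum_(i <- s) pmul (F i) g.
Proof.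
by rewrite pmulEl linear_sum; apply: eq_bigr => i _; rewrite pmulEl.
Qed.

Lemma pmul_sumr (I : Type) (s : seq I) (F : I -> kQ) f :
  pmul f (\sum_(i <- s) F i) = \sum_(i <- s) pmul f (F i).
Proof. exact: linear_sum. Qed.

Lemma pmulZr c f g : pmul f (c *: g) = c *: pmul f g.
Proof. by have := pmul_linr f c g 0; rewrite pmul0 !addr0. Qed.

Lemma pmulZl c f g : pmul (c *: f) g = c *: pmul f g.
Proof. by rewrite !pmulEl linearZ. Qed.

Lemma sum_only (T : eqType) (V : nmodType) (s : seq T) (x : T) (v : V) :
  uniq s -> x \in s -> \sum_(y <- s) (if x == y then v else 0) = v.
Proof.
move=> us xs; rewrite (bigD1_seq x) //= eqxx big1 ?addr0 // => y.
by rewrite eq_sym => /negPf ->.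
Qed.

Lemma plunit f : exists s : seq (qvert Q),
  uniq s /\ f = \sum_(x <- s) pmul (pid x) f.
Proof.
exists (undup [seq ptgt p | p <- msupp f]); split; first exact: undup_uniq.
rewrite -{1}[f]lext_id /lext.
under [in RHS]eq_bigr => x _ do rewrite -{1}[f]lext_id /lext pmul_sumr.
rewrite exchange_big /=; apply: eq_big_seq => p pf.
under eq_bigr => x _ do rewrite pmulZr pid_pelt.
by rewrite -scaler_sumr sum_only ?undup_uniq // mem_undup map_f.
Qed.

Lemma prunit f : exists s : seq (qvert Q),
  uniq s /\ f = \sum_(x <- s) pmul f (pid x).
Proof.
exists (undup [seq psrc p | p <- msupp f]); split; first exact: undup_uniq.
rewrite -{1}[f]lext_id /lext.
under [in RHS]eq_bigr => x _ do rewrite -{1}[f]lext_id /lext pmul_suml.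
rewrite exchange_big /=; apply: eq_big_seq => p pf.
under eq_bigr => x _ do rewrite pmulZl pelt_pid.
by rewrite -scaler_sumr sum_only ?undup_uniq // mem_undup map_f.
Qed.

Record ideal := Ideal {
  imem :> {pred kQ};
  ideal_submod : submod_closed imem;
  idealMl : forall f g, g \in imem -> pmul f g \in imem;
  idealMr : forall f g, f \in imem -> pmul f g \in imem
}.

HB.instance Definition _ (J : ideal) :=
  GRing.isSubmodClosed.Build k kQ (imem J) (ideal_submod J).

Definition ideal_generated (S : kQ -> Prop) (f : kQ) :=
  forall I : ideal, (forall g, S g -> g \in I) -> f \in I.

Definition weakly_admissible (J : ideal) := forall f, f \in J ->
  ideal_generated (fun g => exists2 p, plen p = 2 & g = pelt p) f.

Section Quotient.
Variable J : ideal.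

Definition qalg := Quotient.quot (imem J : zmodClosed kQ).
HB.instance Definition _ := GRing.Zmodule.on qalg.

Definition qproj (f : kQ) : qalg := (\pi_qalg f)%qT.
Definition qscale (c : k) (a : qalg) : qalg := qproj (c *: repr a).
Definition qmul (a b : qalg) : qalg := qproj (pmul (repr a) (repr b)).

Lemma qprojP f g : qproj f = qproj g <-> f - g \in J.
Proof.
have -> : (f - g \in J) = (f - g \in (imem J : zmodClosed kQ)) by [].
by rewrite Quotient.idealrBE; split=> [e|/eqP //]; apply/eqP.
Qed.

Lemma qprojD : {morph qproj : f g / f + g}.
Proof. by move=> f g; rewrite /qproj piE. Qed.

Lemma reprKq a : qproj (repr a) = a.
Proof. exact: reprK. Qed.

Lemma qalgP (P : qalg -> Prop) : (forall f, P (qproj f)) -> forall a, P a.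
Proof. by move=> h a; rewrite -[a]reprKq. Qed.

Lemma repr_proj f : repr (qproj f) - f \in J.
Proof. by apply/qprojP; rewrite reprKq. Qed.

Lemma qscaleE c f : qscale c (qproj f) = qproj (c *: f).
Proof.
by apply/qprojP; rewrite -scalerBr; apply: rpredZ; apply: repr_proj.
Qed.

Lemma qmulE f g : qmul (qproj f) (qproj g) = qproj (pmul f g).
Proof.
apply/qprojP; set f' := repr _; set g' := repr _.
have -> : pmul f' g' - pmul f g = pmul (f' - f) g' + pmul f (g' - g).
  have -> : pmul (f' - f) g' = pmul f' g' - pmul f g'.
    by rewrite !pmulEl linearB.
  by rewrite linearB addrA subrK.
by apply: rpredD; [apply: idealMr|apply: idealMl]; apply: repr_proj.
Qed.

Fact qscaleA c d a : qscale c (qscale d a) = qscale (c * d) a.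
Proof. by move: a; apply: qalgP => f; rewrite !qscaleE scalerA. Qed.
Fact qscale1 : left_id 1 qscale.
Proof. by apply: qalgP => f; rewrite qscaleE scale1r. Qed.
Fact qscaleDr : right_distributive qscale +%R.
Proof.
move=> c; apply: qalgP => f; apply: qalgP => g.
by rewrite -qprojD !qscaleE -qprojD scalerDr.
Qed.
Fact qscaleDl a : {morph qscale^~ a : c d / c + d}.
Proof.
by move: a; apply: qalgP => f c d; rewrite !qscaleE -qprojD scalerDl.
Qed.
HB.instance Definition _ := GRing.Zmodule_isLmodule.Build k qalg
  qscaleA qscale1 qscaleDr qscaleDl.

Lemma qproj_linear : linear qproj.
Proof. by move=> c f g; rewrite qprojD -qscaleE. Qed.
HB.instance Definition _ := GRing.isLinear.Build k kQ qalg _ qproj qproj_linear.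

Definition qid (x : qvert Q) : qalg := qproj (pid x).

Fact qmul_linl b : linear (fun a => qmul a b).
Proof.
move: b; apply: qalgP => h c; apply: qalgP => f; apply: qalgP => g.
by rewrite -linearP !qmulE -linearP pmul_linl.
Qed.
Fact qmul_linr a : linear (qmul a).
Proof.
move: a; apply: qalgP => h c; apply: qalgP => f; apply: qalgP => g.
by rewrite -linearP !qmulE -linearP pmul_linr.
Qed.
Fact qmulA : associative qmul.
Proof.
apply: qalgP => f; apply: qalgP => g; apply: qalgP => h.
by rewrite !qmulE pmulA.
Qed.
Fact qid_idem x : qmul (qid x) (qid x) = qid x.
Proof. by rewrite qmulE pid_idem. Qed.
Fact qid_orth x y : x != y -> qmul (qid x) (qid y) = 0.
Proof. by move=> n; rewrite qmulE pid_orth // linear0. Qed.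
Fact qlunit a : exists s : seq (qvert Q),
  uniq s /\ a = \sum_(x <- s) qmul (qid x) a.
Proof.
move: a; apply: qalgP => f; have [s [us e]] := plunit f.
exists s; split=> //; rewrite {1}e linear_sum.
by apply: eq_bigr => x _; rewrite qmulE.
Qed.
Fact qrunit a : exists s : seq (qvert Q),
  uniq s /\ a = \sum_(x <- s) qmul a (qid x).
Proof.
move: a; apply: qalgP => f; have [s [us e]] := prunit f.
exists s; split=> //; rewrite {1}e linear_sum.
by apply: eq_bigr => x _; rewrite qmulE.
Qed.

Definition path_quotient : lualgebra k :=
  @LUAlgebra k qalg (qvert Q) qmul qid qmul_linl qmul_linr qmulA
    qid_idem qid_orth qlunit qrunit.
End Quotient.
End PathAlgebra.

Lemma sum_supp (T : eqType) (V : nmodType) (s t : seq T) (F : T -> V) :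
  uniq s -> uniq t -> (forall y, y \notin s -> F y = 0) ->
  (forall y, y \notin t -> F y = 0) ->
  \sum_(y <- s) F y = \sum_(y <- t) F y.
Proof.
move=> us ut Fs Ft.
have H (u v : seq T) : (forall y, y \notin v -> F y = 0) ->
    \sum_(y <- u) F y = \sum_(y <- u | y \in v) F y.
  move=> Fv; rewrite [RHS]big_mkcond /=; apply: eq_bigr => y _.
  by case: ifP => // /negbT /Fv.
rewrite (H s t Ft) (H t s Fs) -[LHS]big_filter -[RHS]big_filter.
apply: perm_big.
by apply: uniq_perm; rewrite ?filter_uniq // => y; rewrite !mem_filter andbC.
Qed.

Section Modules.
Variables (k : fieldType) (A : lualgebra k).

Lemma amulDr (a b c : A) : amul a (b + c) = amul a b + amul a c.
Proof. by have := amul_linr a 1 b c; rewrite !scale1r. Qed.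
Lemma amul0 (a : A) : amul a 0 = 0.
Proof. by apply: (addrI (amul a 0)); rewrite -amulDr !addr0. Qed.
Lemma amul_sumr (a : A) (I : Type) (s : seq I) (F : I -> A) :
  amul a (\sum_(i <- s) F i) = \sum_(i <- s) amul a (F i).
Proof. exact: (big_morph (amul a) (amulDr a) (amul0 a)). Qed.
Lemma amulDl (a b c : A) : amul (b + c) a = amul b a + amul c a.
Proof. by have := amul_linl a 1 b c; rewrite !scale1r. Qed.
Lemma a0mul (a : A) : amul 0 a = 0.
Proof. by apply: (addrI (amul 0 a)); rewrite -amulDl !addr0. Qed.
Lemma amul_suml (a : A) (I : Type) (s : seq I) (F : I -> A) :
  amul (\sum_(i <- s) F i) a = \sum_(i <- s) amul (F i) a.
Proof. exact: (big_morph (fun b => amul b a) (amulDl a) (a0mul a)). Qed.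

Lemma scalar0 (f : A -> k^o) : scalar f -> f 0 = 0.
Proof.
move=> fl; have := fl 1 0 0; rewrite scale1r addr0 mul1r => e.
by apply: (addrI (f 0)); rewrite addr0 -e.
Qed.
Lemma scalar_sum (f : A -> k^o) (I : Type) (s : seq I) (F : I -> A) :
  scalar f -> f (\sum_(i <- s) F i) = \sum_(i <- s) f (F i).
Proof.
move=> fl; have fD a b : f (a + b) = f a + f b.
  by have := fl 1 a b; rewrite scale1r mul1r.
exact: (big_morph f fD (scalar0 fl)).
Qed.

(* Left modules; the last field says that M is the sum of the e_x M, which is
   then a direct sum because the e_x are orthogonal. *)
Record module := Module {
  mcar :> lmodType k;
  mact : A -> mcar -> mcar;
  mact_linl : forall m, linear (fun a => mact a m);
  mact_linr : forall a, linear (mact a);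
  mactA : forall a b m, mact (amul a b) m = mact a (mact b m);
  munital : forall m, exists s : seq (avert A),
    uniq s /\ m = \sum_(x <- s) mact (aid x) m
}.

Record hom (M N : module) := Hom {
  hfun :> M -> N;
  hom_linear : linear hfun;
  hom_act : forall a m, hfun (mact a m) = mact a (hfun m)
}.

Lemma hom_ext (M N : module) (f g : hom M N) : (forall m, f m = g m) -> f = g.
Proof.
case: f g => [f fl fa] [g gl ga] /= /funext e.
by case: _ / e in gl ga *; congr Hom; apply: Prop_irrelevance.
Qed.

Lemma homD (M N : module) (f : hom M N) x y : f (x + y) = f x + f y.
Proof. by have := hom_linear f 1 x y; rewrite !scale1r. Qed.
Lemma hom0 (M N : module) (f : hom M N) : f 0 = 0.
Proof. by apply: (addrI (f 0)); rewrite -homD !addr0. Qed.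
Lemma homZ (M N : module) (f : hom M N) c x : f (c *: x) = c *: f x.
Proof. by have := hom_linear f c x 0; rewrite !addr0 hom0 addr0. Qed.

Lemma homN (M N : module) (f : hom M N) x : f (- x) = - f x.
Proof. by rewrite -scaleN1r homZ scaleN1r. Qed.

Lemma mactD (M : module) a (x y : M) : mact a (x + y) = mact a x + mact a y.
Proof. by have := mact_linr a 1 x y; rewrite !scale1r. Qed.
Lemma mact0 (M : module) a : mact a 0 = 0 :> M.
Proof. by apply: (addrI (mact a 0)); rewrite -mactD !addr0. Qed.
Lemma mactZ (M : module) a c (x : M) : mact a (c *: x) = c *: mact a x.
Proof. by have := mact_linr a c x 0; rewrite !addr0 mact0 addr0. Qed.
Lemma mact_sum (M : module) a (I : Type) (s : seq I) (F : I -> M) :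
  mact a (\sum_(i <- s) F i) = \sum_(i <- s) mact a (F i).
Proof. exact: (big_morph (mact a) (mactD a) (mact0 M a)). Qed.
Lemma m0act (M : module) (m : M) : mact 0 m = 0.
Proof.
have := mact_linl m 1 0 0; rewrite !scale1r addr0 => e.
by apply: (addrI (mact 0 m)); rewrite addr0 -e.
Qed.

Definition hid (M : module) : hom M M :=
  @Hom M M id (fun _ _ _ => erefl) (fun _ _ => erefl).

Definition hcomp (M N L : module) (g : hom N L) (f : hom M N) : hom M L.
Proof.
exists (fun m => g (f m)).
- by move=> c x y; rewrite hom_linear hom_linear.
- by move=> a m; rewrite !hom_act.
Defined.

Definition hlin (M N : module) (c : k) (f g : hom M N) : hom M N.
Proof.
exists (fun m => c *: f m + g m).
- move=> d x y; rewrite !hom_linear !scalerDr !scalerA [c * d]mulrC.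
  by rewrite addrACA.
- by move=> a m; rewrite !hom_act mactD mactZ.
Defined.

Definition hzero (M N : module) : hom M N.
Proof.
exists (fun=> 0) => [c x y|a m]; first by rewrite scaler0 addr0.
by rewrite mact0.
Defined.

Definition hadd (M N : module) (f g : hom M N) := hlin 1 f g.
Definition hscale (M N : module) (c : k) (f : hom M N) := hlin c f (hzero M N).

Definition hiso (M N : module) (f : hom M N) :=
  exists g : hom N M, hcomp g f = hid M /\ hcomp f g = hid N.

Definition misomorphic (M N : module) := exists f : hom M N, hiso f.

Definition is_zero_module (M : module) := forall m : M, m = 0.

Lemma mid_out (M : module) (m : M) (s : seq (avert A)) x :
  m = \sum_(x <- s) mact (aid x) m -> x \notin s -> mact (aid x) m = 0.
Proof.
move=> -> xs; rewrite mact_sum big_seq big1 // => y ys.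
by rewrite -mactA aid_orth ?m0act //; apply: contraNneq xs => ->.
Qed.

Definition mdsum (M N : module) : module.
Proof.
refine (@Module (M * N)%type (fun a m => (mact a m.1, mact a m.2)) _ _ _ _).
- by move=> [m n] c a b; congr pair; rewrite /= mact_linl.
- by move=> a c [m n] [m' n']; congr pair; rewrite /= mact_linr.
- by move=> a b [m n]; rewrite /= !mactA.
- move=> [m n]; have [s [us es]] := munital m; have [t [ut et]] := munital n.
  exists (undup (s ++ t)); split; first exact: undup_uniq.
  have fstE (r : seq (avert A)) (F : avert A -> M * N) :
    (\sum_(x <- r) F x) = (\sum_(x <- r) (F x).1, \sum_(x <- r) (F x).2).
    by elim: r => [|x r IH]; rewrite ?big_nil // !big_cons IH; case: (F x).
  rewrite fstE /=; congr pair.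
  + rewrite {1}es; apply: sum_supp; rewrite ?undup_uniq // => y.
      exact: mid_out.
    by rewrite mem_undup mem_cat negb_or => /andP[ys _]; apply: (mid_out es).
  + rewrite {1}et; apply: sum_supp; rewrite ?undup_uniq // => y.
      exact: mid_out.
    by rewrite mem_undup mem_cat negb_or => /andP[_ ys]; apply: (mid_out et).
Defined.

Section Standard.
Variable x : avert A.

Definition proj_pred : {pred A} := [pred a : A | amul a (aid x) == a].
Fact proj_submod : submod_closed proj_pred.
Proof.
split=> [|c a b].
  by rewrite inE a0mul.
by rewrite !inE amul_linl => /eqP-> /eqP->.
Qed.
HB.instance Definition _ :=
  GRing.isSubmodClosed.Build k A proj_pred proj_submod.

Record proj_car := ProjCar { pval : A; pvalP : pval \in proj_pred }.
HB.instance Definition _ := [isSub for pval].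
HB.instance Definition _ := [Choice of proj_car by <:].
HB.instance Definition _ := [SubChoice_isSubLmodule of proj_car by <:].

Fact pact_subproof (a : A) (m : proj_car) : amul a (pval m) \in proj_pred.
Proof. by rewrite inE -amulA (eqP (pvalP m)). Qed.
Definition pact a m := ProjCar (pact_subproof a m).

Definition Pmod : module.
Proof.
refine (@Module proj_car pact _ _ _ _).
- by move=> m c a b; apply: val_inj; rewrite /= amul_linl.
- by move=> a c m n; apply: val_inj; rewrite /= amul_linr.
- by move=> a b m; apply: val_inj; rewrite /= amulA.
- move=> m; have [s [us e]] := alunit (pval m).
  exists s; split=> //; apply: val_inj; rewrite [RHS]raddf_sum [LHS]e.
  by apply: eq_bigr.
Defined.

(* The graded dual of the right module e_x A: linear forms f on A that factor
   through a |-> e_x a, i.e. forms on e_x A, and that vanish on A e_y for all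
   but finitely many y.  The action is (b f) a = f (a b), so that e_y I_x is
   the dual of e_x A e_y. *)
Definition inj_prop (f : A -> k^o) : Prop :=
  [/\ scalar f, forall a, f (amul (aid x) a) = f a &
      exists s : seq (avert A), forall y, y \notin s ->
        forall a, f (amul a (aid y)) = 0].
Definition inj_pred : {pred A -> k^o} := fun f => `[< inj_prop f >].
Fact inj_submod : submod_closed inj_pred.
Proof.
split=> [|c f g].
  apply/asboolP; split=> //; last by exists [::].
  by move=> c a b; rewrite /= mulr0 addr0.
move=> /asboolP[fl fx [s fs]] /asboolP[gl gx [t gt]]; apply/asboolP.
have E z : (c *: f + g) z = c * f z + g z by [].
split.
- move=> d a b; rewrite !E fl gl !mulrDr !mulrA.
  by rewrite [d * c]mulrC addrACA.
- by move=> a; rewrite !E fx gx.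
- exists (s ++ t) => y; rewrite mem_cat negb_or => /andP[ys yt] a.
  by rewrite E fs // gt // mulr0 addr0.
Qed.
HB.instance Definition _ :=
  GRing.isSubmodClosed.Build k (A -> k^o) inj_pred inj_submod.

Record inj_car := InjCar { ival : A -> k^o; ivalP : ival \in inj_pred }.
HB.instance Definition _ := [isSub for ival].
HB.instance Definition _ := [Choice of inj_car by <:].
HB.instance Definition _ := [SubChoice_isSubLmodule of inj_car by <:].

Fact iact_subproof (b : A) (f : inj_car) :
  (fun a => ival f (amul a b)) \in inj_pred.
Proof.
case: f => f /asboolP[fl fx fs] /=; apply/asboolP; split.
- by move=> c a a'; rewrite amul_linl fl.
- by move=> a; rewrite -amulA fx.
- have [s [_ e]] := alunit b; exists s => y ys a.
  suff z : amul (aid y) b = 0 by rewrite -amulA z amul0 scalar0.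
  rewrite e amul_sumr big_seq big1 // => z zs.
  by rewrite amulA aid_orth ?a0mul //; apply: contraNneq ys => ->.
Qed.
Definition iact b f := InjCar (iact_subproof b f).

Definition Imod : module.
Proof.
refine (@Module inj_car iact _ _ _ _).
- move=> [f fP] c a b; apply: val_inj; apply: funext => z /=.
  by have /asboolP[fl _ _] := fP; rewrite amul_linr fl.
- by move=> a c f g; apply: val_inj; apply: funext.
- by move=> a b f; apply: val_inj; apply: funext => z /=; rewrite amulA.
- move=> f; have /asboolP[fl fx [s fs]] := ivalP f.
  exists (undup s); split; first exact: undup_uniq.
  apply: val_inj; apply: funext => a.
  rewrite raddf_sum /= fct_sumE /=.
  have [t [ut e]] := arunit a.
  rewrite {1}e scalar_sum //; apply: sum_supp; rewrite ?undup_uniq // => y.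
  + move=> yt; suff -> : amul a (aid y) = 0 by rewrite scalar0.
    rewrite e amul_suml big_seq big1 // => z zt.
    by rewrite -amulA aid_orth ?amul0 //; apply: contraNneq yt => <-.
  + by rewrite mem_undup => /fs ->.
Defined.
End Standard.

(* Membership in the strictly additive subcategory generated by the G_i.
   A retract in Mod A is a direct summand; taking i and r mutually inverse gives
   closure under isomorphisms. *)
Inductive add_closure (I : Type) (G : I -> module) : module -> Prop :=
| add_gen i : add_closure G (G i)
| add_zero M : is_zero_module M -> add_closure G M
| add_sum M N : add_closure G M -> add_closure G N -> add_closure G (mdsum M N)
| add_summand M N (i : hom N M) (r : hom M N) :
    hcomp r i = hid N -> add_closure G M -> add_closure G N.

Definition in_proj : module -> Prop := add_closure Pmod.
Definition in_inj : module -> Prop := add_closure Imod.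

Record kfunctor (S : module -> Prop) := KFunctor {
  fobj : forall M, S M -> module;
  fmor : forall M N (sM : S M) (sN : S N), hom M N -> hom (fobj sM) (fobj sN);
  fmor_id : forall M (sM : S M), fmor sM sM (hid M) = hid (fobj sM);
  fmor_comp : forall M N L (sM : S M) (sN : S N) (sL : S L)
    (g : hom N L) (f : hom M N),
    fmor sM sL (hcomp g f) = hcomp (fmor sN sL g) (fmor sM sN f);
  fmor_lin : forall M N (sM : S M) (sN : S N) c (f g : hom M N),
    fmor sM sN (hlin c f g) = hlin c (fmor sM sN f) (fmor sM sN g)
}.

Definition linear_form (M N : module) (phi : hom M N -> k) :=
  forall c f g, phi (hlin c f g) = c * phi f + phi g.

(* [pair M sM X] is the isomorphism Hom(X, nu M) -> Hom_k (Hom(M, X), k),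
   written as a pairing; it is binatural in M in proj A and X in Mod A. *)
Definition nakayama_pairing (nu : kfunctor in_proj)
    (pair : forall M (sM : in_proj M) X, hom X (fobj nu sM) -> hom M X -> k) :=
  [/\ forall M (sM : in_proj M) X (u : hom X (fobj nu sM)),
        linear_form (pair M sM X u),
      forall M (sM : in_proj M) X c (u v : hom X (fobj nu sM)) f,
        pair M sM X (hlin c u v) f = c * pair M sM X u f + pair M sM X v f,
      forall M (sM : in_proj M) X (phi : hom M X -> k), linear_form phi ->
        exists! u : hom X (fobj nu sM), forall f, pair M sM X u f = phi f,
      forall M (sM : in_proj M) X Y (h : hom X Y) (u : hom Y (fobj nu sM))
          (f : hom M X),
        pair M sM X (hcomp u h) f = pair M sM Y u (hcomp h f) &
      forall M N (sM : in_proj M) (sN : in_proj N) X (g : hom M N)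
          (u : hom X (fobj nu sM)) (f : hom N X),
        pair N sN X (hcomp (fmor nu sM sN g) u) f = pair M sM X u (hcomp f g)].

Definition nakayama_functor (nu : kfunctor in_proj) :=
  (forall x (sP : in_proj (Pmod x)), misomorphic (fobj nu sP) (Imod x)) /\
  exists pair, @nakayama_pairing nu pair.

(* nui is a quasi-inverse of nu, viewed as an equivalence proj A -> inj A;
   eta and eps are the two natural isomorphisms. *)
Definition nakayama_quasi_inverse
    (nu : kfunctor in_proj) (nui : kfunctor in_inj) :=
  (forall x (sI : in_inj (Imod x)), misomorphic (fobj nui sI) (Pmod x)) /\
  exists (nuI : forall M (sM : in_proj M), in_inj (fobj nu sM))
         (nuiP : forall M (sM : in_inj M), in_proj (fobj nui sM)),
    (exists eta : forall M (sM : in_proj M), hom M (fobj nui (nuI M sM)),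
       (forall M (sM : in_proj M), hiso (eta M sM)) /\
       forall M N (sM : in_proj M) (sN : in_proj N) (f : hom M N),
         hcomp (fmor nui (nuI M sM) (nuI N sN) (fmor nu sM sN f)) (eta M sM)
         = hcomp (eta N sN) f) /\
    (exists eps : forall M (sM : in_inj M), hom (fobj nu (nuiP M sM)) M,
       (forall M (sM : in_inj M), hiso (eps M sM)) /\
       forall M N (sM : in_inj M) (sN : in_inj N) (f : hom M N),
         hcomp (eps N sN) (fmor nu (nuiP M sM) (nuiP N sN) (fmor nui sM sN f))
         = hcomp f (eps M sM)).
End Modules.

(* Morphisms are taken up to the equivalence [heq]. *)
Record category := Category {
  cob :> Type;
  chom : cob -> cob -> Type;
  heq : forall X Y, chom X Y -> chom X Y -> Prop;
  cid : forall X, chom X X;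
  ccomp : forall X Y Z, chom Y Z -> chom X Y -> chom X Z;
  heq_refl : forall X Y (f : chom X Y), heq f f;
  heq_sym : forall X Y (f g : chom X Y), heq f g -> heq g f;
  heq_trans : forall X Y (f g h : chom X Y), heq f g -> heq g h -> heq f h;
  heq_comp : forall X Y Z (g g' : chom Y Z) (f f' : chom X Y),
    heq g g' -> heq f f' -> heq (ccomp g f) (ccomp g' f');
  ccompA : forall X Y Z W (h : chom Z W) (g : chom Y Z) (f : chom X Y),
    heq (ccomp h (ccomp g f)) (ccomp (ccomp h g) f);
  ccomp1l : forall X Y (f : chom X Y), heq (ccomp (cid Y) f) f;
  ccomp1r : forall X Y (f : chom X Y), heq (ccomp f (cid X)) f
}.

Arguments cid {c} X.
Arguments ccomp {c X Y Z} g f.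

Definition ciso (C : category) (X Y : C) (f : chom X Y) :=
  exists g : chom Y X, heq (ccomp g f) (cid X) /\ heq (ccomp f g) (cid Y).

Record cfunctor (C D : category) := CFunctor {
  Fob :> C -> D;
  Fmap : forall X Y, chom X Y -> chom (Fob X) (Fob Y);
  Fmap_eq : forall X Y (f g : chom X Y), heq f g -> heq (Fmap f) (Fmap g);
  Fmap_id : forall X, heq (Fmap (cid X)) (cid (Fob X));
  Fmap_comp : forall X Y Z (g : chom Y Z) (f : chom X Y),
    heq (Fmap (ccomp g f)) (ccomp (Fmap g) (Fmap f))
}.

Definition full_subcat (C : category) (S : C -> Prop) : category :=
  @Category {X : C | S X} (fun X Y => chom (sval X) (sval Y))
    (fun X Y => @heq C (sval X) (sval Y)) (fun X => cid (sval X))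
    (fun X Y Z g f => ccomp g f)
    (fun _ _ => @heq_refl C _ _) (fun _ _ => @heq_sym C _ _)
    (fun _ _ => @heq_trans C _ _) (fun _ _ _ => @heq_comp C _ _ _)
    (fun _ _ _ _ => @ccompA C _ _ _ _) (fun _ _ => @ccomp1l C _ _)
    (fun _ _ => @ccomp1r C _ _).

(* The Gabriel-Zisman localization C[W^-1]: morphisms are formal composites of
   morphisms of C and of formal inverses of morphisms in W, modulo the
   congruence generated by the evident relations. *)
Section Localization.
Variables (C : category) (W : forall X Y : C, chom X Y -> Prop).

Inductive lochom : C -> C -> Type :=
| lmap X Y : chom X Y -> lochom X Y
| linv X Y (s : chom X Y) : W s -> lochom Y X
| lcomp X Y Z : lochom Y Z -> lochom X Y -> lochom X Z.

Inductive loceq : forall X Y, lochom X Y -> lochom X Y -> Prop :=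
| loceq_refl X Y (f : lochom X Y) : loceq f f
| loceq_sym X Y (f g : lochom X Y) : loceq f g -> loceq g f
| loceq_trans X Y (f g h : lochom X Y) : loceq f g -> loceq g h -> loceq f h
| loceq_comp X Y Z (g g' : lochom Y Z) (f f' : lochom X Y) :
    loceq g g' -> loceq f f' -> loceq (lcomp g f) (lcomp g' f')
| loceq_A X Y Z T (h : lochom Z T) (g : lochom Y Z) (f : lochom X Y) :
    loceq (lcomp h (lcomp g f)) (lcomp (lcomp h g) f)
| loceq_1l X Y (f : lochom X Y) : loceq (lcomp (lmap (cid Y)) f) f
| loceq_1r X Y (f : lochom X Y) : loceq (lcomp f (lmap (cid X))) f
| loceq_map X Y (f g : chom X Y) : heq f g -> loceq (lmap f) (lmap g)
| loceq_mapM X Y Z (g : chom Y Z) (f : chom X Y) :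
    loceq (lmap (ccomp g f)) (lcomp (lmap g) (lmap f))
| loceq_Vl X Y (s : chom X Y) (ws : W s) :
    loceq (lcomp (linv ws) (lmap s)) (lmap (cid X))
| loceq_Vr X Y (s : chom X Y) (ws : W s) :
    loceq (lcomp (lmap s) (linv ws)) (lmap (cid Y)).

Definition localization : category :=
  @Category C lochom loceq (fun X => lmap (cid X)) lcomp
    loceq_refl loceq_sym loceq_trans loceq_comp loceq_A loceq_1l loceq_1r.
End Localization.
Arguments lmap {C W X Y} _.

Section LocFunctor.
Variables (C D : category).
Variables (W : forall X Y : C, chom X Y -> Prop).
Variables (V : forall X Y : D, chom X Y -> Prop).
Variables (F : cfunctor C D)
  (FW : forall X Y (s : chom X Y), W s -> V (Fmap F s)).

Fixpoint locmap X Y (f : lochom W X Y) : lochom V (F X) (F Y) :=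
  match f with
  | lmap _ _ g => lmap (Fmap F g)
  | linv _ _ _ ws => linv (FW ws)
  | lcomp _ _ _ g h => lcomp (locmap g) (locmap h)
  end.

Lemma locmap_eq X Y (f g : lochom W X Y) :
  loceq f g -> loceq (locmap f) (locmap g).
Proof.
elim=> {X Y f g} /=; eauto using loceq.
- move=> X Y f; apply: loceq_trans (loceq_1l _); apply: loceq_comp.
    by apply: loceq_map; apply: Fmap_id.
  exact: loceq_refl.
- move=> X Y f; apply: loceq_trans (loceq_1r _); apply: loceq_comp.
    exact: loceq_refl.
  by apply: loceq_map; apply: Fmap_id.
- by move=> X Y f g e; apply: loceq_map; apply: Fmap_eq.
- move=> X Y Z g f; apply: loceq_trans (loceq_mapM _ _ _).
  by apply: loceq_map; apply: Fmap_comp.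
- move=> X Y s ws; apply: loceq_trans (loceq_Vl _) _.
  by apply: loceq_map; apply: heq_sym; apply: Fmap_id.
- move=> X Y s ws; apply: loceq_trans (loceq_Vr _) _.
  by apply: loceq_map; apply: heq_sym; apply: Fmap_id.
Qed.

Definition loc_functor : cfunctor (localization W) (localization V) :=
  @CFunctor (localization W) (localization V) F locmap locmap_eq
    (fun X => loceq_map V (Fmap_id F X)) (fun _ _ _ _ _ => loceq_refl _).
End LocFunctor.

Section Complexes.
Variables (k : fieldType) (A : lualgebra k).

(* Cochain complexes. Carrying the proof of i + 1 = j instead of a differential
   X^i -> X^(i+1) avoids transports in shifts and homotopies. *)
Record complex := Complex {
  cterm :> int -> module A;
  cdiff : forall i j : int, i + 1 = j -> hom (cterm i) (cterm j);
  cdiff2 : forall i j l (e : i + 1 = j) (e' : j + 1 = l) x,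
    cdiff e' (cdiff e x) = 0
}.

Record chainmap (X Y : complex) := ChainMap {
  cmap :> forall i : int, hom (X i) (Y i);
  cmap_diff : forall i j (e : i + 1 = j) x,
    cmap j (cdiff X e x) = cdiff Y e (cmap i x)
}.

Definition chid (X : complex) : chainmap X X :=
  @ChainMap X X (fun i => hid (X i)) (fun _ _ _ _ => erefl).

Definition chcomp (X Y Z : complex) (g : chainmap Y Z) (f : chainmap X Y) :
  chainmap X Z.
Proof.
exists (fun i => hcomp (g i) (f i)) => i j e x /=.
by rewrite !cmap_diff.
Defined.

Definition chzero (X Y : complex) : chainmap X Y.
Proof. by exists (fun i => hzero (X i) (Y i)) => i j e x /=; rewrite hom0. Defined.

Definition chadd (X Y : complex) (f g : chainmap X Y) : chainmap X Y.
Proof.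
exists (fun i => hadd (f i) (g i)) => i j e x /=.
by rewrite !scale1r !cmap_diff homD.
Defined.

Definition cheq (X Y : complex) (f g : chainmap X Y) :=
  forall i x, f i x = g i x.

Definition complexes : category.
Proof.
refine (@Category complex chainmap cheq chid chcomp _ _ _ _ _ _ _) => //.
- by move=> X Y f g e i x; rewrite e.
- by move=> X Y f g h e e' i x; rewrite e.
- by move=> X Y Z g g' f f' e e' i x /=; rewrite e' e.
Defined.

(* Homotopies are indexed like differentials: h^j : X^j -> Y^(j-1). *)
Definition homotopic (X Y : complex) (f g : chainmap X Y) :=
  exists h : forall i j : int, i + 1 = j -> hom (X j) (Y i),
    forall i j l (e : i + 1 = j) (e' : j + 1 = l) x,
      f j x = g j x + (cdiff Y e (h i j e x) + h j l e' (cdiff X e' x)).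

(* H^j(f) is bijective for all j. *)
Definition quasi_iso (X Y : complex) (f : chainmap X Y) :=
  forall i j l (e : i + 1 = j) (e' : j + 1 = l),
  (forall x : X j, cdiff X e' x = 0 -> (exists y, f j x = cdiff Y e y) ->
     exists z, x = cdiff X e z) /\
  (forall y : Y j, cdiff Y e' y = 0 -> exists2 x : X j, cdiff X e' x = 0 &
     exists z, f j x = y + cdiff Y e z).

Definition bounded (X : complex) :=
  exists n : nat, forall i : int, (n < `|i|)%N -> is_zero_module (X i).

Lemma addr1_shift (n i j : int) : i + 1 = j -> i + n + 1 = j + n.
Proof. by move=> <-; rewrite addrAC. Qed.

Definition shift (n : int) (X : complex) : complex.
Proof.
refine (@Complex (fun i => X (i + n))
  (fun i j e => hscale ((-1) ^+ `|n|) (cdiff X (addr1_shift n e))) _).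
by move=> i j l e e' x; rewrite /= !addr0 homZ cdiff2 !scaler0.
Defined.

Definition shift_map (n : int) (X Y : complex) (f : chainmap X Y) :
  chainmap (shift n X) (shift n Y).
Proof.
exists (fun i => f (i + n)) => i j e x /=.
by rewrite !addr0 homZ cmap_diff.
Defined.

Definition hcast (X : complex) (i j : int) (e : i = j) : hom (X i) (X j) :=
  match e with erefl => hid (X i) end.

Lemma hcast_diff (X : complex) (i i' j j' : int) (ei : i = i') (ej : j = j')
    (e : i + 1 = j) (e' : i' + 1 = j') (x : X i) :
  hcast X ej (cdiff X e x) = cdiff X e' (hcast X ei x).
Proof. by case: i' / ei e' => e'; case: j' / ej e' => e'; rewrite (eq_irrelevance e e'). Qed.

Lemma shiftVK_subproof (i : int) : i = i + 1 + -1.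
Proof. by rewrite addrK. Qed.

(* The canonical identification of X with X[-1][1]. *)
Definition shiftVK (X : complex) : chainmap X (shift 1 (shift (-1) X)).
Proof.
exists (fun i => hcast X (shiftVK_subproof i)) => i j e x /=.
rewrite !addr0 !expr1 scalerA mulrNN mulr1 scale1r.
exact: hcast_diff.
Defined.

Definition cone_diff (X Y : complex) (f : chainmap X Y) (i j : int)
    (e : i + 1 = j) : hom (mdsum (X (i + 1)) (Y i)) (mdsum (X (j + 1)) (Y j)).
Proof.
exists (fun x => (- cdiff X (addr1_shift 1 e) x.1,
                  hcast Y e (f (i + 1) x.1) + cdiff Y e x.2)).
- move=> c [x y] [x' y']; congr pair => /=.
    by rewrite hom_linear opprD scalerN.
  by rewrite !hom_linear scalerDr addrACA.
- move=> a [x y]; congr pair => /=.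
    by rewrite hom_act -scaleN1r -mactZ scaleN1r.
  by rewrite !hom_act mactD.
Defined.

Definition cone (X Y : complex) (f : chainmap X Y) : complex.
Proof.
refine (@Complex (fun i => mdsum (X (i + 1)) (Y i)) (cone_diff f) _).
move=> i j l e e' [x y] /=; congr pair.
  by rewrite homN cdiff2 !oppr0.
case: l / e'; case: j / e => /=.
rewrite !homN cmap_diff homD cdiff2 addr0.
by rewrite (eq_irrelevance (addr1_shift 1 erefl) erefl) addNr.
Defined.

Definition cone_in (X Y : complex) (f : chainmap X Y) : chainmap Y (cone f).
Proof.
unshelve refine (@ChainMap Y (cone f) (fun i =>
  @Hom k A (Y i) (mdsum (X (i + 1)) (Y i)) (fun y => (0, y)) _ _) _).
- by move=> c x y; congr pair; rewrite /= scaler0 addr0.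
- by move=> a m; congr pair; rewrite /= mact0.
- by move=> i j e x /=; congr pair; rewrite !hom0 ?oppr0 ?add0r.
Defined.

Definition cone_out (X Y : complex) (f : chainmap X Y) :
  chainmap (cone f) (shift 1 X).
Proof.
unshelve refine (@ChainMap (cone f) (shift 1 X) (fun i =>
  @Hom k A (mdsum (X (i + 1)) (Y i)) (X (i + 1)) (fun x => x.1) _ _) _) => //.
by move=> i j e x /=; rewrite addr0 expr1 scaleN1r.
Defined.

Record kb_object (S : module A -> Prop) := KbObject {
  kb_complex :> complex;
  kb_bounded : bounded kb_complex;
  kb_mem : forall i, S (kb_complex i)
}.

Definition kb_zero S (X : kb_object S) := homotopic (chid X) (chzero X X).

Definition kb_dsum S (X Y Z : kb_object S) :=
  exists (iX : chainmap X Z) (iY : chainmap Y Z)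
         (pX : chainmap Z X) (pY : chainmap Z Y),
  [/\ homotopic (chcomp pX iX) (chid X), homotopic (chcomp pY iY) (chid Y),
      homotopic (chcomp pX iY) (chzero Y X),
      homotopic (chcomp pY iX) (chzero X Y) &
      homotopic (chadd (chcomp iX pX) (chcomp iY pY)) (chid Z)].

Definition kb_indecomposable S (Z : kb_object S) :=
  ~ kb_zero Z /\
  forall X Y : kb_object S, kb_dsum X Y Z -> kb_zero X \/ kb_zero Y.

Definition kfun_complex S (F : kfunctor S) (X : complex)
  (sX : forall i, S (X i)) : complex.
Proof.
refine (@Complex (fun i => fobj F (sX i))
  (fun i j e => fmor F (sX i) (sX j) (cdiff X e)) _) => i j l e e' x.
rewrite -[LHS]/(hcomp (fmor F (sX j) (sX l) (cdiff X e'))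
  (fmor F (sX i) (sX j) (cdiff X e)) x) -fmor_comp.
have -> : hcomp (cdiff X e') (cdiff X e)
  = hlin (-1) (hzero (X i) (X l)) (hzero _ _).
  by apply: hom_ext => m /=; rewrite cdiff2 scaler0 addr0.
by rewrite fmor_lin /= scaleN1r addNr.
Defined.

Definition kfun_kb S (F : kfunctor S) (X : kb_object S) : complex :=
  kfun_complex F (@kb_mem S X).

Lemma kfun_kb_bounded S (F : kfunctor S) (X : kb_object S) :
  bounded (kfun_kb F X).
Proof.
have [n nX] := kb_bounded X; exists n => i /nX z m.
have e : hid (X i) = hlin (-1) (hid (X i)) (hid (X i)).
  by apply: hom_ext => x /=; rewrite (z x) scaler0 addr0.
rewrite -[m]/(hid (fobj F (@kb_mem S X i)) m) -fmor_id e fmor_lin /=.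
by rewrite scaleN1r addNr.
Qed.

(* D(Mod A) and D^b(Mod A) are obtained by one construction, applied to all
   complexes and to bounded complexes respectively. *)
Record complex_class := ComplexClass {
  inclass :> complex -> Prop;
  inclass_shift : forall n X, inclass X -> inclass (shift n X);
  inclass_cone : forall X Y (f : chainmap X Y),
    inclass X -> inclass Y -> inclass (cone f)
}.

Definition all_complexes : complex_class :=
  @ComplexClass (fun=> True) (fun _ _ _ => I) (fun _ _ _ _ _ => I).

Lemma bounded_shift n X : bounded X -> bounded (shift n X).
Proof.
by move=> [m mX]; exists (m + `|n|)%N => i hi; apply: mX; lia.
Qed.

Lemma bounded_cone X Y (f : chainmap X Y) :
  bounded X -> bounded Y -> bounded (cone f).
Proof.
move=> [m mX] [p pY]; exists (m + p + 1)%N => i hi [x y].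
by congr pair; [apply: mX; lia | apply: pY; lia].
Qed.

Definition bounded_complexes : complex_class :=
  ComplexClass bounded_shift bounded_cone.

Section Derived.
Variable B : complex_class.

Definition complexes_in : category := @full_subcat complexes B.

Definition qis (X Y : complexes_in) (f : chom X Y) : Prop := quasi_iso f.

(* For B := all_complexes this is D(Mod A), and for B := bounded_complexes it
   is D^b(Mod A). *)
Definition derived : category := localization qis.

Definition dmap (X Y : complexes_in) (f : chom X Y) : @chom derived X Y :=
  lmap f.

Definition dshift_ob (n : int) (X : derived) : derived :=
  exist _ (shift n (sval X)) (inclass_shift n (svalP X)).

Definition dcone (X Y : complexes_in) (f : chom X Y) : derived :=
  exist _ (cone f) (inclass_cone f (svalP X) (svalP Y)).

Definition shift_functor (n : int) : cfunctor complexes_in complexes_in.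
Proof.
refine (@CFunctor complexes_in complexes_in (dshift_ob n)
  (fun X Y f => shift_map n f) _ _ _) => //.
by move=> X Y f g e i x; apply: e.
Defined.

Lemma shift_functor_qis n X Y (f : chom X Y) :
  qis f -> qis (Fmap (shift_functor n) f).
Proof.
move=> qf i j l e e'.
have [inj sur] := qf _ _ _ (addr1_shift n e) (addr1_shift n e').
have sg : (-1 : k) ^+ `|n| * (-1) ^+ `|n| = 1.
  by rewrite -exprD addnn -mul2n exprM sqrrN expr1n expr1n.
have sg0 : (-1 : k) ^+ `|n| != 0 by rewrite signr_eq0.
split.
- move=> x /=; rewrite addr0 => /eqP; rewrite scaler_eq0 (negPf sg0) /=.
  move=> /eqP dx [y]; rewrite addr0 -homZ => ey.
  have [z ->] := inj x dx (ex_intro _ _ ey).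
  by exists ((-1) ^+ `|n| *: z); rewrite addr0 homZ scalerA sg scale1r.
- move=> y /=; rewrite addr0 => /eqP; rewrite scaler_eq0 (negPf sg0) /=.
  move=> /eqP /sur [x dx [z ez]]; exists x; first by rewrite dx scaler0 addr0.
  by exists ((-1) ^+ `|n| *: z); rewrite addr0 homZ scalerA sg scale1r.
Qed.

Definition dshift (n : int) : cfunctor derived derived :=
  loc_functor (shift_functor_qis n).

Record triangle := Triangle {
  tX : derived; tY : derived; tZ : derived;
  tu : chom tX tY;
  tv : chom tY tZ;
  tw : chom tZ (dshift 1 tX)
}.

Definition exact_triangle (T : triangle) :=
  exists (X Y : complexes_in) (f : chom X Y)
    (a : @chom derived (tX T) X) (b : @chom derived (tY T) Y)
    (c : chom (tZ T) (dcone f)),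
  [/\ ciso a, ciso b & ciso c] /\
  [/\ heq (ccomp b (tu T)) (ccomp (dmap f) a),
      heq (ccomp c (tv T)) (ccomp (@dmap Y (dcone f) (cone_in f)) b) &
      heq (ccomp (Fmap (dshift 1) a) (tw T))
          (ccomp (@dmap (dcone f) (dshift_ob 1 X) (cone_out f)) c)].
End Derived.
End Complexes.

Section AlmostSplit.
Variable C : category.

Definition is_section (X Y : C) (f : chom X Y) :=
  exists r : chom Y X, heq (ccomp r f) (cid X).
Definition is_retraction (X Y : C) (f : chom X Y) :=
  exists s : chom Y X, heq (ccomp f s) (cid Y).

Definition left_minimal (X Y : C) (f : chom X Y) :=
  forall h : chom Y Y, heq (ccomp h f) f -> ciso h.
Definition right_minimal (X Y : C) (f : chom X Y) :=
  forall h : chom X X, heq (ccomp f h) f -> ciso h.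

Definition left_almost_split (X Y : C) (f : chom X Y) :=
  ~ is_section f /\ forall (M : C) (g : chom X M), ~ is_section g ->
    exists h : chom Y M, heq g (ccomp h f).
Definition right_almost_split (X Y : C) (f : chom X Y) :=
  ~ is_retraction f /\ forall (M : C) (g : chom M Y), ~ is_retraction g ->
    exists h : chom M X, heq g (ccomp f h).

Definition min_left_almost_split (X Y : C) (f : chom X Y) :=
  left_minimal f /\ left_almost_split f.
Definition min_right_almost_split (X Y : C) (f : chom X Y) :=
  right_minimal f /\ right_almost_split f.
End AlmostSplit.

Section DerivedOfMod.
Variables (k : fieldType) (A : lualgebra k).

Definition almost_split_triangle (B : complex_class A) (T : triangle B) :=
  [/\ exact_triangle T, min_left_almost_split (tu T) &
      min_right_almost_split (tv T)].

Definition DMod : category := derived (all_complexes A).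
Definition DbMod : category := derived (bounded_complexes A).

Definition incl : cfunctor (complexes_in (bounded_complexes A))
  (complexes_in (all_complexes A)).
Proof.
by refine (@CFunctor (complexes_in (bounded_complexes A))
  (complexes_in (all_complexes A)) (fun X => exist _ (sval X) I)
  (fun X Y f => f) _ _ _).
Defined.

Definition Db_to_D : cfunctor DbMod DMod :=
  @loc_functor _ _ (@qis k A (bounded_complexes A)) (@qis k A (all_complexes A))
    incl (fun X Y s qs => qs).

Definition triangle_image (T : triangle (bounded_complexes A)) :
    triangle (all_complexes A) :=
  @Triangle k A (all_complexes A) (Db_to_D (tX T)) (Db_to_D (tY T))
    (Db_to_D (tZ T))
    (Fmap Db_to_D (tu T)) (Fmap Db_to_D (tv T)) (Fmap Db_to_D (tw T)).

Definition kb_Db S (X : kb_object S) : DbMod :=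
  exist _ (kb_complex X) (kb_bounded X).

Definition kfun_Db S (F : kfunctor S) (X : kb_object S) : DbMod :=
  exist _ (kfun_kb F X) (kfun_kb_bounded F X).

Definition Db_shift (n : int) (X : DbMod) : DbMod := dshift _ n X.

Definition Db_shiftVK (X : DbMod) : chom X (Db_shift 1 (Db_shift (-1) X)) :=
  @dmap k A (bounded_complexes A) X (Db_shift 1 (Db_shift (-1) X))
    (shiftVK (sval X)).
End DerivedOfMod.

(* Main.v *)
(* Let Z be a bounded complex of finitely generated projectives and Y its Nakayama
   transform. The pairings of the terms, summed with alternating signs, give
   Serre duality Hom_K(N, Y) = Hom_k(Hom_K(Z, N), k) for every complex N; since
   Hom_K(Z, -) inverts quasi-isomorphisms, so does Hom_K(-, Y), and maps in the
   derived category from Z and to Y are homotopy classes of chain maps.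
   Fitting's lemma makes End_K(Z) local with nilpotent radical. A linear form on
   End_K(Z) that is 1 at the identity and kills the radical is represented by a
   map w : Z -> Y, and the triangle on w is almost split: by duality w a = 0 as
   soon as all composites Z -> N -> Z through a : N -> Z are nilpotent, and
   dually at Y. An endomorphism of the middle term fixing one of the two maps is
   the identity plus a nilpotent map, whence minimality. *)

From HB Require Import structures.
From mathcomp Require Import all_boot all_order all_algebra.
From mathcomp Require Import boolp classical_sets functions zify ring.
Require Import Defs.
From Stdlib Require Import Setoid Morphisms.

Set Implicit Arguments.
Unset Strict Implicit.
Unset Printing Implicit Defensive.

Import GRing.Theory.
Local Open Scope ring_scope.

(** * Linear forms *)

(** Hom spaces to and from an arbitrary complex N may be infinite-dimensional, so the duality is
    one-sided: Hom(N, Y) is the full dual of Hom(Z, N). Hence forms have to be extended by Zorn's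
    lemma, and transposition from Y to Z rests on the one finiteness available, that of the spaces
    End(Z^i). The same duality serves (2), with Z the shifted inverse transform of the given
    complex. There indecomposability is known on the side of Y, so the dichotomy of Fitting is
    proved for Y and transposed back to Z. Morphisms of the derived category are formal words modulo
    a congruence. Nothing follows from an equality of words until some invariant of words is at
    hand, and building one is the purpose of the roofs below. Cones and cocones are all instances of
    one construction [ext w] for a map w to a shift. A strict lift to it, or a strict extension from
    it, amounts to a null-homotopy, which keeps the homotopies explicit. *)

Section LinearForms.
Variables (k : fieldType) (V : lmodType k).

Definition linear_relation (G : V -> k -> Prop) :=
  forall c x y a b, G x a -> G y b -> G (c *: x + y) (c * a + b).

Definition single_valued_at_0 (G : V -> k -> Prop) := forall a, G 0 a -> a = 0.

(** Zorn's lemma is applied to graphs: a linear relation single-valued at 0 is the graph of a form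
    on a subspace, so partial forms need no type of their own. *)
Lemma linear_relation_extend (G : V -> k -> Prop) :
  G 0 0 -> linear_relation G -> single_valued_at_0 G ->
  exists2 phi : V -> k, scalar phi & forall x a, G x a -> phi x = a.
Proof.
move=> G00 linG funG.
(* The first clause asks for G inside S only when S is inhabited, because Zorn's lemma also tests
   the empty chain, whose union is empty. *)
pose good (S : set (V * k)) :=
  [/\ forall x a y b, S (x, a) -> G y b -> S (y, b),
      linear_relation (fun x a => S (x, a)) &
      single_valued_at_0 (fun x a => S (x, a))].
have [F Fgood tot|S [[SG linS funS] maxS]] := @Zorn_bigcup _ good.
  split.
  - move=> x a y b [U FU Ux] Gy; exists U => //.
    by have [UG _ _] := Fgood _ FU; apply: UG Ux Gy.
  - move=> c x y a b [U FU Ux] [W FW Wy].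
    have [UW|WU] := tot _ _ FU FW.
      by exists W => //; have [_ lW _] := Fgood _ FW; apply: lW => //; apply: UW.
    by exists U => //; have [_ lU _] := Fgood _ FU; apply: lU => //; apply: WU.
  - by move=> a [U FU Ua]; have [_ _ fU] := Fgood _ FU; apply: fU.
have S00 : S (0, 0).
  apply: contrapT => nS; apply: (maxS (fun p => G p.1 p.2)); last first.
    by split=> //= x a y b.
  split=> [[x a] Sx|e]; first by exfalso; apply: nS; apply: SG Sx G00.
  by apply: nS; apply: (e (0, 0)).
have Sfun x a b : S (x, a) -> S (x, b) -> a = b.
  move=> Sa Sb; apply/eqP; rewrite -subr_eq0; apply/eqP/funS.
  by have := linS (-1) _ _ _ _ Sb Sa; rewrite scaleN1r addNr mulN1r addrC.
have Stot x : exists a, S (x, a).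
  apply: contrapT => nSx.
  (* If x is outside the domain, S extends by the value 0 at x, against maximality. *)
  pose S' (p : V * k) := exists (c : k) y, p.1 = c *: x + y /\ S (y, p.2).
  have SS' p : S p -> S' p.
    by case: p => y b Sy; exists 0, y; rewrite scale0r add0r.
  apply: (maxS S'); first split=> // e.
    apply: nSx; exists 0; apply: (e (x, 0)).
    by exists 1, 0; rewrite scale1r addr0.
  split.
  - by move=> z a y b _ Gy; apply: SS'; apply: SG S00 Gy.
  - move=> c z y a b [d [z' [/= -> Sz]]] [e [y' [/= -> Sy]]].
    exists (c * d + e), (c *: z' + y'); split=> /=; last exact: linS.
    by rewrite scalerDr scalerDl scalerA addrACA.
  - move=> a [c [y [/= e Sy]]].
    case: (eqVneq c 0) => [c0|nc].
      by apply: funS; move: e; rewrite c0 scale0r add0r => ->.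
    exfalso; apply: nSx; exists (- c^-1 * a).
    have -> : x = (- c^-1) *: y.
      have -> : y = - (c *: x) by apply/eqP; rewrite -addr_eq0 addrC -e.
      by rewrite scaleNr scalerN opprK scalerA mulVf ?scale1r.
    by have := linS (- c^-1) _ _ _ _ Sy S00; rewrite !addr0.
have [phi phiP] := choice Stot; exists phi.
  by move=> c x y; apply: Sfun (phiP _) _; apply: linS.
by move=> x a Gx; apply: Sfun (phiP _) _; apply: SG S00 Gx.
Qed.

(** The form extends y + a v |-> a for y in U, which is well defined because v is outside U. It
    reduces membership in a space of null-homotopic or nilpotent maps to a test by forms. *)
Lemma linear_form_separates (U : V -> Prop) v :
  U 0 -> (forall c x y, U x -> U y -> U (c *: x + y)) -> ~ U v ->
  exists phi : V -> k, [/\ scalar phi, forall x, U x -> phi x = 0 & phi v = 1].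
Proof.
move=> U0 linU nUv.
pose G x a := exists2 y, U y & x = y + a *: v.
have [||| phi phil phiG] := @linear_relation_extend G.
- by exists 0; rewrite // scale0r addr0.
- move=> c x y a b [x' Ux ->] [y' Uy ->]; exists (c *: x' + y'); first exact: linU.
  by rewrite scalerDr scalerDl scalerA addrACA.
- move=> a [y Uy /esym/eqP]; rewrite addrC addr_eq0 => /eqP e.
  apply: contrapT => /eqP na; apply: nUv.
  have -> : v = (- a^-1) *: y + 0.
    by rewrite addr0 -[y]opprK -e scalerN scaleNr opprK scalerA mulVf ?scale1r.
  exact: linU.
exists phi; split=> // [x Ux|]; apply: phiG; first by exists x; rewrite // scale0r addr0.
by exists 0; rewrite // add0r scale1r.
Qed.

Lemma linear_form_factor (U : lmodType k) (D : U -> V) (tau : U -> k) :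
  linear D -> scalar tau -> (forall u, D u = 0 -> tau u = 0) ->
  exists2 sigma : V -> k, scalar sigma & forall u, sigma (D u) = tau u.
Proof.
move=> linD lint ker.
pose G x a := exists2 u, x = D u & a = tau u.
have D0 : D 0 = 0.
  by have := linD (-1) 0 0; rewrite !scaleN1r addNr addNr.
have t0 : tau 0 = 0 by apply: ker.
have [||| phi phil phiG] := @linear_relation_extend G.
- by exists 0.
- move=> c x y a b [u -> ->] [u' -> ->]; exists (c *: u + u').
    by rewrite linD.
  by rewrite lint.
- by move=> a [u /esym/ker e ->].
by exists phi => // u; apply: phiG; exists u.
Qed.

Lemma linear_form_combination (n : nat) (psi : 'I_n -> V -> k) (phi : V -> k) :
  (forall i, scalar (psi i)) -> scalar phi ->
  (forall v, (forall i, psi i v = 0) -> phi v = 0) ->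
  exists c : 'I_n -> k, forall v, phi v = \sum_i c i * psi i v.
Proof.
elim: n psi phi => [|n IH] psi phi linpsi linphi ker.
  by exists (fun=> 0) => v; rewrite big_ord0; apply: ker; case.
have [[v0 [v0k v0n]]|none] :=
  pselect (exists v, (forall i, psi (lift ord0 i) v = 0) /\ psi ord0 v <> 0).
  (* As v0 is killed by the other forms, this is the only possible coefficient of [psi ord0];
     without such a v0, that coefficient can be taken to be 0. *)
  pose c0 := phi v0 / psi ord0 v0.
  have [|||c cP] := IH (fun i => psi (lift ord0 i)) (fun v => phi v - c0 * psi ord0 v).
  - by move=> i; apply: linpsi.
  - by move=> c x y; rewrite linphi linpsi; ring.
  - move=> v vk; set a := psi ord0 v / psi ord0 v0.
    have : phi (- a *: v0 + v) = 0.
      apply: ker => i; rewrite linpsi; case: (unliftP ord0 i) => [j ->|->].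
        by rewrite v0k vk mulr0 addr0.
      by rewrite /a mulNr divfK ?addNr //; apply/eqP.
    rewrite linphi /c0 /a => e; rewrite -[RHS]e; ring.
  exists (fun i => if unlift ord0 i is Some j then c j else c0) => v.
  rewrite big_ord_recl unlift_none.
  under eq_bigr => i _ do rewrite liftK.
  by rewrite -cP; ring.
have [|||c cP] := IH (fun i => psi (lift ord0 i)) phi.
- by move=> i; apply: linpsi.
- by [].
- move=> v vk; apply: ker => i; case: (unliftP ord0 i) => [j ->|->] //.
  by apply: contrapT => nv; apply: none; exists v.
exists (fun i => if unlift ord0 i is Some j then c j else 0) => v.
rewrite big_ord_recl unlift_none mul0r add0r.
by under eq_bigr => i _ do rewrite liftK.
Qed.
End LinearForms.

(** * Homotopy classes of chain maps *)

Section HomModule.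
Variables (k : fieldType) (A : lualgebra k).

Section Hom.
Variables M N : module A.
Implicit Types f g h : hom M N.

HB.instance Definition _ := gen_eqMixin (hom M N).
HB.instance Definition _ := gen_choiceMixin (hom M N).

Definition hopp f : hom M N := hscale (-1) f.

Fact haddA : associative (@hadd k A M N).
Proof. by move=> f g h; apply: hom_ext => m /=; rewrite !scale1r addrA. Qed.
Fact haddC : commutative (@hadd k A M N).
Proof. by move=> f g; apply: hom_ext => m /=; rewrite !scale1r addrC. Qed.
Fact hadd0 : left_id (hzero M N) (@hadd k A M N).
Proof. by move=> f; apply: hom_ext => m /=; rewrite scaler0 add0r. Qed.
Fact haddN : left_inverse (hzero M N) hopp (@hadd k A M N).
Proof.
by move=> f; apply: hom_ext => m /=; rewrite addr0 scale1r scaleN1r addNr.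
Qed.
HB.instance Definition _ := GRing.isZmodule.Build (hom M N) haddA haddC hadd0 haddN.

Lemma haddE f g m : (f + g) m = f m + g m.
Proof. by rewrite -[f m]scale1r. Qed.
Lemma hom0E m : (0 : hom M N) m = 0.
Proof. by []. Qed.

Lemma hscale_app c f m : hscale c f m = c *: f m.
Proof. exact: addr0. Qed.
Fact hscaleA c d f : hscale c (hscale d f) = hscale (c * d) f.
Proof. by apply: hom_ext => m /=; rewrite !addr0 scalerA. Qed.
Fact hscale1 : left_id 1 (@hscale k A M N).
Proof. by move=> f; apply: hom_ext => m /=; rewrite addr0 scale1r. Qed.
Fact hscaleDr : right_distributive (@hscale k A M N) +%R.
Proof.
by move=> c f g; apply: hom_ext => m; rewrite !(haddE, hscale_app) scalerDr.
Qed.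
Fact hscaleDl f : {morph (@hscale k A M N)^~ f : c d / c + d}.
Proof.
by move=> c d; apply: hom_ext => m; rewrite !(haddE, hscale_app) scalerDl.
Qed.
HB.instance Definition _ := GRing.Zmodule_isLmodule.Build k (hom M N)
  hscaleA hscale1 hscaleDr hscaleDl.

Lemma hscaleE c f m : (c *: f) m = c *: f m.
Proof. exact: addr0. Qed.
Lemma hoppE f m : (- f) m = - f m.
Proof. by rewrite -scaleN1r hscaleE scaleN1r. Qed.
Lemma hsubE f g m : (f - g) m = f m - g m.
Proof. by rewrite haddE hoppE. Qed.
Lemma hlinE c f g : hlin c f g = c *: f + g.
Proof. by apply: hom_ext => m; rewrite haddE hscaleE. Qed.
Lemma hsumE (I : Type) (r : seq I) (F : I -> hom M N) m :
  (\sum_(i <- r) F i) m = \sum_(i <- r) F i m.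
Proof. exact: (big_morph (fun f => hfun f m) (fun f g => haddE f g m) (hom0E m)). Qed.
End Hom.

Lemma hcompE (M N L : module A) (g : hom N L) (f : hom M N) m :
  hcomp g f m = g (f m).
Proof. by []. Qed.

(* Kept apart: unification unfolds [(f + g) x] into a sum of vectors, so that
   rewriting with [homlE] is only reliable after [hevE]. *)
Definition hevE := (haddE, hcompE, hom0E, hoppE, hscaleE, hsumE).
Definition homlE := (homD, hom0, homN, homZ).

Lemma homB (M N : module A) (f : hom M N) x y : f (x - y) = f x - f y.
Proof. by rewrite homD homN. Qed.

Lemma hom_sum (M N : module A) (f : hom M N) (I : Type) (r : seq I) (F : I -> M) :
  f (\sum_(i <- r) F i) = \sum_(i <- r) f (F i).
Proof. exact: (big_morph f (homD f) (hom0 f)). Qed.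

Lemma hcompA (M N L K : module A) (h : hom L K) (g : hom N L) (f : hom M N) :
  hcomp h (hcomp g f) = hcomp (hcomp h g) f.
Proof. by apply: hom_ext. Qed.
Lemma hcomp1l (M N : module A) (f : hom M N) : hcomp (hid N) f = f.
Proof. by apply: hom_ext. Qed.
Lemma hcomp1r (M N : module A) (f : hom M N) : hcomp f (hid M) = f.
Proof. by apply: hom_ext. Qed.
Lemma hcomp_linl (M N L : module A) c (g g' : hom N L) (f : hom M N) :
  hcomp (c *: g + g') f = c *: hcomp g f + hcomp g' f.
Proof. by apply: hom_ext => m; rewrite ?hevE ?homlE. Qed.
Lemma hcomp_linr (M N L : module A) c (g : hom N L) (f f' : hom M N) :
  hcomp g (c *: f + f') = c *: hcomp g f + hcomp g f'.
Proof. by apply: hom_ext => m; rewrite ?hevE ?homlE. Qed.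
Lemma hcompDl (M N L : module A) (g g' : hom N L) (f : hom M N) :
  hcomp (g + g') f = hcomp g f + hcomp g' f.
Proof. by apply: hom_ext => m; rewrite ?hevE ?homlE. Qed.
Lemma hcompDr (M N L : module A) (g : hom N L) (f f' : hom M N) :
  hcomp g (f + f') = hcomp g f + hcomp g f'.
Proof. by apply: hom_ext => m; rewrite ?hevE ?homlE. Qed.
Lemma hcomp0l (M N L : module A) (f : hom M N) : hcomp (0 : hom N L) f = 0.
Proof. by apply: hom_ext => m; rewrite ?hevE ?homlE. Qed.
Lemma hcomp0r (M N L : module A) (g : hom N L) : hcomp g (0 : hom M N) = 0.
Proof. by apply: hom_ext => m; rewrite ?hevE ?homlE. Qed.
Lemma hcompNl (M N L : module A) (g : hom N L) (f : hom M N) :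
  hcomp (- g) f = - hcomp g f.
Proof. by apply: hom_ext => m; rewrite ?hevE ?homlE. Qed.
Lemma hcompNr (M N L : module A) (g : hom N L) (f : hom M N) :
  hcomp g (- f) = - hcomp g f.
Proof. by apply: hom_ext => m; rewrite ?hevE ?homlE. Qed.

Lemma hom_from_zero (M N : module A) (f : hom M N) : is_zero_module M -> f = 0.
Proof. by move=> z; apply: hom_ext => m; rewrite [m]z ?hevE ?homlE. Qed.
Lemma hom_to_zero (M N : module A) (f : hom M N) : is_zero_module N -> f = 0.
Proof. by move=> z; apply: hom_ext => m; rewrite [f m]z. Qed.

(** Degreewise maps with no condition on differentials. Serre duality is first proved for these,
    where it splits into the single degrees, and then cut down to chain maps. *)
Definition fam (X Y : int -> module A) := forall i : int, hom (X i) (Y i).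

Section Fam.
Variables X Y : int -> module A.
Implicit Types f g : fam X Y.

HB.instance Definition _ := gen_eqMixin (fam X Y).
HB.instance Definition _ := gen_choiceMixin (fam X Y).

Definition famadd f g : fam X Y := fun i => f i + g i.
Definition famopp f : fam X Y := fun i => - f i.
Definition fam0 : fam X Y := fun i => 0.
Definition famscale (c : k) f : fam X Y := fun i => c *: f i.

Lemma fam_ext f g : (forall i, f i = g i) -> f = g.
Proof. by move=> e; apply: functional_extensionality_dep. Qed.

Fact famaddA : associative famadd.
Proof. by move=> f g h; apply: fam_ext => i; apply: addrA. Qed.
Fact famaddC : commutative famadd.
Proof. by move=> f g; apply: fam_ext => i; apply: addrC. Qed.
Fact famadd0 : left_id fam0 famadd.
Proof. by move=> f; apply: fam_ext => i; apply: add0r. Qed.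
Fact famaddN : left_inverse fam0 famopp famadd.
Proof. by move=> f; apply: fam_ext => i; apply: addNr. Qed.
HB.instance Definition _ := GRing.isZmodule.Build (fam X Y)
  famaddA famaddC famadd0 famaddN.
Fact famscaleA c d f : famscale c (famscale d f) = famscale (c * d) f.
Proof. by apply: fam_ext => i; apply: scalerA. Qed.
Fact famscale1 : left_id 1 famscale.
Proof. by move=> f; apply: fam_ext => i; apply: scale1r. Qed.
Fact famscaleDr : right_distributive famscale +%R.
Proof. by move=> c f g; apply: fam_ext => i; apply: scalerDr. Qed.
Fact famscaleDl f : {morph famscale^~ f : c d / c + d}.
Proof. by move=> c d; apply: fam_ext => i; apply: scalerDl. Qed.
HB.instance Definition _ := GRing.Zmodule_isLmodule.Build k (fam X Y)
  famscaleA famscale1 famscaleDr famscaleDl.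

Lemma fam_addE f g i : (f + g) i = f i + g i. Proof. by []. Qed.
Lemma fam_oppE f i : (- f) i = - f i. Proof. by []. Qed.
Lemma fam_zeroE i : (0 : fam X Y) i = 0. Proof. by []. Qed.
Lemma fam_scaleE c f i : (c *: f) i = c *: f i. Proof. by []. Qed.
End Fam.

Section ChainMap.
Variables X Y : complex A.
Implicit Types f g : chainmap X Y.

HB.instance Definition _ := gen_eqMixin (chainmap X Y).
HB.instance Definition _ := gen_choiceMixin (chainmap X Y).

Lemma chainmap_ext f g : (forall i x, f i x = g i x) -> f = g.
Proof.
case: f g => [f fd] [g gd] /= e.
have : f = g by apply: functional_extensionality_dep => i; apply: hom_ext.
by move=> e'; case: _ / e' in gd e *; congr ChainMap; apply: Prop_irrelevance.
Qed.

Definition chscale (c : k) f : chainmap X Y.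
Proof.
by exists (fun i => c *: f i) => i j e x; rewrite ?hevE ?homlE cmap_diff.
Defined.

Fact chaddA : associative (@chadd k A X Y).
Proof. by move=> f g h; apply: chainmap_ext => i x /=; rewrite !scale1r addrA. Qed.
Fact chaddC : commutative (@chadd k A X Y).
Proof. by move=> f g; apply: chainmap_ext => i x /=; rewrite !scale1r addrC. Qed.
Fact chadd0 : left_id (chzero X Y) (@chadd k A X Y).
Proof. by move=> f; apply: chainmap_ext => i x /=; rewrite scaler0 add0r. Qed.
Fact chaddN : left_inverse (chzero X Y) (chscale (-1)) (@chadd k A X Y).
Proof.
by move=> f; apply: chainmap_ext => i x /=; rewrite scale1r addr0 scaleN1r addNr.
Qed.
HB.instance Definition _ := GRing.isZmodule.Build (chainmap X Y)
  chaddA chaddC chadd0 chaddN.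

Lemma chaddE f g i : (f + g) i = f i + g i.
Proof. by []. Qed.
Lemma ch0E i : (0 : chainmap X Y) i = 0.
Proof. by []. Qed.

Fact chscaleA c d f : chscale c (chscale d f) = chscale (c * d) f.
Proof. by apply: chainmap_ext => i x /=; rewrite !addr0 scalerA. Qed.
Fact chscale1 : left_id 1 chscale.
Proof. by move=> f; apply: chainmap_ext => i x /=; rewrite addr0 scale1r. Qed.
Fact chscaleDr : right_distributive chscale +%R.
Proof.
by move=> c f g; apply: chainmap_ext => i x; rewrite chaddE [LHS]hscaleE ?hevE ?homlE scalerDr.
Qed.
Fact chscaleDl f : {morph chscale^~ f : c d / c + d}.
Proof.
by move=> c d; apply: chainmap_ext => i x; rewrite chaddE [LHS]hscaleE ?hevE ?homlE scalerDl.
Qed.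
HB.instance Definition _ := GRing.Zmodule_isLmodule.Build k (chainmap X Y)
  chscaleA chscale1 chscaleDr chscaleDl.

Lemma chscaleE c f i : (c *: f) i = c *: f i.
Proof. by []. Qed.
Lemma choppE f i : (- f) i = - f i.
Proof. by rewrite -scaleN1r chscaleE scaleN1r. Qed.
End ChainMap.

Lemma chcompE (X Y Z : complex A) (g : chainmap Y Z) (f : chainmap X Y) i :
  chcomp g f i = hcomp (g i) (f i).
Proof. by []. Qed.
Definition chE := (chaddE, chcompE, ch0E, choppE, chscaleE).

Lemma chsubE (X Y : complex A) (f g : chainmap X Y) i x :
  (f - g) i x = f i x - g i x.
Proof. by rewrite !(chE, hevE). Qed.

Lemma cmap_hcomp (X Y : complex A) (f : chainmap X Y) i j (e : i + 1 = j) :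
  hcomp (f j) (cdiff X e) = hcomp (cdiff Y e) (f i).
Proof. by apply: hom_ext => x /=; rewrite cmap_diff. Qed.

Section CompLemmas.
Variables X Y Z W : complex A.
Implicit Types (f : chainmap X Y) (g : chainmap Y Z) (h : chainmap Z W).

Lemma chcompA h g f : chcomp h (chcomp g f) = chcomp (chcomp h g) f.
Proof. by apply: chainmap_ext => i x; rewrite ?(chE, hevE) ?homlE. Qed.
Lemma chcomp1l f : chcomp (chid Y) f = f.
Proof. by apply: chainmap_ext => i x; rewrite ?(chE, hevE) ?homlE. Qed.
Lemma chcomp1r f : chcomp f (chid X) = f.
Proof. by apply: chainmap_ext => i x; rewrite ?(chE, hevE) ?homlE. Qed.
Lemma chcompDl g g' f : chcomp (g + g') f = chcomp g f + chcomp g' f.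
Proof. by apply: chainmap_ext => i x; rewrite ?(chE, hevE) ?homlE. Qed.
Lemma chcompDr g f f' : chcomp g (f + f') = chcomp g f + chcomp g f'.
Proof. by apply: chainmap_ext => i x; rewrite ?(chE, hevE) ?homlE. Qed.
Lemma chcompNl g f : chcomp (- g) f = - chcomp g f.
Proof. by apply: chainmap_ext => i x; rewrite ?(chE, hevE) ?homlE. Qed.
Lemma chcompNr g f : chcomp g (- f) = - chcomp g f.
Proof. by apply: chainmap_ext => i x; rewrite ?(chE, hevE) ?homlE. Qed.
Lemma chcompZl c g f : chcomp (c *: g) f = c *: chcomp g f.
Proof. by apply: chainmap_ext => i x; rewrite ?(chE, hevE) ?homlE. Qed.
Lemma chcompZr c g f : chcomp g (c *: f) = c *: chcomp g f.
Proof. by apply: chainmap_ext => i x; rewrite ?(chE, hevE) ?homlE. Qed.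
Lemma chcomp0l f : chcomp (0 : chainmap Y Z) f = 0.
Proof. by apply: chainmap_ext => i x; rewrite ?(chE, hevE) ?homlE. Qed.
Lemma chcomp0r g : chcomp g (0 : chainmap X Y) = 0.
Proof. by apply: chainmap_ext => i x; rewrite ?(chE, hevE) ?homlE. Qed.
End CompLemmas.

Definition nullhom (X Y : complex A) (f : chainmap X Y) := homotopic f 0.

Section Null.
Variables X Y : complex A.
Implicit Types f g : chainmap X Y.

Lemma nullhomP f : nullhom f <->
  exists h : forall i j : int, i + 1 = j -> hom (X j) (Y i),
    forall i j l (e : i + 1 = j) (e' : j + 1 = l) x,
      f j x = cdiff Y e (h i j e x) + h j l e' (cdiff X e' x).
Proof.
by split=> -[h hh]; exists h => i j l e e' x; rewrite (hh _ _ _ e e') ?chE /= add0r.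
Qed.

Lemma nullhom_lin c f g : nullhom f -> nullhom g -> nullhom (c *: f + g).
Proof.
move=> /nullhomP[h hh] /nullhomP[h' hh']; apply/nullhomP.
exists (fun i j e => c *: h i j e + h' i j e) => i j l e e' x.
by rewrite ?(chE, hevE) ?homlE (hh _ _ _ e e') (hh' _ _ _ e e') scalerDr addrACA.
Qed.
Lemma nullhom0 : nullhom (0 : chainmap X Y).
Proof.
by apply/nullhomP; exists (fun _ _ _ => 0) => i j l e e' x; rewrite ?hevE ?homlE addr0.
Qed.
Lemma nullhomZ c f : nullhom f -> nullhom (c *: f).
Proof. by move=> nf; rewrite -[c *: f]addr0; apply: nullhom_lin nf nullhom0. Qed.
Lemma nullhomD f g : nullhom f -> nullhom g -> nullhom (f + g).
Proof. by rewrite -{2}[f]scale1r; apply: nullhom_lin. Qed.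
Lemma nullhomN f : nullhom f -> nullhom (- f).
Proof. by rewrite -scaleN1r; apply: nullhomZ. Qed.

Lemma homotopicE f g : homotopic f g <-> nullhom (f - g).
Proof.
rewrite nullhomP; split=> -[h hh]; exists h => i j l e e' x.
  by rewrite ?(chE, hevE) ?homlE (hh _ _ _ e e') addrC addKr.
have := hh _ _ _ e e' x; rewrite ?(chE, hevE) ?homlE => <-.
by rewrite addrC subrK.
Qed.

Lemma homotopic_nullhom f g : homotopic f g -> nullhom (f - g).
Proof. by case: (homotopicE f g). Qed.
Lemma nullhom_homotopic f g : nullhom (f - g) -> homotopic f g.
Proof. by case: (homotopicE f g). Qed.
End Null.

Lemma nullhom_compl (X Y Z : complex A) (g : chainmap Y Z) (f : chainmap X Y) :
  nullhom f -> nullhom (chcomp g f).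
Proof.
move=> /nullhomP[h hh]; apply/nullhomP.
exists (fun i j e => hcomp (g i) (h i j e)) => i j l e e' x /=.
by rewrite (hh _ _ _ e e') homD cmap_diff.
Qed.
Lemma nullhom_compr (X Y Z : complex A) (g : chainmap Y Z) (f : chainmap X Y) :
  nullhom g -> nullhom (chcomp g f).
Proof.
move=> /nullhomP[h hh]; apply/nullhomP.
exists (fun i j e => hcomp (h i j e) (f j)) => i j l e e' x /=.
by rewrite (hh _ _ _ e e') cmap_diff.
Qed.

Lemma homotopic_refl (X Y : complex A) (f : chainmap X Y) : homotopic f f.
Proof. by apply: nullhom_homotopic; rewrite subrr; apply: nullhom0. Qed.
Lemma homotopic_sym (X Y : complex A) (f g : chainmap X Y) : homotopic f g -> homotopic g f.
Proof. by move/homotopic_nullhom/nullhomN; rewrite opprB => /nullhom_homotopic. Qed.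
Lemma homotopic_trans (X Y : complex A) (f g h : chainmap X Y) :
  homotopic f g -> homotopic g h -> homotopic f h.
Proof.
move=> /homotopic_nullhom n1 /homotopic_nullhom n2; apply: nullhom_homotopic.
by rewrite -(subrKA g); apply: nullhomD.
Qed.
Lemma homotopic_comp (X Y Z : complex A) (g g' : chainmap Y Z) (f f' : chainmap X Y) :
  homotopic g g' -> homotopic f f' -> homotopic (chcomp g f) (chcomp g' f').
Proof.
move=> /homotopic_nullhom n1 /homotopic_nullhom n2; apply: nullhom_homotopic.
have -> : chcomp g f - chcomp g' f' = chcomp (g - g') f + chcomp g' (f - f').
  by rewrite chcompDl chcompDr chcompNl chcompNr addrA subrK.
by apply: nullhomD; [apply: nullhom_compr | apply: nullhom_compl].
Qed.
Lemma homotopicD (X Y : complex A) (f f' g g' : chainmap X Y) :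
  homotopic f f' -> homotopic g g' -> homotopic (f + g) (f' + g').
Proof.
move=> /homotopic_nullhom n1 /homotopic_nullhom n2; apply: nullhom_homotopic.
by rewrite opprD addrACA; apply: nullhomD.
Qed.

Lemma nullhom_eq (X Y : complex A) (f g : chainmap X Y) : homotopic f g -> nullhom g -> nullhom f.
Proof. exact: homotopic_trans. Qed.

#[export] Instance homotopic_equivalence (X Y : complex A) :
  Equivalence (@homotopic k A X Y).
Proof.
split; first exact: homotopic_refl.
  exact: homotopic_sym.
exact: homotopic_trans.
Qed.
#[export] Instance chcomp_proper (X Y Z : complex A) :
  Proper (@homotopic k A Y Z ==> @homotopic k A X Y ==> @homotopic k A X Z)
    (@chcomp k A X Y Z).
Proof. by move=> g g' eg f f' ef; apply: homotopic_comp. Qed.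
#[export] Instance homotopicD_proper (X Y : complex A) :
  Proper (@homotopic k A X Y ==> @homotopic k A X Y ==> @homotopic k A X Y)
    (@GRing.add (chainmap X Y)).
Proof. by move=> g g' eg f f' ef; apply: homotopicD. Qed.
#[export] Instance nullhom_proper (X Y : complex A) :
  Proper (@homotopic k A X Y ==> iff) (@nullhom X Y).
Proof. by move=> g g' eg; split; apply: nullhom_eq => //; apply: homotopic_sym. Qed.
End HomModule.

(** * Extensions of complexes *)

Lemma int_succ (i : int) : exists i', i' + 1 = i.
Proof. by exists (i - 1); rewrite subrK. Qed.

(** Homotopies are indexed by pairs i, i + 1 and so produce families in degree i + 1 only. The
    transport to an arbitrary degree is confined to this lemma. *)
Lemma reindex_succ (T : int -> Type) (f : forall i, T (i + 1)) :
  exists g : forall j, T j, forall i, g (i + 1) = f i.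
Proof.
exists (fun j => eq_rect _ T (f (j - 1)) j (subrK 1 j)) => i.
move: (i + 1 - 1) (addrK 1 i) (subrK 1 (i + 1)) => i' -> e.
by rewrite (eq_irrelevance e erefl).
Qed.

Section Extensions.
Variables (k : fieldType) (A : lualgebra k).
Implicit Types X Y Z N : complex A.

Definition hpair (L M N : module A) (f : hom L M) (g : hom L N) :
  hom L (mdsum M N).
Proof.
exists (fun x => (f x, g x)) => [c x y|a x].
  by rewrite !hom_linear.
by rewrite !hom_act.
Defined.

Definition hfst (M N : module A) : hom (mdsum M N) M.
Proof. by exists (fun x => x.1). Defined.
Definition hsnd (M N : module A) : hom (mdsum M N) N.
Proof. by exists (fun x => x.2). Defined.

Lemma pair_eq (M N : module A) (p q : mdsum M N) : p.1 = q.1 -> p.2 = q.2 -> p = q.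
Proof. by case: p q => [? ?] [? ?] /= -> ->. Qed.

Lemma cdiff_irr X i j (e e' : i + 1 = j) : cdiff X e = cdiff X e'.
Proof. by rewrite (eq_irrelevance e e'). Qed.

Lemma shift1_diffE X i j (e : i + 1 = j) (x : shift 1 X i) :
  cdiff (shift 1 X) e x = - cdiff X (addr1_shift 1 e) x.
Proof. by rewrite /= addr0 expr1 scaleN1r. Qed.

Lemma nullhomS X Y (f : chainmap X Y) : nullhom f <->
  exists h : forall i, hom (X (i + 1)) (Y i), forall i x,
    f (i + 1) x = cdiff Y erefl (h i x) + h (i + 1) (cdiff X erefl x).
Proof.
rewrite nullhomP; split=> -[h hh].
  by exists (fun i => h i (i + 1) erefl) => i x; apply: hh.
exists (fun i j e => match e in _ = j return hom (X j) (Y i) with erefl => h i end).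
by move=> i j l e e'; case: l / e'; case: j / e => x; apply: hh.
Qed.

Lemma nullhom_shiftS X Y (f : chainmap X (shift 1 Y)) : nullhom f <->
  exists h : forall i, hom (X (i + 1)) (Y (i + 1)), forall i x,
    f (i + 1) x = - cdiff Y erefl (h i x) + h (i + 1) (cdiff X erefl x).
Proof.
rewrite nullhomS; split=> -[h hh]; exists h => i x.
  by rewrite hh shift1_diffE (cdiff_irr _ (addr1_shift 1 erefl) erefl).
by rewrite shift1_diffE (cdiff_irr _ (addr1_shift 1 erefl) erefl) -hh.
Qed.

Lemma chainmapS X Y (f : forall i, hom (X i) (Y i)) :
  (forall i x, f (i + 1) (cdiff X erefl x) = cdiff Y erefl (f i x)) ->
  exists g : chainmap X Y, forall i, g i = f i.
Proof.
move=> fd; have fd' i j (e : i + 1 = j) x : f j (cdiff X e x) = cdiff Y e (f i x).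
  by case: j / e.
by exists (ChainMap fd').
Qed.

Section Extension.
Variables (Z X : complex A) (w : chainmap Z (shift 1 X)).

(** The square vanishes because w, being a chain map to X[1], anticommutes with the differentials.
    With this sign of w, z |-> (w z, (z, 0)) is a chain map from Z to the cone of X -> [ext w], so
    that the triangle ends in w and not in -w. *)
Definition ext_diff (i j : int) (e : i + 1 = j) :
    hom (mdsum (Z i) (X i)) (mdsum (Z j) (X j)) :=
  hpair (hcomp (cdiff Z e) (hfst _ _))
    (hcomp (cdiff X e) (hsnd _ _) - hcomp (hcast X e) (hcomp (w i) (hfst _ _))).

Lemma ext_diffE i j (e : i + 1 = j) p :
  ext_diff e p = (cdiff Z e p.1, cdiff X e p.2 - hcast X e (w i p.1)).
Proof. by apply: pair_eq; last exact: hsubE. Qed.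

Lemma ext_w_diff i (z : Z i) :
  w (i + 1) (cdiff Z erefl z) = - cdiff X erefl (w i z).
Proof.
by rewrite cmap_diff shift1_diffE (cdiff_irr _ (addr1_shift 1 erefl) erefl).
Qed.

(* The cocone of w: the middle term of a triangle X -> ext w -> Z -> X[1]. *)
Definition ext : complex A.
Proof.
refine (@Complex k A (fun i => mdsum (Z i) (X i)) ext_diff _).
move=> i j l e e' p; case: l / e'; case: j / e; rewrite !ext_diffE /=.
apply: pair_eq => /=; first exact: cdiff2.
by rewrite ext_w_diff opprK homB cdiff2 sub0r addNr.
Defined.

Lemma ext_cdiffE i j (e : i + 1 = j) p :
  cdiff ext e p = (cdiff Z e p.1, cdiff X e p.2 - hcast X e (w i p.1)).
Proof. exact: ext_diffE. Qed.

Definition ext_in : chainmap X ext.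
Proof.
exists (fun i => hpair (hzero (X i) (Z i)) (hid (X i))) => i j e x.
by rewrite ext_cdiffE; apply: pair_eq; rewrite /= ?hom0 ?subr0.
Defined.

Definition ext_out : chainmap ext Z.
Proof. by exists (fun i => hfst (Z i) (X i)). Defined.

Lemma ext_out_in : chcomp ext_out ext_in = 0.
Proof. by apply: chainmap_ext. Qed.

Lemma ext_w_out_null : nullhom (chcomp w ext_out).
Proof.
apply/nullhom_shiftS; exists (fun i => - hsnd (Z (i + 1)) (X (i + 1))) => i p.
rewrite ext_cdiffE !(chE, hevE) !homlE /= opprK opprB.
by rewrite addrCA subrr addr0.
Qed.

Lemma ext_in_w_null : nullhom (chcomp (shift_map 1 ext_in) w).
Proof.
apply/nullhom_shiftS.
exists (fun i => hpair (hid (Z (i + 1))) (hzero (Z (i + 1)) (X (i + 1)))) => i z.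
by rewrite ext_cdiffE; apply: pair_eq; rewrite /= ?hom0 ?sub0r ?opprK ?addr0 ?addNr.
Qed.

(** The condition on the missing component N -> X is that it be, up to sign, a null-homotopy of w a;
    hence the lift is strict and not only up to homotopy. *)
Lemma ext_lift_out N (a : chainmap N Z) : nullhom (chcomp w a) ->
  exists a' : chainmap N ext, chcomp ext_out a' = a.
Proof.
move=> /nullhom_shiftS[h hh].
have [c cE] := @reindex_succ (fun j => hom (N j) (X j)) (fun i => - h i).
have [|a' a'E] := @chainmapS N ext (fun j => hpair (a j) (c j)).
  move=> i n; rewrite ext_cdiffE; apply: pair_eq => /=; first exact: cmap_diff.
  have [i' ei] := int_succ i; case: i / ei n => n.
  rewrite !cE !hevE homN; have := hh _ n; rewrite chE hevE => ->.
  by rewrite opprD opprK addKr.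
by exists a'; apply: chainmap_ext => i x; rewrite !chE a'E.
Qed.

Lemma ext_desc_in N (g : chainmap X N) : nullhom (chcomp (shift_map 1 g) w) ->
  exists g' : chainmap ext N, chcomp g' ext_in = g.
Proof.
move=> /nullhom_shiftS[h hh].
have [c cE] := @reindex_succ (fun j => hom (Z j) (N j)) h.
have [|g' g'E] := @chainmapS ext N (fun j => hcomp (g j) (hsnd _ _) + hcomp (c j) (hfst _ _)).
  move=> i p; rewrite ext_cdiffE !hevE /= homB homD cmap_diff.
  have [i' ei] := int_succ i; case: i / ei p => p.
  rewrite !cE; have := hh _ p.1; rewrite chE hevE /= => ->.
  by rewrite opprD opprK -[LHS]addrA subrK.
by exists g'; apply: chainmap_ext => i x; rewrite !chE hevE g'E !hevE /= hom0 addr0.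
Qed.

(** Subtracting the homotopy (h, 0) kills the component of a in Z. Since the differential of [ext]
    sends (z, 0) to (d z, - w z), the component in X is changed by w h. *)
Lemma ext_factor_in N (a : chainmap N ext) : nullhom (chcomp ext_out a) ->
  exists b : chainmap N X, homotopic a (chcomp ext_in b).
Proof.
move=> /nullhomS[h hh].
have [c cE] := @reindex_succ (fun j => hom (N j) (X j))
  (fun i => hcomp (w i) (h i)).
have h1 i (n : N (i + 1)) : (a (i + 1) n).1 =
    cdiff Z erefl (h i n) + h _ (cdiff N erefl n) by exact: hh.
have [|b bE] := @chainmapS N X (fun j => hcomp (hsnd _ _) (a j) + c j).
  move=> i n; rewrite !hevE homD.
  have [i' ei] := int_succ i; case: i / ei n => n.
  rewrite !cE !hevE cmap_diff ext_cdiffE /= h1 homD ext_w_diff opprD opprK.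
  by rewrite -[LHS]addrA subrK.
exists b; apply: nullhom_homotopic; apply/nullhomS.
exists (fun i => hpair (h i) (hzero _ _)) => i n.
rewrite ext_cdiffE !(chE, hevE) bE !hevE; apply: pair_eq => /=.
  by rewrite subr0 h1.
by rewrite hom0 cE !hevE sub0r addr0 opprD addNKr.
Qed.

Definition ext_fst i : hom (Z i) (ext i) := hpair (hid _) (hzero _ _).

Lemma ext_split i (p : ext i) : p = ext_fst i p.1 + ext_in i p.2.
Proof. by apply: pair_eq; rewrite /= ?addr0 ?add0r. Qed.

Lemma ext_diff_fst i (z : Z i) : cdiff ext erefl (ext_fst i z) =
  ext_fst _ (cdiff Z erefl z) - ext_in _ (w i z).
Proof.
by rewrite ext_cdiffE; apply: pair_eq; rewrite /= ?hom0 ?subr0 ?sub0r ?add0r.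
Qed.

(** Dually, subtracting the homotopy h on the summand X leaves a map that vanishes on X, and the
    differential adds h w to its restriction to Z. *)
Lemma ext_factor_out N (g : chainmap ext N) : nullhom (chcomp g ext_in) ->
  exists b : chainmap Z N, homotopic g (chcomp b ext_out).
Proof.
move=> /nullhomS[h hh].
have h1 i (x : X (i + 1)) : g (i + 1) (ext_in _ x) =
    cdiff N erefl (h i x) + h _ (cdiff X erefl x) by exact: hh.
have [|b bE] := @chainmapS Z N (fun j => hcomp (g j) (ext_fst j) + hcomp (h j) (w j)).
  move=> i z; rewrite !hevE homD -cmap_diff ext_diff_fst homB h1.
  rewrite ext_w_diff homN opprD -[RHS]addrA [in RHS]addrAC addNr add0r.
  by [].
exists b; apply: nullhom_homotopic; apply/nullhomS.
exists (fun i => hcomp (h i) (hsnd _ _)) => i p.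
rewrite !(chE, hevE) bE ?hevE ext_cdiffE {1}[p]ext_split homD h1 /= homB.
by rewrite opprD addrACA subrr add0r; apply/esym/addrA.
Qed.

(** A null-homotopy of a map out of [ext] that vanishes on X restricts on X, up to sign, to a chain
    map X[1] -> N; on Z it is the homotopy sought. The next lemma is dual. *)
Lemma ext_factor_w N (g : chainmap Z N) : nullhom (chcomp g ext_out) ->
  exists b : chainmap (shift 1 X) N, homotopic g (chcomp b w).
Proof.
move=> /nullhomS[h hh].
have h1 i (p : ext (i + 1)) : g (i + 1) p.1 =
    cdiff N erefl (h i p) + h _ (cdiff ext erefl p) by exact: hh.
have h2 i (x : X (i + 1)) : cdiff N erefl (h i (ext_in _ x)) =
    - h _ (ext_in _ (cdiff X erefl x)).
  by apply/eqP; rewrite -addr_eq0 cmap_diff -h1 /= hom0.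
have [|b bE] := @chainmapS (shift 1 X) N (fun i => - hcomp (h i) (ext_in (i + 1))).
  move=> i y; rewrite shift1_diffE !hevE !homN h2 opprK.
  by rewrite (cdiff_irr _ (addr1_shift 1 erefl) erefl) opprK.
exists b; apply: nullhom_homotopic; apply/nullhomS.
exists (fun i => hcomp (h i) (ext_fst _)) => i z.
rewrite !(chE, hevE) bE -[z in g _ z]/((ext_fst _ z).1) h1 ext_diff_fst homB !hevE.
by rewrite opprK -[LHS]addrA subrK.
Qed.

Lemma ext_lift_w N (a : chainmap N (shift 1 X)) :
  nullhom (chcomp (shift_map 1 ext_in) a) ->
  exists b : chainmap N Z, homotopic a (chcomp w b).
Proof.
move=> /nullhom_shiftS[h hh].
have h1 i (n : N (i + 1)) : ext_in _ (a (i + 1) n) =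
    - cdiff ext erefl (h i n) + h _ (cdiff N erefl n) by exact: hh.
have [c cE] := @reindex_succ (fun j => hom (N j) (Z j)) (fun i => hcomp (hfst _ _) (h i)).
have [|b bE] := @chainmapS N Z c.
  move=> i n; have [i' ei] := int_succ i; case: i / ei n => n.
  rewrite !cE !hevE /=; have /(congr1 fst) := h1 _ n; rewrite ext_cdiffE /=.
  by move/esym/(canRL (addNKr _)); rewrite addr0.
exists b; apply: nullhom_homotopic; apply/nullhom_shiftS.
exists (fun i => hcomp (hsnd _ _) (h i)) => i n.
have /(congr1 snd) := h1 _ n; rewrite ext_cdiffE !(chE, hevE) bE cE !hevE /= => ->.
by rewrite opprB -[X in X - _ = _]addrA [LHS]addrAC subrr add0r.
Qed.
End Extension.
End Extensions.

(** * Shifts, acyclic complexes and quasi-isomorphisms *)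

Section Shift.
Variables (k : fieldType) (A : lualgebra k).
Implicit Types X Y Z N : complex A.

Lemma shift_map_comp X Y Z (g : chainmap Y Z) (f : chainmap X Y) :
  shift_map 1 (chcomp g f) = chcomp (shift_map 1 g) (shift_map 1 f).
Proof. exact: chainmap_ext. Qed.

Lemma shift_map_id X : shift_map 1 (chid X) = chid (shift 1 X).
Proof. exact: chainmap_ext. Qed.

Lemma shift_mapB X Y (f g : chainmap X Y) :
  shift_map 1 (f - g) = shift_map 1 f - shift_map 1 g.
Proof.
by apply: chainmap_ext => i x; rewrite [RHS]chsubE; exact: (@chsubE k A X Y f g (i + 1) x).
Qed.

Lemma shift_map_full X Y (f : chainmap (shift 1 X) (shift 1 Y)) :
  exists g : chainmap X Y, shift_map 1 g = f.
Proof.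
have [c cE] := @reindex_succ (fun j => hom (X j) (Y j)) f.
have [|g gE] := @chainmapS k A X Y c.
  move=> i x; have [i' ei] := int_succ i; case: i / ei x => x.
  rewrite !cE; apply: oppr_inj; rewrite -homN.
  have := @cmap_diff _ _ _ _ f i' _ erefl x; rewrite !shift1_diffE.
  by rewrite !(cdiff_irr _ (addr1_shift 1 erefl) erefl).
by exists g; apply: chainmap_ext => i x /=; rewrite gE cE.
Qed.

Lemma nullhom_shift X Y (f : chainmap X Y) : nullhom f -> nullhom (shift_map 1 f).
Proof.
move=> /nullhomS[h hh]; apply/nullhom_shiftS.
exists (fun i => - h (i + 1)) => i x.
rewrite shift1_diffE (cdiff_irr _ (addr1_shift 1 erefl) erefl) !hevE !homlE !opprK.
exact: hh.
Qed.

Lemma nullhom_unshift X Y (f : chainmap X Y) : nullhom (shift_map 1 f) -> nullhom f.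
Proof.
move=> /nullhom_shiftS[h hh]; apply/nullhomS.
have [c cE] := @reindex_succ (fun i => hom (X (i + 1)) (Y i)) (fun i => - h i).
exists c => i x; have [i' ei] := int_succ i; case: i / ei x => x.
rewrite !cE !hevE !homlE; have := hh _ x.
by rewrite shift1_diffE (cdiff_irr _ (addr1_shift 1 erefl) erefl) homN.
Qed.

Lemma homotopic_shift X Y (f g : chainmap X Y) :
  homotopic f g -> homotopic (shift_map 1 f) (shift_map 1 g).
Proof.
move=> /homotopic_nullhom/nullhom_shift; rewrite shift_mapB.
exact: nullhom_homotopic.
Qed.

Lemma homotopic_unshift X Y (f g : chainmap X Y) :
  homotopic (shift_map 1 f) (shift_map 1 g) -> homotopic f g.
Proof.
move=> /homotopic_nullhom; rewrite -shift_mapB => /nullhom_unshift.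
exact: nullhom_homotopic.
Qed.

Definition shiftVK_inv X : chainmap (shift 1 (shift (-1) X)) X.
Proof.
exists (fun i => hcast X (esym (shiftVK_subproof i))) => i j e x /=.
rewrite !addr0 !expr1 scalerA mulrNN mulr1 scale1r.
exact: hcast_diff.
Defined.

Lemma hcastK X i j (e : i = j) x : hcast X (esym e) (hcast X e x) = x.
Proof. by case: j / e. Qed.
Lemma hcastVK X i j (e : i = j) x : hcast X e (hcast X (esym e) x) = x.
Proof. by case: j / e x. Qed.

Lemma shiftVKK X : chcomp (shiftVK_inv X) (shiftVK X) = chid X.
Proof. by apply: chainmap_ext => i x /=; rewrite hcastK. Qed.
Lemma shiftVK_invK X : chcomp (shiftVK X) (shiftVK_inv X) = chid _.
Proof. by apply: chainmap_ext => i x /=; rewrite hcastVK. Qed.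

Lemma nullhom_shiftVK X N (f : chainmap N X) :
  nullhom (chcomp (shiftVK X) f) -> nullhom f.
Proof.
move=> /(nullhom_compl (shiftVK_inv X)).
by rewrite chcompA shiftVKK chcomp1l.
Qed.

Definition acyclic X := forall i (x : X (i + 1)),
  cdiff X erefl x = 0 -> exists y : X i, x = cdiff X erefl y.

Lemma acyclicP X : acyclic X <-> forall i j l (e : i + 1 = j) (e' : j + 1 = l) (x : X j),
  cdiff X e' x = 0 -> exists y : X i, x = cdiff X e y.
Proof.
split=> H; last by move=> i x; apply: H.
by move=> i j l e e'; case: l / e'; case: j / e; apply: H.
Qed.

Lemma acyclic_shift n X : acyclic X -> acyclic (shift n X).
Proof.
move=> /acyclicP aX; apply/acyclicP => i j l e e' x.
have sg : (-1 : k) ^+ `|n| * (-1) ^+ `|n| = 1.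
  by rewrite -exprD addnn -mul2n exprM sqrrN expr1n expr1n.
rewrite /= addr0 => /eqP; rewrite scaler_eq0 signr_eq0 /= => /eqP.
move=> /(aX _ _ _ (addr1_shift n e))[y ->].
by exists ((-1) ^+ `|n| *: y); rewrite addr0 homZ scalerA sg scale1r.
Qed.

Lemma quasi_isoS X Y (f : chainmap X Y) : quasi_iso f <->
  (forall i (x : X (i + 1)), cdiff X erefl x = 0 ->
     (exists y, f _ x = cdiff Y erefl y) -> exists z, x = cdiff X erefl z) /\
  (forall i (y : Y (i + 1)), cdiff Y erefl y = 0 ->
     exists2 x : X (i + 1), cdiff X erefl x = 0 & exists z, f _ x = y + cdiff Y erefl z).
Proof.
split=> [H|[H1 H2]].
  by split=> i; have [] := H _ _ _ (erefl (i + 1)) erefl.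
by move=> i j l e e'; case: l / e'; case: j / e; split; [apply: H1 | apply: H2].
Qed.

Lemma quasi_iso_comp X Y Z (g : chainmap Y Z) (f : chainmap X Y) :
  quasi_iso g -> quasi_iso f -> quasi_iso (chcomp g f).
Proof.
move=> /quasi_isoS[gi gs] /quasi_isoS[fi fs]; apply/quasi_isoS; split=> i.
- move=> x dx ex; apply: fi => //; apply: gi => //.
  by rewrite -cmap_diff dx hom0.
- move=> z dz; have [y dy [z' ez]] := gs _ _ dz; have [x dx [y' ey]] := fs _ _ dy.
  exists x => //; exists (z' + g i y').
  by rewrite /= ey homD ez cmap_diff homD addrA.
Qed.

Lemma quasi_iso_cancel X Y Z (g : chainmap Y Z) (f : chainmap X Y) :
  quasi_iso (chcomp g f) -> quasi_iso f -> quasi_iso g.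
Proof.
move=> /quasi_isoS[gfi gfs] /quasi_isoS[fi fs]; apply/quasi_isoS; split=> i.
- move=> y dy [z ez]; have [x dx [y' ey]] := fs _ _ dy.
  have [|x' ex] := gfi _ _ dx.
    by exists (z + g i y'); rewrite /= ey homD ez cmap_diff homD.
  exists (f i x' - y'); rewrite homB -cmap_diff -ex ey.
  by rewrite addrK.
- move=> z dz; have [x dx [z' ez]] := gfs _ _ dz.
  exists (f _ x); first by rewrite -cmap_diff dx hom0.
  by exists z'.
Qed.

Lemma quasi_iso_homotopic X Y (f g : chainmap X Y) :
  homotopic f g -> quasi_iso f -> quasi_iso g.
Proof.
move=> /homotopic_sym[h hh] /quasi_isoS[fi fs]; apply/quasi_isoS.
have hc i (x : X (i + 1)) : cdiff X erefl x = 0 ->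
    g _ x = f _ x + cdiff Y erefl (h _ _ erefl x).
  by move=> dx; rewrite (hh _ _ _ erefl erefl) dx hom0 addr0.
split=> i.
- move=> x dx [y ey]; apply: fi => //.
  by exists (y - h _ _ erefl x); rewrite homB -ey hc // addrK.
- move=> y dy; have [x dx [z ez]] := fs _ _ dy; exists x => //.
  by exists (z + h _ _ erefl x); rewrite hc // ez homD addrA.
Qed.

Lemma quasi_iso_id X : quasi_iso (chid X).
Proof.
apply/quasi_isoS; split=> i x dx; first by case=> y ey; exists y.
by exists x => //; exists 0; rewrite hom0 addr0.
Qed.

Lemma quasi_iso_shift X Y (f : chainmap X Y) :
  quasi_iso f -> quasi_iso (shift_map 1 f).
Proof.
exact: (@shift_functor_qis k A (all_complexes A) 1 (exist _ X I) (exist _ Y I)).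
Qed.

Section ExtQis.
Variables (Z X : complex A) (w : chainmap Z (shift 1 X)).

Lemma ext_cycle i (p : ext w i) : cdiff (ext w) erefl p = 0 ->
  cdiff Z erefl p.1 = 0 /\ cdiff X erefl p.2 = w i p.1.
Proof.
rewrite ext_cdiffE => e; have /= e1 := congr1 fst e; have /= e2 := congr1 snd e.
by split=> //; apply/eqP; rewrite -subr_eq0 e2.
Qed.

Lemma ext_out_qis : acyclic X -> quasi_iso (ext_out w).
Proof.
move=> aX; apply/quasi_isoS; split=> i.
- move=> p /ext_cycle[d1 d2] [z ez]; rewrite /= in ez.
  have [|x ex] := aX _ (p.2 + w i z).
    by rewrite homD d2 ez ext_w_diff addNr.
  exists (z, x); rewrite ext_cdiffE; apply: pair_eq => //=.
  by rewrite -ex addrK.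
- move=> z dz; have [|x ex] := aX _ (w _ z).
    by apply: oppr_inj; rewrite -ext_w_diff dz hom0 oppr0.
  exists (z, x); last by exists 0; rewrite hom0 addr0.
  by rewrite ext_cdiffE; apply: pair_eq; rewrite //= -ex subrr.
Qed.

Lemma ext_in_qis : acyclic Z -> quasi_iso (ext_in w).
Proof.
move=> aZ; apply/quasi_isoS; split=> i.
- move=> x dx [p]; rewrite ext_cdiffE => ep.
  have /= e1 := congr1 fst ep; have /= e2 := congr1 snd ep.
  have [i' ei] := int_succ i; case: i / ei x dx p ep e1 e2 => x dx p _ e1 e2.
  have [z ez] := aZ _ _ (esym e1).
  by exists (p.2 + w _ z); rewrite homD e2 ez ext_w_diff opprK.
- move=> p /ext_cycle[d1 d2]; have [z ez] := aZ _ _ d1.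
  exists (p.2 + w i z); first by rewrite homD d2 ez ext_w_diff addNr.
  exists (- z, 0); rewrite ext_cdiffE; apply: pair_eq => /=.
    by rewrite homN -ez subrr.
  by rewrite hom0 sub0r homN opprK.
Qed.

(** A cycle (z, x) has w z = d x, so z = d z0 by injectivity in cohomology. Then x + w z0 is a
    cycle, and surjectivity supplies a cycle by which z0 must be corrected. *)
Lemma ext_acyclic : quasi_iso w -> acyclic (ext w).
Proof.
move=> qw i p /ext_cycle[d1 d2].
have [i' ei] := int_succ i; case: i / ei p d1 d2 => p d1 d2.
have [inj _] := qw _ _ _ (erefl (i' + 1 + 1)) erefl.
have [_ sur] := qw _ _ _ (erefl (i' + 1)) erefl.
have [|z ez] := inj _ d1.
  exists (- p.2); rewrite shift1_diffE homN opprK.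
  by rewrite (cdiff_irr _ (addr1_shift 1 erefl) erefl) d2.
have [|z' dz' [x ex]] := sur (p.2 + w _ z).
  rewrite shift1_diffE (cdiff_irr _ (addr1_shift 1 erefl) erefl).
  by rewrite homD d2 ez ext_w_diff addNr oppr0.
exists (z - z', x : X (i' + 1)); rewrite ext_cdiffE; apply: pair_eq => /=.
  by rewrite homB dz' subr0.
rewrite homB ex shift1_diffE (cdiff_irr _ (addr1_shift 1 erefl) erefl).
by rewrite opprB [X in cdiff _ _ _ + X]addrAC addrK [RHS]addrC subrK.
Qed.
End ExtQis.
End Shift.

(** * Calculus of fractions *)

#[export] Instance heq_equivalence (C : category) (X Y : C) :
  Equivalence (@heq C X Y).
Proof.
split; first exact: heq_refl.
  exact: heq_sym.
exact: heq_trans.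
Qed.
#[export] Instance ccomp_proper (C : category) (X Y Z : C) :
  Proper (@heq C Y Z ==> @heq C X Y ==> @heq C X Z) (@ccomp C X Y Z).
Proof. by move=> g g' eg f f' ef; apply: heq_comp. Qed.

Lemma ciso_cancell (C : category) (X Y Z : C) (s : chom Y Z) (f g : chom X Y) :
  ciso s -> heq (ccomp s f) (ccomp s g) -> heq f g.
Proof.
move=> [r [rs _]] e; rewrite -[f]ccomp1l -[g]ccomp1l -rs -!ccompA e.
reflexivity.
Qed.
Lemma ciso_cancelr (C : category) (X Y Z : C) (s : chom X Y) (f g : chom Y Z) :
  ciso s -> heq (ccomp f s) (ccomp g s) -> heq f g.
Proof.
move=> [r [_ sr]] e; rewrite -[f]ccomp1r -[g]ccomp1r -sr !ccompA e.
reflexivity.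
Qed.

Section Fractions.
Variables (k : fieldType) (A : lualgebra k).
Local Notation "g ** f" := (chcomp g f) (at level 40, left associativity).
Local Notation "f ~~ g" := (homotopic f g) (at level 70).

(** A separate condition: [ext w] is a shifted cone only up to isomorphism, and a [complex_class] is
    not assumed to be closed under isomorphisms. *)
Definition ext_closed (B : complex_class A) :=
  forall Z X (w : chainmap Z (shift 1 X)), B Z -> B X -> B (ext w).

Lemma all_ext_closed : ext_closed (all_complexes A).
Proof. by []. Qed.

Lemma bounded_ext_closed : ext_closed (bounded_complexes A).
Proof.
move=> Z X w [m mZ] [p pX]; exists (m + p)%N => i hi [z x].
by congr pair; [apply: mZ; lia | apply: pX; lia].
Qed.

Lemma quasi_iso_shiftVK (X : complex A) : quasi_iso (shiftVK X).
Proof.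
apply/quasi_isoS; split=> i x dx.
  move=> [y ey]; exists (shiftVK_inv X i y).
  rewrite -cmap_diff -ey -[RHS]/((shiftVK_inv X ** shiftVK X) _ x).
  by rewrite shiftVKK.
exists (shiftVK_inv X _ x); first by rewrite -cmap_diff dx hom0.
exists 0; rewrite hom0 addr0 -[LHS]/((shiftVK X ** shiftVK_inv X) _ x).
by rewrite shiftVK_invK.
Qed.

Variable B : complex_class A.
Hypothesis BE : ext_closed B.

Lemma B_shift n X : B X -> B (shift n X).
Proof. exact: inclass_shift. Qed.

(** Let E be the cocone of s, which is acyclic, and Y' the cone of E -> X -> Y. Then Y -> Y' is a
    quasi-isomorphism, and X -> Y -> Y' is null-homotopic on E, hence factors through s. *)
Lemma ore_left (X X' Y : complex A) (s : chainmap X X') (f : chainmap X Y) :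
  B X -> B X' -> B Y -> quasi_iso s ->
  exists Y' (s' : chainmap Y Y') (f' : chainmap X' Y'),
    [/\ B Y', quasi_iso s' & s' ** f ~~ f' ** s].
Proof.
(* Since [ext] needs a map to a shift, a map s enters either through [shiftVK], which gives its
   cocone, or as [shift_map 1 s], which gives its cone. *)
move=> bX bX' bY qs; pose w1 := shiftVK X' ** s.
have a1 : acyclic (ext w1).
  by apply/ext_acyclic/quasi_iso_comp; first exact: quasi_iso_shiftVK.
pose w2 := shift_map 1 (f ** ext_out w1).
have n2 : nullhom (ext_in w2 ** f ** ext_out w1).
  rewrite -chcompA; apply: nullhom_unshift; rewrite shift_map_comp.
  exact: ext_in_w_null.
have [b eb] := ext_factor_w n2.
have b1 : B (ext w1) by apply: BE => //; apply: B_shift.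
exists (ext w2), (ext_in w2), (b ** shiftVK X'); split.
- by apply: BE => //; apply: B_shift.
- exact/ext_in_qis/acyclic_shift.
- by rewrite -chcompA.
Qed.

(** As f s is null-homotopic, f extends to the acyclic cone of s; V' is the cone of this
    extension. *)
Lemma qis_kill_left (X X' V : complex A) (s : chainmap X X') (f : chainmap X' V) :
  B X -> B X' -> B V -> quasi_iso s -> nullhom (f ** s) ->
  exists V' (t : chainmap V V'), [/\ B V', quasi_iso t & nullhom (t ** f)].
Proof.
move=> bX bX' bV qs n; pose w1 := shift_map 1 s.
have a1 : acyclic (ext w1) by apply/ext_acyclic/quasi_iso_shift.
have [|g eg] := @ext_desc_in _ _ _ _ w1 _ f.
  by rewrite -shift_map_comp; apply: nullhom_shift.
pose w2 := shift_map 1 g.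
have b1 : B (ext w1) by apply: BE => //; apply: B_shift.
exists (ext w2), (ext_in w2); split.
- by apply: BE => //; apply: B_shift.
- exact/ext_in_qis/acyclic_shift.
- rewrite -eg chcompA; apply/nullhom_compr/nullhom_unshift.
  by rewrite shift_map_comp; apply: ext_in_w_null.
Qed.

(** Dual to [ore_left]: X' is the cocone of the composite of f with the inclusion of Y in the
    acyclic cone of s. *)
Lemma ore_right (X Y Y' : complex A) (s : chainmap Y' Y) (f : chainmap X Y) :
  B X -> B Y -> B Y' -> quasi_iso s ->
  exists X' (r : chainmap X' X) (f' : chainmap X' Y'),
    [/\ B X', quasi_iso r & f ** r ~~ s ** f'].
Proof.
move=> bX bY bY' qs; pose w1 := shift_map 1 s.
have a1 : acyclic (ext w1) by apply/ext_acyclic/quasi_iso_shift.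
have b1 : B (ext w1) by apply: BE => //; apply: B_shift.
pose w2 := shiftVK (ext w1) ** (ext_in w1 ** f).
have n2 : nullhom (ext_in w1 ** (f ** ext_out w2)).
  rewrite chcompA; apply: nullhom_shiftVK; rewrite chcompA.
  exact: ext_w_out_null.
have [|b eb] := @ext_lift_w _ _ _ _ w1 _ (shift_map 1 (f ** ext_out w2)).
  by rewrite -shift_map_comp; apply: nullhom_shift.
have [f' ef'] := shift_map_full b.
exists (ext w2), (ext_out w2), f'; split.
- by apply: BE => //; apply: B_shift.
- exact/ext_out_qis/acyclic_shift.
- by apply: homotopic_unshift; rewrite (shift_map_comp s) ef'.
Qed.

Lemma qis_kill_right (X Y Y' : complex A) (t : chainmap Y Y') (f : chainmap X Y) :
  B X -> B Y -> B Y' -> quasi_iso t -> nullhom (t ** f) ->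
  exists X' (r : chainmap X' X), [/\ B X', quasi_iso r & nullhom (f ** r)].
Proof.
move=> bX bY bY' qt n; pose w1 := shiftVK Y' ** t.
have a1 : acyclic (ext w1).
  by apply/ext_acyclic/quasi_iso_comp; first exact: quasi_iso_shiftVK.
have b1 : B (ext w1) by apply: BE => //; apply: B_shift.
have [|g eg] := @ext_lift_out _ _ _ _ w1 _ f.
  by rewrite -chcompA; apply: nullhom_compl.
pose w2 := shiftVK (ext w1) ** g.
exists (ext w2), (ext_out w2); split.
- by apply: BE => //; apply: B_shift.
- exact/ext_out_qis/acyclic_shift.
- rewrite -eg -chcompA; apply/nullhom_compl/nullhom_shiftVK.
  by rewrite chcompA; apply: ext_w_out_null.
Qed.

Local Notation ob := (cob (complexes_in B)).
Local Notation D := (derived B).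
Local Notation ch X Y := (chainmap (sval X) (sval Y)).

Lemma dmap_comp (X Y Z : ob) (g : ch Y Z) (f : ch X Y) :
  heq (@dmap k A B X Z (g ** f)) (ccomp (@dmap k A B Y Z g) (@dmap k A B X Y f)).
Proof. exact: (@loceq_mapM _ (@qis k A B) X Y Z g f). Qed.

Lemma dmap_qis (X Y : ob) (s : ch X Y) : quasi_iso s -> ciso (@dmap k A B X Y s).
Proof.
move=> qs; exists (@linv _ (@qis k A B) X Y s qs).
split; [exact: loceq_Vl | exact: loceq_Vr].
Qed.

(* Both maps are the composites of a single map out of X (+) C, where C is the
   contractible cone of the identity, with two sections of X (+) C -> X. *)
Lemma dmap_homotopic (X Y : ob) (f g : ch X Y) : f ~~ g ->
  heq (@dmap k A B X Y f) (@dmap k A B X Y g).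
Proof.
move=> /homotopic_nullhom n.
have bX : B (sval X) := svalP X; have bY : B (sval Y) := svalP Y.
pose w1 := chid (shift 1 (sval X)).
have a1 : acyclic (ext w1) by apply/ext_acyclic/quasi_iso_id.
have b1 : B (ext w1) by apply: BE => //; apply: B_shift.
have [|h eh] := @ext_desc_in _ _ _ _ w1 _ (f - g).
  by rewrite chcomp1r; apply: nullhom_shift.
pose w2 : chainmap (sval X) (shift 1 (ext w1)) := 0.
have b2 : B (ext w2) by apply: BE.
have [|s0 es0] := @ext_lift_out _ _ _ _ w2 _ (chid (sval X)).
  by rewrite chcomp0l; apply: nullhom0.
have [|H eH] := @ext_desc_in _ _ _ _ w2 _ h.
  by rewrite chcomp0r; apply: nullhom0.
pose s1 := s0 + ext_in w2 ** ext_in w1.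
(* H restricts to f - g along the second summand, but nothing is known of H s0. The correction
   forces H' s0 = g, and then H' s1 = g + (f - g). *)
pose H' := H + (g - H ** s0) ** ext_out w2.
have es1 : ext_out w2 ** s1 = chid (sval X).
  by rewrite chcompDr es0 chcompA ext_out_in chcomp0l addr0.
have e0 : H' ** s0 = g.
  by rewrite chcompDl -chcompA es0 chcomp1r addrC subrK.
have e1 : H' ** s1 = f.
  rewrite chcompDl -[_ ** _ ** s1]chcompA es1 chcomp1r chcompDr chcompA eH eh.
  by rewrite addrC addrA subrK addrC subrK.
pose S : ob := exist _ (ext w2) b2.
have es : heq (@dmap k A B X S s0) (@dmap k A B X S s1).
  apply: (@ciso_cancell _ _ _ _ (@dmap k A B S X (ext_out w2))).
    exact/dmap_qis/ext_out_qis.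
  apply: heq_trans (heq_sym (@dmap_comp X S X _ _)) _.
  apply: heq_trans _ (@dmap_comp X S X _ _).
  by rewrite es0 es1; apply: heq_refl.
rewrite -e0 -e1; apply: heq_trans (@dmap_comp X S Y _ _) _.
apply: heq_trans _ (heq_sym (@dmap_comp X S Y _ _)).
exact: heq_comp (heq_refl _) (heq_sym es).
Qed.

(** Induction on the word. In a composite, [ore_left] moves the denominator of the first factor past
    the numerator of the second. *)
Lemma loc_left_fraction (X Y : ob) (f : lochom (@qis k A B) X Y) :
  exists (Y' : ob) (s : ch Y Y') (g : ch X Y'), quasi_iso s /\
    loceq (lcomp (@lmap _ (@qis k A B) Y Y' s) f) (@lmap _ (@qis k A B) X Y' g).
Proof.
elim: {X Y} f => [X Y f|X Y s qs|X Y Z g [Z2 [s2 [a2 [q2 e2]]]] f [Y1 [s1 [a1 [q1 e1]]]]].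
- exists Y, (chid _), f; split; first exact: quasi_iso_id.
  exact: loceq_1l.
- by exists Y, s, (chid _); split=> //; apply: loceq_Vr.
have [W' [s' [a' [bW q' e']]]] := ore_left a2 (svalP Y) (svalP Y1) (svalP Z2) q1.
pose W : ob := exist _ W' bW.
exists W, (s' ** s2), (a' ** a1); split; first exact: quasi_iso_comp.
apply: loceq_trans (loceq_comp (@loceq_mapM _ (@qis k A B) Z Z2 W s' s2) (loceq_refl _)) _.
apply: loceq_trans (loceq_sym (loceq_A _ _ _)) _.
apply: loceq_trans (loceq_comp (loceq_refl _) (loceq_A _ _ _)) _.
apply: loceq_trans (loceq_comp (loceq_refl _) (loceq_comp e2 (loceq_refl _))) _.
apply: loceq_trans (loceq_A _ _ _) _.
apply: loceq_trans (loceq_comp (loceq_sym (@loceq_mapM _ (@qis k A B) Y Z2 W s' a2))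
  (loceq_refl _)) _.
apply: loceq_trans (loceq_comp (@dmap_homotopic Y W _ _ e') (loceq_refl _)) _.
apply: loceq_trans (loceq_comp (@loceq_mapM _ (@qis k A B) Y Y1 W a' s1) (loceq_refl _)) _.
apply: loceq_trans (loceq_sym (loceq_A _ _ _)) _.
apply: loceq_trans (loceq_comp (loceq_refl _) e1) _.
exact: loceq_sym (@loceq_mapM _ (@qis k A B) X Y1 W a' a1).
Qed.

Lemma left_fraction (X Y : ob) (f : @chom D X Y) :
  exists (Y' : ob) (s : ch Y Y') (g : ch X Y'), quasi_iso s /\
    heq (ccomp (@dmap k A B Y Y' s) f) (@dmap k A B X Y' g).
Proof.
exact: loc_left_fraction.
Qed.

Lemma right_fraction (X Y : ob) (f : @chom D X Y) :
  exists (X' : ob) (r : ch X' X) (g : ch X' Y), quasi_iso r /\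
    heq (ccomp f (@dmap k A B X' X r)) (@dmap k A B X' Y g).
Proof.
have [Y' [s [g [qs e]]]] := @left_fraction X Y f.
have [X1 [r [g' [bX1 qr er]]]] := ore_right g (svalP X) (svalP Y') (svalP Y) qs.
pose X' : ob := exist _ X1 bX1.
exists X', r, g'; split=> //; apply: ciso_cancell (dmap_qis qs) _.
apply: heq_trans (ccompA _ _ _) _; apply: heq_trans (heq_comp e (heq_refl _)) _.
apply: heq_trans (heq_sym (@dmap_comp X' X Y' g r)) _.
apply: heq_trans (@dmap_homotopic X' Y' _ _ er) _.
exact: (@dmap_comp X' Y Y' s g').
Qed.

(** * An invariant of words: the action of the localization on classes of roofs *)

Section Roofs.
Variable N : ob.

(** A left fraction from N to Y, standing for the inverse of [rqis] after [rmap]. *)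
Record roof (Y : ob) := Roof {
  rob : ob;
  rqis : ch Y rob;
  rqisP : quasi_iso rqis;
  rmap : ch N rob
}.

(** Says that r' represents f after r, witnessed over a common W. Only b has to be a
    quasi-isomorphism, since f is arbitrary; for f the identity this is equivalence of fractions. *)
Definition roof_rel (Y Z : ob) (f : ch Y Z) (r : roof Y) (r' : roof Z) :=
  exists (W : ob) (a : ch (rob r) W) (b : ch (rob r') W),
  [/\ quasi_iso b, a ** rqis r ~~ b ** rqis r' ** f & a ** rmap r ~~ b ** rmap r'].

Lemma roof_rel_total (Y Z : ob) (f : ch Y Z) (r : roof Y) : exists r', roof_rel f r r'.
Proof.
have [W' [s' [a' [bW q' e']]]] :=
  ore_left f (svalP Y) (svalP (rob r)) (svalP Z) (rqisP r).
exists (@Roof Z (exist _ W' bW) s' q' (a' ** rmap r)).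
exists (exist _ W' bW), a', (chid _); rewrite !chcomp1l; split.
- exact: quasi_iso_id.
- exact: homotopic_sym.
- exact: homotopic_refl.
Qed.

Lemma roof_rel_refl (Y : ob) (r : roof Y) : roof_rel (chid _) r r.
Proof.
exists (rob r), (chid _), (chid _); rewrite !chcomp1l chcomp1r; split.
- exact: quasi_iso_id.
- exact: homotopic_refl.
- exact: homotopic_refl.
Qed.

Lemma roof_rel_comp (X Y Z : ob) (f : ch X Y) (g : ch Y Z) r r' r'' :
  roof_rel f r r' -> roof_rel g r' r'' -> roof_rel (g ** f) r r''.
Proof.
move=> [W1 [a1 [b1 [q1 e1 e1']]]] [W2 [a2 [b2 [q2 e2 e2']]]].
have [V' [s [c [bV qs es]]]] :=
  ore_left a2 (svalP (rob r')) (svalP W1) (svalP W2) q1.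
exists (exist _ V' bV), (c ** a1), (s ** b2); split.
- exact: quasi_iso_comp.
- rewrite -[_ ** a1 ** _]chcompA e1 chcompA chcompA -es.
  rewrite -[s ** a2 ** _]chcompA e2 !chcompA; reflexivity.
- rewrite -[_ ** a1 ** _]chcompA e1' chcompA -es.
  rewrite -[s ** a2 ** _]chcompA e2' !chcompA; reflexivity.
Qed.

(** An Ore square reconciles the two witnesses on Z. The two maps then obtained on the vertex of r
    agree after the quasi-isomorphism [rqis r], so [qis_kill_left] makes them homotopic. *)
Lemma roof_rel_unique (Y Z : ob) (f : ch Y Z) r r1 r2 :
  roof_rel f r r1 -> roof_rel f r r2 -> roof_rel (chid _) r1 r2.
Proof.
move=> [W1 [a1 [b1 [q1 e1 e1']]]] [W2 [a2 [b2 [q2 e2 e2']]]].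
have q1' : quasi_iso (b1 ** rqis r1) by apply: quasi_iso_comp (rqisP _).
have [V1 [s [c [bV1 qs es]]]] :=
  ore_left (b2 ** rqis r2) (svalP Z) (svalP W1) (svalP W2) q1'.
have [|V2 [t [bV2 qt nt]]] := @qis_kill_left _ _ V1 (rqis r) (c ** a1 - s ** a2)
    (svalP Y) (svalP (rob r)) bV1 (rqisP r).
  rewrite chcompDl chcompNl; apply: homotopic_nullhom.
  rewrite -[c ** a1 ** _]chcompA e1 -[s ** a2 ** _]chcompA e2 !chcompA.
  rewrite -[c ** b1 ** _]chcompA -es !chcompA; reflexivity.
have e : t ** c ** a1 ~~ t ** s ** a2.
  by apply: nullhom_homotopic; rewrite -!chcompA -chcompNr -chcompDr.
exists (exist _ V2 bV2), (t ** c ** b1), (t ** s ** b2); split.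
- by apply: quasi_iso_comp => //; apply: quasi_iso_comp.
- rewrite chcomp1r -!chcompA -es !chcompA; reflexivity.
- rewrite -[_ ** b1 ** _]chcompA -e1' chcompA e -[_ ** a2 ** _]chcompA e2' !chcompA; reflexivity.
Qed.

(** This lets the formal inverse of f act by the converse relation. *)
Lemma roof_rel_inj (Y Z : ob) (f : ch Y Z) r1 r2 r' : quasi_iso f ->
  roof_rel f r1 r' -> roof_rel f r2 r' -> roof_rel (chid _) r1 r2.
Proof.
move=> qf [W1 [a1 [b1 [q1 e1 e1']]]] [W2 [a2 [b2 [q2 e2 e2']]]].
have [V1 [s [c [bV1 qs es]]]] :=
  ore_left b2 (svalP (rob r')) (svalP W1) (svalP W2) q1.
have e3 : c ** a1 ** rqis r1 ~~ s ** a2 ** rqis r2.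
  rewrite -[c ** a1 ** _]chcompA e1 -[s ** a2 ** _]chcompA e2 !chcompA es.
  reflexivity.
exists (exist _ V1 bV1), (c ** a1), (s ** a2); split.
- have q : quasi_iso (s ** a2 ** rqis r2).
    apply: (@quasi_iso_homotopic _ _ _ _ (s ** (b2 ** rqis r' ** f))).
      by rewrite -[s ** a2 ** _]chcompA e2; reflexivity.
    apply: quasi_iso_comp => //; apply: quasi_iso_comp => //.
    by apply: quasi_iso_comp => //; apply: rqisP.
  exact: quasi_iso_cancel q (rqisP r2).
- by rewrite chcomp1r.
- rewrite -[c ** a1 ** _]chcompA e1' -[s ** a2 ** _]chcompA e2' !chcompA es.
  reflexivity.
Qed.

Lemma roof_rel_sym (Y : ob) (r r' : roof Y) :
  roof_rel (chid _) r r' -> roof_rel (chid _) r' r.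
Proof. by move=> h; apply: roof_rel_unique h (roof_rel_refl r). Qed.

Lemma roof_rel_homotopic (Y Z : ob) (f g : ch Y Z) r r' : f ~~ g ->
  roof_rel f r r' -> roof_rel g r r'.
Proof. by move=> e [W [a [b [q e1 e2]]]]; exists W, a, b; split=> //; rewrite -e. Qed.

(* A set-valued functor on the localization: inverses of quasi-isomorphisms
   act by the converse relation, which is again one to one on classes of roofs. *)
Fixpoint roof_act (X Y : ob) (f : lochom (@qis k A B) X Y)
    (S : roof X -> Prop) (r : roof Y) : Prop :=
  match f in lochom _ X Y return (roof X -> Prop) -> roof Y -> Prop with
  | lmap _ _ g => fun S r => exists2 r0, S r0 & roof_rel g r0 r
  | linv _ _ s _ => fun S r => exists2 r0, S r0 & roof_rel s r r0
  | lcomp _ _ _ g h => fun S => roof_act g (roof_act h S)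
  end S r.

(** Such sets are unions of equivalence classes of roofs; on them the identity acts trivially, which
    fails for arbitrary sets. *)
Definition roof_sat (Y : ob) (S : roof Y -> Prop) :=
  forall r r', S r -> roof_rel (chid _) r r' -> S r'.

Lemma roof_act_sat (X Y : ob) (f : lochom (@qis k A B) X Y) S :
  roof_sat S -> roof_sat (roof_act f S).
Proof.
elim: f S => {X Y} [X Y f|X Y s qs|X Y Z g IHg f IHf] S sS r r' /=.
- move=> [r0 Sr0 h] h'; exists r0 => //.
  by have := roof_rel_comp h h'; rewrite chcomp1l.
- move=> [r0 Sr0 h] h'; exists r0 => //.
  by have := roof_rel_comp (roof_rel_sym h') h; rewrite chcomp1r.
- by apply: IHg; apply: IHf.
Qed.

Lemma roof_act_eq (X Y : ob) (f g : lochom (@qis k A B) X Y) : loceq f g ->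
  forall S, roof_sat S -> roof_act f S = roof_act g S.
Proof.
elim=> {X Y f g} //=.
- by move=> X Y f g _ IH S sS; rewrite IH.
- by move=> X Y f g h _ IH _ IH' S sS; rewrite IH ?IH'.
- by move=> X Y Z g g' f f' _ IH _ IH' S sS; rewrite IH' // IH //; apply: roof_act_sat.
- move=> X Y f S sS; apply/funext => r; apply/propext; split.
    by move=> [r0 Sr0 h]; apply: roof_act_sat h.
  by move=> Sr; exists r => //; apply: roof_rel_refl.
- move=> X Y f S sS; congr roof_act; apply/funext => r; apply/propext; split.
    by move=> [r0 Sr0 h]; apply: sS h.
  by move=> Sr; exists r => //; apply: roof_rel_refl.
- move=> X Y f g e S sS; apply/funext => r; apply/propext.
  have e' : f ~~ g by rewrite (_ : f = g); [reflexivity | apply: chainmap_ext].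
  split=> -[r0 Sr0 h]; exists r0 => //; apply: roof_rel_homotopic h => //.
  exact: homotopic_sym.
- move=> X Y Z g f S sS; apply/funext => r; apply/propext; split; last first.
    by move=> [r1 [r0 Sr0 h] h']; exists r0 => //; apply: roof_rel_comp h h'.
  move=> [r0 Sr0 h]; have [r1 h1] := roof_rel_total f r0.
  exists r1; first by exists r0.
  have [r2 h2] := roof_rel_total g r1.
  have := roof_rel_comp h2 (roof_rel_unique (roof_rel_comp h1 h2) h).
  by rewrite chcomp1l.
- move=> X Y s qs S sS; apply/funext => r; apply/propext; split.
    by move=> [r1 [r0 Sr0 h] h']; exists r0 => //; apply: roof_rel_inj h h'.
  move=> [r0 Sr0 /(sS _ _ Sr0) Sr]; have [r' h] := roof_rel_total s r.
  by exists r' => //; exists r.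
- move=> X Y s qs S sS; apply/funext => r; apply/propext; split.
    by move=> [r1 [r0 Sr0 h] h']; exists r0 => //; apply: roof_rel_unique h h'.
  move=> [r0 Sr0 /(sS _ _ Sr0) Sr].
  (* A preimage of r under s is obtained by absorbing s into the denominator. *)
  pose r1 : roof X := @Roof X (rob r) (rqis r ** s) (quasi_iso_comp (rqisP r) qs) (rmap r).
  have h : roof_rel s r1 r.
    exists (rob r), (chid _), (chid _); rewrite !chcomp1l; split.
    - exact: quasi_iso_id.
    - exact: homotopic_refl.
    - exact: homotopic_refl.
  by exists r1 => //; exists r.
Qed.
End Roofs.

(** As in Yoneda's lemma, f and g act on the class of the identity roof at N = X. A roof r reached
    through both gives witnesses that, reconciled by an Ore square, equalize f and g. *)
Lemma dmap_eq_left (X Y : ob) (f g : ch X Y) :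
  heq (@dmap k A B X Y f) (@dmap k A B X Y g) ->
  exists (Y' : ob) (t : ch Y Y'), quasi_iso t /\ t ** f ~~ t ** g.
Proof.
pose r0 := @Roof X X X (chid _) (@quasi_iso_id k A _) (chid _).
have sS : roof_sat (roof_rel (chid _) r0).
  by move=> r r' h h'; have := roof_rel_comp h h'; rewrite chcomp1l.
move=> /(@roof_act_eq X X Y) /(_ _ sS) e.
have [r h] := roof_rel_total f r0.
have : roof_act (@lmap _ (@qis k A B) X Y g) (roof_rel (chid _) r0) r.
  by rewrite -e; exists r0 => //; apply: roof_rel_refl.
move=> [r1 h0 h1].
have {h0 h1} := roof_rel_comp h0 h1; rewrite chcomp1r => h'.
have [Y' [a [b [q e1 e2]]]] := h; have [Y2 [a' [b' [q' e1' e2']]]] := h'.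
move: e1 e2 e1' e2'; rewrite /= !chcomp1r => e1 e2 e1' e2'.
have [V1 [s [c [bV qs es]]]] :=
  ore_left b' (svalP (rob r)) (svalP Y') (svalP Y2) q.
exists (exist _ V1 bV), (c ** b ** rqis r); split.
  apply: quasi_iso_comp (rqisP r); apply: quasi_iso_homotopic es _.
  exact: quasi_iso_comp.
have ef : c ** b ** rqis r ** f ~~ c ** b ** rmap r.
  by rewrite -!chcompA [b ** (_ ** f)]chcompA -e1 e2; reflexivity.
rewrite ef -es -!chcompA [b' ** (_ ** g)]chcompA -e1' e2'; reflexivity.
Qed.
End Fractions.

(** * Projective modules and complexes of projectives *)

Section FiniteSpan.
Variable k : fieldType.

Definition finspan (V : lmodType k) (S : V -> Prop) :=
  exists (n : nat) (b : 'I_n -> V),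
    forall v, S v -> exists c : 'I_n -> k, v = \sum_i c i *: b i.

Lemma finspan_image (V W : lmodType k) (f : V -> W) (S : V -> Prop) (T : W -> Prop) :
  linear f -> (forall w, T w -> exists2 v, S v & w = f v) -> finspan S -> finspan T.
Proof.
move=> linf TS [n [b bS]]; exists n, (fun i => f (b i)) => w /TS[v /bS[c ->] ->].
pose f' : {linear V -> W} := HB.pack f (GRing.isLinear.Build k V W _ f linf).
exists c; rewrite -[f _]/(f' _) linear_sum; apply: eq_bigr => i _.
by rewrite linearZ.
Qed.

Lemma finspan_add (V : lmodType k) (S T U : V -> Prop) :
  (forall u, U u -> exists s t, [/\ S s, T t & u = s + t]) ->
  finspan S -> finspan T -> finspan U.
Proof.
move=> USum [n [b bS]] [m [d dT]].
exists (n + m)%N, (fun i => match fintype.split i with inl j => b j | inr j => d j end).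
move=> u /USum[s [t [/bS[c ->] /dT[e ->] ->]]].
exists (fun i => match fintype.split i with inl j => c j | inr j => e j end).
rewrite big_split_ord; congr (_ + _); apply: eq_bigr => i _.
  by rewrite (unsplitK (inl i)).
by rewrite (unsplitK (inr i)).
Qed.

(** The linear relation is recorded as a polynomial because v will be the sequence of powers of an
    endomorphism. It comes from the left kernel of an (n + 1) by n matrix. *)
Lemma finspan_dependent (V : lmodType k) (v : nat -> V) :
  finspan (fun _ : V => True) ->
  exists p : {poly k}, p != 0 /\ \sum_(i < size p) p`_i *: v i = 0.
Proof.
move=> [n [b bS]].
have /choice[c cP] i := bS (v i) I.
pose C : 'M[k]_(n.+1, n) := \matrix_(i, j) c i j.
have [u un uC] : exists2 u : 'rV[k]_n.+1, u != 0 & u *m C = 0.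
  have : kermx C != 0.
    rewrite -mxrank_eq0 mxrank_ker -lt0n subn_gt0.
    by rewrite (leq_ltn_trans (rank_leq_col C)).
  move=> /rowV0Pn[u]; rewrite sub_kermx => /eqP uC un; by exists u.
pose p : {poly k} := rVpoly u.
exists p; split.
  apply: contraNneq un => p0; rewrite -[u]rVpolyK -/p p0.
  by apply/eqP/rowP => i; rewrite !mxE coef0.
have szp : (size p <= n.+1)%N by apply: size_poly.
have -> : \sum_(i < size p) p`_i *: v i = \sum_(i < n.+1) p`_i *: v i.
  rewrite (big_ord_widen _ (fun i => p`_i *: v i) szp) [LHS]big_mkcond.
  apply: eq_bigr => i _; case: ltnP => // /(nth_default 0) ->.
  by rewrite scale0r.
under eq_bigr => i _ do rewrite cP scaler_sumr.
rewrite exchange_big big1 // => j _.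
under eq_bigr => i _ do rewrite scalerA.
rewrite -scaler_suml.
have /rowP/(_ j) := uC; rewrite !mxE => e.
suff -> : \sum_(i < n.+1) p`_i * c i j = 0 by rewrite scale0r.
rewrite -[RHS]e; apply: eq_bigr => i _.
by rewrite mxE coef_rVpoly_ord.
Qed.
End FiniteSpan.

Section Projectives.
Variables (k : fieldType) (A : lualgebra k).

Definition projective (M : module A) := forall (N L : module A)
  (p : hom N L) (g : hom M L), (forall m, exists n, p n = g m) ->
  exists g' : hom M N, hcomp p g' = g.

Definition Pgen x : Pmod (A := A) x := @ProjCar k A x (aid x)
  (introT eqP (aid_idem x)).

Lemma Pmod_act x (m : Pmod (A := A) x) : m = mact (pval m) (Pgen x).
Proof. by apply: val_inj; rewrite /= (eqP (pvalP m)). Qed.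

Lemma Pgen_act x : mact (aid x) (Pgen x) = Pgen x.
Proof. by apply: val_inj; rewrite /= aid_idem. Qed.

Definition Phom x (N : module A) (n : N) : hom (Pmod (A := A) x) N.
Proof.
exists (fun m => mact (pval m) n).
  by move=> c a b; rewrite /= mact_linl.
by move=> a m /=; rewrite mactA.
Defined.

Lemma Phom_linear x (N : module A) : linear (@Phom x N).
Proof.
by move=> c n n'; apply: hom_ext => m; rewrite !hevE /= mact_linr.
Qed.

Lemma Phom_gen x (N : module A) (f : hom (Pmod (A := A) x) N) :
  f = Phom x (f (Pgen x)).
Proof. by apply: hom_ext => m; rewrite /= -hom_act -Pmod_act. Qed.

Lemma Pmod_projective x : projective (Pmod (A := A) x).
Proof.
move=> N L p g /(_ (Pgen x))[n en]; exists (Phom x n).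
apply: hom_ext => m; rewrite /= hom_act en -hom_act.
by rewrite -Pmod_act.
Qed.

Lemma mdsum_split (M N : module A) (p : mdsum M N) :
  p = hpair (hid M) (hzero M N) p.1 + hpair (hzero N M) (hid N) p.2.
Proof. by apply: pair_eq; rewrite /= ?addr0 ?add0r. Qed.

Lemma in_proj_projective (M : module A) : in_proj M -> projective M.
Proof.
elim=> {M} [x|M zM|M N _ pM _ pN|M N i r ri _ pM] L K p g sur.
- exact: Pmod_projective.
- exists 0; apply: hom_ext => m.
  by rewrite [m]zM !homlE.
- have [|gM eM] := pM _ _ p (hcomp g (hpair (hid M) (hzero M N))).
    by move=> m; apply: sur.
  have [|gN eN] := pN _ _ p (hcomp g (hpair (hzero N M) (hid N))).
    by move=> m; apply: sur.
  exists (hcomp gM (hfst M N) + hcomp gN (hsnd M N)).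
  apply: hom_ext => m; rewrite [m in RHS]mdsum_split !hevE !homD.
  have /(congr1 (fun f => hfun f m.1)) /= -> := eM.
  by have /(congr1 (fun f => hfun f m.2)) /= -> := eN.
- have [|g' eg] := pM _ _ p (hcomp g r); first by move=> m; apply: sur.
  by exists (hcomp g' i); rewrite hcompA eg -hcompA ri hcomp1r.
Qed.

(** Hom(P_x, N) is e_x N, and e_x P_y is e_x A e_y. The claim passes to sums and summands in each
    variable, hence two inductions, the one on N nested for fixed x. *)
Lemma in_proj_finspan (M N : module A) : locally_finite_dim A ->
  in_proj M -> in_proj N -> finspan (fun _ : hom M N => True).
Proof.
move=> lfd pM pN.
have fN x : finspan (fun n : N => exists m, n = mact (aid x) m).
  elim: pN => {M pM N} [y|N zN|N1 N2 _ f1 _ f2|N N' i r ri _ f].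
  - have [n [b [Sb bP]]] := lfd x y.
    have bY i : b i \in proj_pred y.
      have [c ->] := Sb i; rewrite inE -amulA aid_idem //.
    exists n, (fun i => ProjCar (bY i)) => _ [m ->].
    have [|c ec] := bP (amul (aid x) (pval m)).
      by exists (pval m); rewrite -amulA (eqP (pvalP m)).
    exists c; apply: val_inj; rewrite [RHS]raddf_sum [LHS]ec.
    by apply: eq_bigr => i _.
  - exists 0%N, (fun=> 0) => n _; exists (fun=> 0).
    by rewrite [n]zN big_ord0.
  - apply: (@finspan_add _ _ (fun v => exists m, v = hpair (hid N1) (hzero N1 N2) (mact (aid x) m))
      (fun v => exists m, v = hpair (hzero N2 N1) (hid N2) (mact (aid x) m))).
    + move=> _ [m ->]; exists (hpair (hid N1) (hzero N1 N2) (mact (aid x) m.1)),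
        (hpair (hzero N2 N1) (hid N2) (mact (aid x) m.2)).
      by split; [exists m.1| exists m.2|apply: pair_eq; rewrite /= ?addr0 ?add0r].
    + apply: finspan_image f1; first exact: (@hom_linear _ _ _ _ (hpair (hid N1) (hzero N1 N2))).
      by move=> _ [m ->]; exists (mact (aid x) m) => //; exists m.
    + apply: finspan_image f2; first exact: (@hom_linear _ _ _ _ (hpair (hzero N2 N1) (hid N2))).
      by move=> _ [m ->]; exists (mact (aid x) m) => //; exists m.
  - apply: finspan_image f; first exact: (@hom_linear _ _ _ _ r).
    move=> _ [m ->]; exists (mact (aid x) (i m)); first by exists (i m).
    by rewrite -hom_act -[r _ in RHS]/(hcomp r i _) hom_act -hom_act /= -[r _]/(hcomp r i _) ri.
elim: pM => {M} [x|M zM|M1 M2 _ f1 _ f2|M M' i r ri _ f].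
- apply: finspan_image (fN x); first exact: (@Phom_linear x N).
  move=> f _; exists (f (Pgen x)); last exact: Phom_gen.
  by exists (f (Pgen x)); rewrite -hom_act Pgen_act.
- exists 0%N, (fun=> 0) => g _; exists (fun=> 0).
  by rewrite big_ord0; apply: hom_from_zero.
- apply: (@finspan_add _ _ (fun v => exists g, v = hcomp g (hfst M1 M2))
      (fun v => exists g, v = hcomp g (hsnd M1 M2))).
  + move=> g _; exists (hcomp (hcomp g (hpair (hid M1) (hzero M1 M2))) (hfst M1 M2)),
      (hcomp (hcomp g (hpair (hzero M2 M1) (hid M2))) (hsnd M1 M2)).
    split; [by eexists | by eexists |].
    by apply: hom_ext => m; rewrite {1}[m]mdsum_split !hevE !homD.
  + apply: finspan_image f1; last by move=> _ [g ->]; exists g.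
    by move=> c g g'; apply: hcomp_linl.
  + apply: finspan_image f2; last by move=> _ [g ->]; exists g.
    by move=> c g g'; apply: hcomp_linl.
- apply: (finspan_image (f := fun g => hcomp g i) _ _ f).
    by move=> c g g'; apply: hcomp_linl.
  move=> g _; exists (hcomp g r) => //.
  by rewrite -hcompA ri hcomp1r.
Qed.
End Projectives.

(** * K-projective complexes *)

Section KProjective.
Variables (k : fieldType) (A : lualgebra k).
Implicit Types Z N C : complex A.
Local Notation "g ** f" := (chcomp g f) (at level 40, left associativity).
Local Notation "f ~~ g" := (homotopic f g) (at level 70).

Definition Kprojective Z :=
  forall C (f : chainmap Z C), acyclic C -> nullhom f.

Lemma update_at (T : int -> Type) (h : forall i, T i) j (y : T j) :
  exists h' : forall i, T i, h' j = y /\ forall i, i != j -> h' i = h i.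
Proof.
exists (fun i => match @eqP _ j i with
  | ReflectT e => eq_rect j T y i e | ReflectF _ => h i end).
split=> [|i]; first by case: eqP => // e; rewrite (eq_irrelevance e erefl).
by case: eqP => // e; rewrite -{1}e eqxx.
Qed.

(** The homotopy is built by descending induction on the degree, lifting along the differential of C
    onto its cycles. *)
Lemma bounded_projective_Kprojective Z :
  bounded Z -> (forall i, projective (Z i)) -> Kprojective Z.
Proof.
move=> [n nZ] pZ C f aC; apply/nullhomS.
have zero i (x : Z i) : (n < `|i|)%N -> x = 0 by move=> /nZ/(_ x).
suff [h hh] : exists h : forall i, hom (Z (i + 1)) (C i), forall i x,
    - (n.+1)%:Z <= i -> f (i + 1) x = cdiff C erefl (h i x) + h (i + 1) (cdiff Z erefl x).
  exists h => i x; case: (boolP (- (n.+1)%:Z <= i)) => [|lt]; first exact: hh.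
  by rewrite [x]zero ?homlE ?addr0 //; lia.
(* Since [h i] starts at Z^(i+1), the equations are trivial for i >= n and for i < -(n+1); from n
   down to -(n+1) there are n + (n+1) steps. *)
have: forall r : nat, exists h : forall i, hom (Z (i + 1)) (C i), forall i x,
    n%:Z - r%:Z <= i -> f (i + 1) x = cdiff C erefl (h i x) + h (i + 1) (cdiff Z erefl x).
  elim=> [|r [h hh]].
    exists (fun i => 0) => i x le; rewrite [x]zero ?homlE ?addr0 //; lia.
  pose j : int := n%:Z - r.+1%:Z.
  pose g := f (j + 1) - hcomp (h (j + 1)) (cdiff Z erefl).
  (* By the equation in degree j + 1, g takes values in cycles. Equation i involves only [h i] and
     [h (i + 1)], so changing h at j preserves the equations above j. *)
  have [|y ey] := pZ _ _ _ (cdiff C (erefl (j + 1))) g.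
    move=> x; have [|y ->] := aC _ (g x); last by exists y.
    rewrite !hevE homB -cmap_diff hh; last by rewrite /j; lia.
    by rewrite cdiff2 hom0 addr0 subrr.
  have [h' [h'j h'n]] := update_at h y.
  exists h' => i x le; have [eij|nij] := eqVneq i j.
    subst i; rewrite h'j h'n; last by lia.
    have /(congr1 (fun u => hfun u x)) := ey; rewrite !hevE => ->.
    by rewrite subrK.
  rewrite !h'n //; last by rewrite /j in nij le *; lia.
  by apply: hh; rewrite /j in nij; lia.
move=> /(_ (n + n.+1)%N)[h hh]; exists h => i x le; apply: hh.
by lia.
Qed.

Section Lift.
Variable Z : complex A.
Hypothesis KZ : Kprojective Z.

(** The composite of g with the inclusion of N' in the acyclic cone of s is null-homotopic. *)
Lemma Kprojective_lift N N' (s : chainmap N N') (g : chainmap Z N') :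
  quasi_iso s -> exists g' : chainmap Z N, g ~~ s ** g'.
Proof.
move=> qs; pose w1 := shift_map 1 s.
have a1 : acyclic (ext w1) by apply/ext_acyclic/quasi_iso_shift.
have [|b eb] := @ext_lift_w _ _ _ _ w1 _ (shift_map 1 g).
  by rewrite -shift_map_comp; apply/nullhom_shift/KZ.
have [f' ef'] := shift_map_full b; exists f'.
by apply: homotopic_unshift; rewrite shift_map_comp ef'.
Qed.

(** Here g lifts to the acyclic cocone of s. *)
Lemma Kprojective_null N N' (s : chainmap N N') (g : chainmap Z N) :
  quasi_iso s -> nullhom (s ** g) -> nullhom g.
Proof.
move=> qs n; pose w1 := shiftVK N' ** s.
have a1 : acyclic (ext w1).
  by apply/ext_acyclic/quasi_iso_comp; first exact: quasi_iso_shiftVK.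
have [|a ea] := @ext_lift_out _ _ _ _ w1 _ g.
  by rewrite -chcompA; apply: nullhom_compl.
by rewrite -ea; apply/nullhom_compl/KZ.
Qed.
End Lift.
End KProjective.

(** * Fitting's lemma *)

(* End rings may be zero rings, so that the evaluation of polynomials of the
   library, which needs a non-trivial algebra, does not apply. *)
Section PolyEval.
Variables (k : fieldType) (V : lmodType k) (mul : V -> V -> V) (one : V).
Hypotheses (mulA : associative mul) (mul1l : left_id one mul) (mul1r : right_id one mul)
  (mul_linl : forall b, linear (fun a => mul a b)) (mul_linr : forall a, linear (mul a)).

HB.instance Definition _ a := GRing.isLinear.Build k V V _ (mul a) (mul_linr a).

Definition vpow (a : V) n := iter n (mul a) one.
Definition veval (a : V) (p : {poly k}) : V := \sum_(i < size p) p`_i *: vpow a i.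

Lemma vevalE a n (p : {poly k}) : (size p <= n)%N ->
  veval a p = \sum_(i < n) p`_i *: vpow a i.
Proof.
move=> le; rewrite /veval (big_ord_widen _ (fun i => p`_i *: vpow a i) le).
rewrite [LHS]big_mkcond; apply: eq_bigr => i _; case: ltnP => // /(nth_default 0) ->.
by rewrite scale0r.
Qed.

Lemma veval_linear a : linear (veval a).
Proof.
move=> c p q; pose n := maxn (size p) (size q).
have le : (size (c *: p + q)%R <= n)%N.
  apply: leq_trans (size_polyD _ _) _; rewrite geq_max leq_maxr andbT.
  by apply: leq_trans (size_scale_leq _ _) _; apply: leq_maxl.
rewrite (vevalE a le) (vevalE a (leq_maxl (size p) (size q))).
rewrite (vevalE a (leq_maxr (size p) (size q))) scaler_sumr -big_split /=.
by apply: eq_bigr => i _; rewrite coefD coefZ scalerDl scalerA.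
Qed.
HB.instance Definition _ a := GRing.isLinear.Build k {poly k} V _ (veval a) (veval_linear a).

Lemma vevalC a c : veval a c%:P = c *: one.
Proof. by rewrite (vevalE a (size_polyC_leq1 c)) big_ord1 coefC eqxx. Qed.

Lemma veval1 a : veval a 1 = one.
Proof. by rewrite -polyC1 vevalC scale1r. Qed.

Lemma vevalXM a p : veval a ('X * p) = mul a (veval a p).
Proof.
have le : (size ('X * p)%R <= (size p).+1)%N.
  by apply: leq_trans (size_polyMleq _ _) _; rewrite size_polyX.
rewrite (vevalE a le) big_ord_recl coefXM eqxx scale0r add0r linear_sum.
by apply: eq_bigr => i _; rewrite linearZ coefXM.
Qed.

Lemma vevalX a : veval a 'X = a.
Proof. by rewrite -['X]mulr1 vevalXM veval1 mul1r. Qed.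

Lemma veval_mul a p q : veval a (p * q) = mul (veval a p) (veval a q).
Proof.
elim/poly_ind: p => [|p c IH].
  rewrite mul0r linear0; have := mul_linl (veval a q) (-1) 0 0.
  by rewrite !scaleN1r !addNr => ->.
have -> : (p * 'X + c%:P) * q = c *: q + 'X * (p * q).
  by rewrite -mul_polyC; ring.
have -> : p * 'X + c%:P = c *: 1 + 'X * p by rewrite -mul_polyC; ring.
by rewrite !veval_linear !vevalXM veval1 mul_linl mul1l IH mulA.
Qed.

Lemma veval_Xn a n : veval a 'X^n = vpow a n.
Proof.
elim: n => [|n IH]; first by rewrite expr0 veval1.
by rewrite exprS vevalXM IH.
Qed.

Definition algebraic a := exists p : {poly k}, p != 0 /\ veval a p = 0.

Lemma finspan_algebraic a : finspan (fun _ : V => True) -> algebraic a.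
Proof. by move=> /(finspan_dependent (vpow a)). Qed.

(* The idempotent attached to [a] by a coprime factorisation X^m q of a
   polynomial annihilating [a]. *)
Lemma algebraic_fitting a : algebraic a ->
  exists n (b e : V), [/\ mul e e = e, vpow a n = mul (vpow a n) e,
    mul a b = e & mul b a = e].
Proof.
(* The factor X makes 0 a root, so that m > 0 and X^(m-1) is available for b. *)
move=> [p0 [np0 ev0]]; pose p := 'X * p0.
have np : p != 0 by rewrite mulf_neq0 // polyX_eq0.
have evp : veval a p = 0 by rewrite vevalXM ev0 linear0.
have [m [q nq0 ep]] := multiplicity_XsubC p 0.
rewrite np /= subr0 in nq0 ep.
have m0 : (0 < m)%N.
  rewrite lt0n; apply: contraNneq nq0 => m0.
  by rewrite m0 expr0 mulr1 in ep; rewrite -ep rootM rootX eqxx.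
have : coprimep ('X^m) q.
  by rewrite coprimep_expl // coprimep_sym coprimepX.
move=> /Bezout_eq1_coprimepP[[u v] /= uv].
have evM r s : veval a (r * s) = mul (veval a s) (veval a r) by rewrite mulrC veval_mul.
(* With u X^m + v q = 1 and p = q X^m, the polynomial e = u X^m is idempotent modulo p, and X^m (1 -
   e) = v p. *)
exists m, (veval a (u * 'X^(m.-1))), (veval a (u * 'X^m)); split.
- rewrite -veval_mul; have -> : u * 'X^m * (u * 'X^m) = u * 'X^m - u * v * p.
    by rewrite -{3}[u * 'X^m]mulr1 -uv ep; ring.
  by rewrite linearB /= [veval a (_ * p)]veval_mul evp linear0 subr0.
- rewrite -veval_Xn -veval_mul; have -> : 'X^m * (u * 'X^m) = 'X^m - v * p.
    by rewrite -{3}['X^m]mulr1 -uv ep; ring.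
  by rewrite linearB /= [veval a (_ * p)]veval_mul evp linear0 subr0.
- by rewrite -vevalXM; congr veval; rewrite mulrCA -exprS prednK.
- by rewrite -[X in mul _ X]vevalX -veval_mul; congr veval; rewrite -mulrA -exprSr prednK.
Qed.
End PolyEval.

Lemma veval_morph (k : fieldType) (V W : lmodType k) (mulV : V -> V -> V) oneV
    (mulW : W -> W -> W) oneW (phi : V -> W) a p :
  linear phi -> phi oneV = oneW -> {morph phi : x y / mulV x y >-> mulW x y} ->
  phi (veval mulV oneV a p) = veval mulW oneW (phi a) p.
Proof.
move=> linphi phi1 phiM.
pose phi' : {linear V -> W} := HB.pack phi (GRing.isLinear.Build k V W _ phi linphi).
rewrite -[phi _]/(phi' _) linear_sum; apply: eq_bigr => i _; rewrite linearZ /=.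
by congr (_ *: _); elim: (nat_of_ord i) => //= n <-.
Qed.

(** * Splitting of idempotents and the dichotomy nilpotent or invertible *)

Section Fitting.
Variables (k : fieldType) (A : lualgebra k).
Local Notation "g ** f" := (chcomp g f) (at level 40, left associativity).
Local Notation "f ~~ g" := (homotopic f g) (at level 70).

Definition cpow (Z : complex A) (f : chainmap Z Z) n := vpow (@chcomp k A Z Z Z) (chid Z) f n.

Definition homotopy_equiv (X Y : complex A) (f : chainmap X Y) :=
  exists g : chainmap Y X, g ** f ~~ chid X /\ f ** g ~~ chid Y.

Definition fitting_end (Z : complex A) := forall f : chainmap Z Z,
  (exists n, nullhom (cpow f n)) \/ homotopy_equiv f.

Definition alg_hom (M : module A) (f : hom M M) := algebraic (@hcomp k A M M M) (hid M) f.

Section Image.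
Variables (M : module A) (e : hom M M).
Hypothesis ee : hcomp e e = e.

Definition img_pred : {pred M} := [pred m : M | e m == m].
Fact img_submod : submod_closed img_pred.
Proof.
split=> [|c a b]; rewrite !inE; first by rewrite hom0.
by move=> /eqP ea /eqP eb; rewrite hom_linear ea eb.
Qed.
HB.instance Definition _ :=
  GRing.isSubmodClosed.Build k M img_pred img_submod.

Record img_car := ImgCar { imgval : M; imgvalP : imgval \in img_pred }.
HB.instance Definition _ := [isSub for imgval].
HB.instance Definition _ := [Choice of img_car by <:].
HB.instance Definition _ := [SubChoice_isSubLmodule of img_car by <:].

Fact imgact_subproof (a : A) (m : img_car) : mact a (imgval m) \in img_pred.
Proof. by rewrite inE hom_act (eqP (imgvalP m)). Qed.
Definition imgact a m := ImgCar (imgact_subproof a m).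

Definition img : module A.
Proof.
refine (@Module k A img_car imgact _ _ _ _).
- by move=> m c a b; apply: val_inj; rewrite /= mact_linl.
- by move=> a c m n; apply: val_inj; rewrite /= mact_linr.
- by move=> a b m; apply: val_inj; rewrite /= mactA.
- move=> m; have [s [us es]] := munital (imgval m).
  exists s; split=> //; apply: val_inj; rewrite [RHS]raddf_sum [LHS]es.
  by apply: eq_bigr.
Defined.

Definition img_in : hom img M.
Proof. by exists (fun m : img_car => imgval m). Defined.

Fact img_out_subproof m : e m \in img_pred.
Proof. by rewrite inE; have /(congr1 (fun f => hfun f m))/= -> := ee. Qed.

Definition img_out : hom M img.
Proof.
exists (fun m => ImgCar (img_out_subproof m)).
  by move=> c x y; apply: val_inj; rewrite /= hom_linear.
by move=> a m; apply: val_inj; rewrite /= hom_act.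
Defined.

Lemma img_out_in : hcomp img_out img_in = hid img.
Proof. by apply: hom_ext => m; apply: val_inj; rewrite /= (eqP (imgvalP m)). Qed.
End Image.

Section ImageComplex.
Variables (S : module A -> Prop) (Z : kb_object S) (e : chainmap Z Z).
Hypothesis S_summand : forall M N (i : hom N M) (r : hom M N), hcomp r i = hid N -> S M -> S N.
Hypothesis ee : e ** e = e.

Fact image_idem i : hcomp (e i) (e i) = e i.
Proof. by have /(congr1 (fun f : chainmap Z Z => f i)) := ee. Qed.

Definition img_complex : complex A.
Proof.
refine (@Complex k A (fun i => img (e i)) (fun i j d =>
  hcomp (img_out (image_idem j)) (hcomp (cdiff Z d) (img_in (e i)))) _).
move=> i j l d d' m; apply: val_inj => /=.
by rewrite -cmap_diff cdiff2 !hom0.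
Defined.

Definition img_kb : kb_object S.
Proof.
refine (@KbObject k A S img_complex _ _) => [|i].
  have [n nZ] := kb_bounded Z; exists n => i /nZ z m.
  by apply: val_inj; rewrite /= [LHS]z.
by apply: S_summand (img_out_in (image_idem i)) (@kb_mem k A S Z i).
Defined.

Definition img_kb_in : chainmap img_kb Z.
Proof.
exists (fun i => img_in (e i)) => i j d m /=.
by rewrite cmap_diff (eqP (imgvalP m)).
Defined.

Definition img_kb_out : chainmap Z img_kb.
Proof.
exists (fun i => img_out (image_idem i)) => i j d m; apply: val_inj => /=.
by rewrite -cmap_diff -[e j (e j _)]/((e ** e) j _) ee.
Defined.

Lemma img_kb_out_in : img_kb_out ** img_kb_in = chid img_kb.
Proof.
apply: chainmap_ext => i m.
by have /(congr1 (fun f => hfun f m)) := img_out_in (image_idem i).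
Qed.
Lemma img_kb_in_out : img_kb_in ** img_kb_out = e.
Proof. exact: chainmap_ext. Qed.

Lemma img_kb_zero : kb_zero img_kb -> nullhom e.
Proof.
move=> z; rewrite -img_kb_in_out -[img_kb_in]chcomp1r.
apply/nullhom_compr/nullhom_compl; exact: z.
Qed.
End ImageComplex.

(** As e is idempotent on the nose and not only up to homotopy, it splits degreewise, and the images
    of e and 1 - e are again bounded complexes over S. *)
Lemma kb_indecomposable_idempotent (S : module A -> Prop) (Z : kb_object S) (e : chainmap Z Z) :
  (forall M N (i : hom N M) (r : hom M N), hcomp r i = hid N -> S M -> S N) ->
  kb_indecomposable Z -> e ** e = e -> nullhom e \/ e ~~ chid Z.
Proof.
move=> Ssum [_ indec] ee; pose e' := chid Z - e.
have ee' : e' ** e' = e'.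
  rewrite {1}/e' chcompDl chcomp1l chcompNl /e' chcompDr chcomp1r chcompNr ee.
  by rewrite subrr oppr0 addr0.
have [|/img_kb_zero ne|/img_kb_zero ne'] := indec (img_kb Ssum ee) (img_kb Ssum ee').
- exists (img_kb_in Ssum ee), (img_kb_in Ssum ee'), (img_kb_out Ssum ee), (img_kb_out Ssum ee').
  have e0 : e ** e' = 0 by rewrite chcompDr chcompNr chcomp1r ee subrr.
  have e0' : e' ** e = 0 by rewrite chcompDl chcompNl chcomp1l ee subrr.
  have z (a b : chainmap Z Z) (aa : a ** a = a) (bb : b ** b = b) : a ** b = 0 ->
      img_kb_out Ssum aa ** img_kb_in Ssum bb = 0.
    move=> ab; apply: chainmap_ext => i m; apply: val_inj => /=.
    by rewrite -(eqP (imgvalP m)) -[LHS]/((a ** b) i _) ab.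
  split.
  + by rewrite img_kb_out_in; apply: homotopic_refl.
  + by rewrite img_kb_out_in; apply: homotopic_refl.
  + by rewrite z //; apply: homotopic_refl.
  + by rewrite z //; apply: homotopic_refl.
  + rewrite !img_kb_in_out -[chadd e e']/(e + e') addrC subrK; exact: homotopic_refl.
- by left.
- by right; apply/homotopic_sym/nullhom_homotopic.
Qed.

(** Polynomials in f are evaluated degreewise, so the product of annihilating polynomials over the
    degrees -n, ..., n annihilates f strictly. *)
Lemma bounded_algebraic (Z : complex A) (f : chainmap Z Z) : bounded Z ->
  (forall i (a : hom (Z i) (Z i)), alg_hom a) ->
  algebraic (@chcomp k A Z Z Z) (chid Z) f.
Proof.
move=> [n nZ] alg.
have /choice[p pP] i := alg i (f i).
pose P := \prod_(m < (n + n).+1) p (m%:Z - n%:Z).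
exists P; split; first by apply/prodf_neq0 => m _; case: (pP (m%:Z - n%:Z)).
apply: chainmap_ext => i x.
have -> : veval (@chcomp k A Z Z Z) (chid Z) f P i = veval (@hcomp k A _ _ _) (hid (Z i)) (f i) P.
  exact: (veval_morph (phi := fun g : chainmap Z Z => g i)).
have [lt|le] := boolP (n < `|i|)%N.
  by rewrite [LHS](nZ _ lt).
have lm : (absz (i + n%:Z)%R < (n + n).+1)%N by lia.
rewrite /P (bigD1 (Ordinal lm)) //=.
have -> : (absz (i + n%:Z))%:Z - n%:Z = i by lia.
rewrite veval_mul; first 1 last.
- exact: hcompA.
- exact: hcomp1l.
- by move=> b c g g'; apply: hcomp_linl.
- by move=> b c g g'; apply: hcomp_linr.
by rewrite (pP i).2 hcomp0l.
Qed.

(** The Fitting idempotent e of f lives among strict chain maps. If e is null-homotopic, so is f^n =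
    f^n e; if e is homotopic to 1, then b inverts f. *)
Lemma kb_indecomposable_fitting (S : module A -> Prop) (Z : kb_object S) :
  (forall M N (i : hom N M) (r : hom M N), hcomp r i = hid N -> S M -> S N) ->
  kb_indecomposable Z -> (forall i (a : hom (Z i) (Z i)), alg_hom a) ->
  fitting_end Z.
Proof.
move=> Ssum indec alg f.
have [|||||n [b [e [ee fe eb be]]]] :=
  algebraic_fitting _ _ _ _ _ (bounded_algebraic f (kb_bounded Z) alg).
- exact: chcompA.
- exact: chcomp1l.
- exact: chcomp1r.
- by move=> g c h h'; rewrite chcompDl chcompZl.
- by move=> g c h h'; rewrite chcompDr chcompZr.
have [ne|ie] := kb_indecomposable_idempotent Ssum indec ee.
  by left; exists n; rewrite /cpow fe; apply: nullhom_compl.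
by right; exists b; rewrite be eb.
Qed.
End Fitting.

(** * Serre duality *)

Section Serre.
Variables (k : fieldType) (A : lualgebra k).
Local Notation "g ** f" := (chcomp g f) (at level 40, left associativity).
Local Notation "f ~~ g" := (homotopic f g) (at level 70).

(* Forms th i on Hom(Z^i, Y^i) such that u |-> (f |-> th i (u f)) is an
   isomorphism Hom(N, Y^i) -> Hom_k(Hom(Z^i, N), k) for every module N. The sign
   in the last field makes the sum of the th i vanish on null-homotopic maps. *)
Record serre_data (Z Y : complex A) := SerreData {
  th :> forall i, hom (Z i) (Y i) -> k;
  th_lin : forall i, scalar (@th i);
  th_inj : forall i N (u : hom N (Y i)), (forall f, th (hcomp u f) = 0) -> u = 0;
  th_sur : forall i N (phi : hom (Z i) N -> k), scalar phi ->
    exists u : hom N (Y i), forall f, th (hcomp u f) = phi f;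
  th_d : forall i (u : hom (Z (i + 1)) (Y i)),
    th (hcomp (cdiff Y erefl) u) = - th (hcomp u (cdiff Z erefl))
}.

Section Forms.
Variables (Z Y : complex A) (th : serre_data Z Y) (n : nat).
Hypothesis nZ : forall i : int, (n < `|i|)%N -> is_zero_module (Z i).

Lemma thD i (f g : hom (Z i) (Y i)) : th i (f + g) = th i f + th i g.
Proof. by rewrite -[f]scale1r th_lin mul1r scale1r. Qed.
Lemma th0 i : th i 0 = 0.
Proof. by apply: (addrI (th i 0)); rewrite -thD !addr0. Qed.
Lemma thZ i c (f : hom (Z i) (Y i)) : th i (c *: f) = c * th i f.
Proof. by rewrite -[c *: f]addr0 th_lin th0 addr0. Qed.
Lemma thN i (f : hom (Z i) (Y i)) : th i (- f) = - th i f.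
Proof. by rewrite -scaleN1r thZ mulN1r. Qed.
Lemma th_sum i (I : Type) (r : seq I) (F : I -> hom (Z i) (Y i)) :
  th i (\sum_(j <- r) F j) = \sum_(j <- r) th i (F j).
Proof. exact: (big_morph (th i) (@thD i) (th0 i)). Qed.

(** A nonzero x is detected by some linear form, and every form is represented by a map to Y^i. *)
Lemma th_nondeg i N (x : hom (Z i) N) :
  (forall b : hom N (Y i), th i (hcomp b x) = 0) -> x = 0.
Proof.
move=> bx; apply: contrapT => nx.
have [|c y z -> -> | // |phi [phil _ phix]] :=
  @linear_form_separates k _ (fun y : hom (Z i) N => y = 0) x.
- by [].
- by rewrite scaler0 addr0.
have [u uP] := th_sur th phil.
by have /eqP := bx u; rewrite uP phix oner_eq0.
Qed.

(** The sum over the degrees from -n to n, outside which Z vanishes. The alternating signs are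
    already part of the forms [th]. *)
Definition trace (f : fam Z Y) : k := \sum_(m < (n + n).+1) th (m%:Z - n%:Z) (f (m%:Z - n%:Z)).

Lemma trace_lin c f g : trace (c *: f + g) = c * trace f + trace g.
Proof. by rewrite /trace mulr_sumr -big_split; apply: eq_bigr => m _; apply: th_lin. Qed.
Lemma traceD f g : trace (f + g) = trace f + trace g.
Proof. by rewrite -[f]scale1r trace_lin mul1r scale1r. Qed.
Lemma trace0 : trace 0 = 0.
Proof. by apply: (addrI (trace 0)); rewrite -traceD !addr0. Qed.
Lemma traceN f : trace (- f) = - trace f.
Proof. by rewrite -scaleN1r -[_ *: f]addr0 trace_lin trace0 addr0 mulN1r. Qed.
Lemma traceB f g : trace (f - g) = trace f - trace g.
Proof. by rewrite traceD traceN. Qed.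

Lemma th_out i f : (n < `|i|)%N -> th i f = 0.
Proof. by move=> /nZ z; rewrite (hom_from_zero f z) th0. Qed.

Lemma trace_single (f : fam Z Y) i : (forall j, j != i -> f j = 0) -> trace f = th i (f i).
Proof.
move=> fj; have [lt|le] := boolP (n < `|i|)%N.
  rewrite th_out // /trace big1 // => m _; rewrite fj ?th0 //.
  by case: m => m /=; lia.
have lm : (absz (i + n%:Z)%R < (n + n).+1)%N by lia.
have em : (Ordinal lm)%:Z - n%:Z = i by rewrite /=; lia.
rewrite /trace (bigD1 (Ordinal lm)) //= -[absz _]/(nat_of_ord (Ordinal lm)) em.
rewrite big1 ?addr0 // => m nm; rewrite fj ?th0 //.
by apply: contraNneq nm => e; apply/eqP/val_inj => /=; lia.
Qed.

(* [a + b] is the null-homotopic family defined by q; its trace telescopes to 0. *)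
Lemma trace_homotopy (q : forall i, hom (Z (i + 1)) (Y i)) (a b : fam Z Y) :
  (forall i, a i = hcomp (q i) (cdiff Z erefl)) ->
  (forall i, b (i + 1) = hcomp (cdiff Y erefl) (q i)) -> trace b = - trace a.
Proof.
move=> ea eb; pose F i := th i (a i).
have Fb j : th j (b j) = - F (j - 1).
  have [i ei] := int_succ j; case: j / ei.
  by rewrite eb th_d addrK /F ea.
rewrite /trace -sumrN; apply/eqP; rewrite -subr_eq0 -sumrB.
under eq_bigr => m _ do rewrite Fb opprK.
(* The sum telescopes to F n - F (-n-1): the second term is 0 because Z vanishes there, the first
   because the differential of Z leaving degree n is 0. *)
pose s (m : nat) := F (m%:Z - n%:Z - 1).
have -> : \sum_(m < (n + n).+1) (- F (m%:Z - n%:Z - 1) + th (m%:Z - n%:Z) (a (m%:Z - n%:Z))) =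
    \sum_(m < (n + n).+1) (s m.+1 - s m).
  apply: eq_bigr => m _; rewrite addrC /s; congr (_ - _).
  by rewrite -[th _ _]/(F (m%:Z - n%:Z)); congr F; lia.
rewrite -(big_mkord xpredT (fun m => s m.+1 - s m)) telescope_sumr //.
have -> : s 0%N = 0 by rewrite /s /F th_out //; lia.
have -> : s (n + n).+1 = 0.
  rewrite /s; have -> : (n + n).+1%:Z - n%:Z - 1 = n%:Z by lia.
  rewrite /F ea; have -> : cdiff Z (erefl (n%:Z + 1)) = 0.
    by apply: hom_to_zero; apply: nZ; lia.
  by rewrite hcomp0r th0.
by rewrite subr0.
Qed.

Definition famcomp (N : int -> module A) (t : fam N Y) (g : fam Z N) : fam Z Y :=
  fun i => hcomp (t i) (g i).

Lemma famcomp_inj (N : int -> module A) (t : fam N Y) :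
  (forall g, trace (famcomp t g) = 0) -> t = 0.
Proof.
move=> tg; apply: fam_ext => i; rewrite fam_zeroE; apply: (@th_inj _ _ th) => f.
have [g [gi gj]] := @update_at (fun j => hom (Z j) (N j)) (fun=> 0) i f.
rewrite -gi -[RHS](tg g) (@trace_single _ i) // => j /gj e.
by rewrite /famcomp e hcomp0r.
Qed.

Definition single (N : int -> module A) i (f : hom (Z i) (N i)) : fam Z N :=
  fun j => match @eqP _ i j with
  | ReflectT e => eq_rect i (fun j => hom (Z j) (N j)) f j e | ReflectF _ => 0 end.

Lemma singleE (N : int -> module A) i (f : hom (Z i) (N i)) : single f i = f.
Proof. by rewrite /single; case: eqP => // e; rewrite (eq_irrelevance e erefl). Qed.
Lemma single_out (N : int -> module A) i j (f : hom (Z i) (N i)) : i != j -> single f j = 0.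
Proof. by rewrite /single; case: eqP => // e; rewrite -{1}e eqxx. Qed.

Lemma single_lin (N : int -> module A) i c (f g : hom (Z i) (N i)) :
  single (c *: f + g) = c *: single f + single g.
Proof.
apply: fam_ext => j; rewrite fam_addE fam_scaleE; have [<-|ne] := eqVneq i j.
  by rewrite !singleE.
by rewrite !single_out // scaler0 addr0.
Qed.

(** Z being bounded, a family out of Z is the finite sum of its components, and phi is represented
    degree by degree. *)
Lemma fam_form (N : int -> module A) (phi : fam Z N -> k) : scalar phi ->
  exists t : fam N Y, forall g, phi g = trace (famcomp t g).
Proof.
move=> phil.
have H i := @th_sur _ _ th i (N i) (fun f => phi (single f))
  (fun c f g => etrans (congr1 phi (single_lin c f g)) (phil _ _ _)).
pose t i := sval (boolp.cid (H i)).
have tP i : forall f, th i (hcomp (t i) f) = phi (single f) by apply: (svalP (boolp.cid (H i))).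
exists t => g.
pose phi' : {scalar fam Z N} := HB.pack phi (GRing.isLinear.Build k (fam Z N) k _ phi phil).
have eg : g = \sum_(m < (n + n).+1) single (g (m%:Z - n%:Z)).
  apply: fam_ext => i.
  rewrite (big_morph (fun f : fam Z N => f i) (id1 := 0) (op1 := +%R)) //.
  have [lt|le] := boolP (n < `|i|)%N.
    rewrite (hom_from_zero (g i) (nZ lt)) big1 // => m _.
    by apply: single_out; apply/eqP; case: m => m /=; lia.
  have lm : (absz (i + n%:Z)%R < (n + n).+1)%N by lia.
  have em : (Ordinal lm)%:Z - n%:Z = i by rewrite /=; lia.
  rewrite (bigD1 (Ordinal lm)) //= -[absz _]/(nat_of_ord (Ordinal lm)) em singleE.
  rewrite big1 ?addr0 // => m nm; rewrite single_out //.
  by apply: contraNneq nm => e; apply/eqP/val_inj => /=; lia.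
rewrite {1}eg -[phi _]/(phi' _) linear_sum; apply: eq_bigr => m _.
by rewrite /famcomp tP.
Qed.

Definition tr (f : chainmap Z Y) : k := trace (cmap f).

Lemma tr_lin c f g : tr (c *: f + g) = c * tr f + tr g.
Proof. exact: (trace_lin c (cmap f) (cmap g)). Qed.
Lemma tr0 : tr 0 = 0.
Proof. exact: trace0. Qed.

Lemma tr_null f : nullhom f -> tr f = 0.
Proof.
move=> /nullhomS[h hh].
pose a : fam Z Y := fun i => hcomp (h i) (cdiff Z erefl).
have -> : tr f = trace (a + ((cmap f : fam Z Y) - a)) by rewrite addrC subrK.
rewrite traceD (@trace_homotopy h a (_ - a)) ?subrr // => i.
apply: hom_ext => x; rewrite fam_addE fam_oppE !hevE hh /a ?hevE.
by rewrite addrK.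
Qed.

Lemma tr_homotopic f g : f ~~ g -> tr f = tr g.
Proof.
move=> /homotopic_nullhom/tr_null; rewrite -scaleN1r addrC tr_lin mulN1r addrC.
by move/eqP; rewrite subr_eq0 => /eqP.
Qed.

(** Chain maps g are the kernel of D g = d g - g d, so the form g |-> trace(t g) on families factors
    through D. The factor is represented by maps s : N^(i+1) -> Y^i, and moving d across the trace
    turns trace(t g) = trace(s (D g)) into t = s d + d s. *)
Lemma tr_null_left N (t : chainmap N Y) :
  (forall g : chainmap Z N, tr (t ** g) = 0) -> nullhom t.
Proof.
move=> tg0; pose N1 i := N (i + 1).
pose D (g : fam Z N) : fam Z N1 := fun i =>
  hcomp (cdiff N erefl) (g i) - hcomp (g (i + 1)) (cdiff Z erefl).
have [|g h|g Dg|sigma sigmal sD] := @linear_form_factor k (fam Z N1) (fam Z N) D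
    (fun g => trace (famcomp (cmap t) g)).
- move=> c g h; apply: fam_ext => i; apply: hom_ext => x.
  rewrite /D !(fam_addE, fam_scaleE) ?hevE ?(fam_addE, fam_scaleE) ?hevE homD homZ.
  by rewrite opprD addrACA scalerBr.
- move=> h'; rewrite -trace_lin; congr trace; apply: fam_ext => i.
  exact: hcomp_linr.
- have [|g' g'E] := @chainmapS k A Z N g.
    move=> i x; have /(congr1 (fun f : fam Z N1 => f i x)) := Dg.
    by rewrite /D fam_zeroE !hevE => /eqP; rewrite subr_eq0 => /eqP.
  by rewrite -[RHS](tg0 g'); congr trace; apply: fam_ext => i; rewrite /famcomp /= g'E.
have [s sP] := fam_form sigmal.
have [e eE] : exists e : fam N Y, forall i, e (i + 1) = hcomp (cdiff Y erefl) (s i).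
  exact: (@reindex_succ (fun j => hom (N j) (Y j))).
pose sd : fam N Y := fun i => hcomp (s i) (cdiff N erefl).
have tE : (cmap t : fam N Y) = sd + e.
  apply/eqP; rewrite -subr_eq0; apply/eqP/famcomp_inj => g.
  pose qd : fam Z Y := fun i => hcomp (hcomp (s i) (g (i + 1))) (cdiff Z erefl).
  have -> : famcomp ((cmap t : fam N Y) - (sd + e)) g =
      famcomp (cmap t) g - (famcomp sd g + famcomp e g).
    apply: fam_ext => i; apply: hom_ext => x.
    by rewrite /famcomp ?(fam_addE, fam_oppE) ?hevE ?(fam_addE, fam_oppE) ?hevE.
  rewrite traceB -sD sP traceD.
  rewrite (@trace_homotopy (fun i => hcomp (s i) (g (i + 1)))
    qd (famcomp e g)) //; last first.
    by move=> i; rewrite /famcomp eE hcompA.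
  rewrite -!traceB; have -> : famcomp s (D g) - (famcomp sd g - qd) = 0.
    apply: fam_ext => i; apply: hom_ext => x.
    rewrite ?(fam_addE, fam_oppE) ?hevE /famcomp /D /sd /qd ?hevE homB.
    by rewrite opprB addrA subrK subrr.
  by rewrite trace0.
apply/nullhomS; exists s => i x.
by have -> : t (i + 1) = (sd + e) (i + 1); [rewrite -tE | rewrite fam_addE eE !hevE [LHS]addrC].
Qed.

(** The form is extended from chain maps to families and represented there by a family t. That phi
    kills null-homotopic maps says precisely that t commutes with the differentials. *)
Lemma tr_form N (phi : chainmap Z N -> k) : scalar phi ->
  (forall g, nullhom g -> phi g = 0) ->
  exists t : chainmap N Y, forall g, phi g = tr (t ** g).
Proof.
move=> phil phi0.
have [c g h||g g0|Phi Phil PhiE] := @linear_form_factor k (fam Z N) (chainmap Z N)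
  (fun g => cmap g) phi.
- by apply: fam_ext.
- by [].
- suff -> : g = 0 by apply/phi0/nullhom0.
  apply: chainmap_ext => i x.
  by have /(congr1 (fun f : fam Z N => f i x)) := g0.
have [t tP] := fam_form Phil.
have [|t' t'E] := @chainmapS k A N Y t.
  move=> i x; suff /(congr1 (fun f => hfun f x)) :
      hcomp (t (i + 1)) (cdiff N erefl) - hcomp (cdiff Y erefl) (t i) = 0.
    by rewrite !hevE => /eqP; rewrite subr_eq0 => /eqP.
  apply: (@th_inj _ _ th (i + 1)) => f.
  (* The test map g = d h + h d comes from a homotopy with f as its only component, so the trace
     isolates one commutation defect of t. *)
  have [h [hi hj]] := @update_at (fun j => hom (Z (j + 1)) (N j)) (fun=> 0) i f.
  have [dh dhE] : exists dh : fam Z N, forall j, dh (j + 1) = hcomp (cdiff N erefl) (h j).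
    exact: (@reindex_succ (fun j => hom (Z j) (N j))).
  pose hd : fam Z N := fun j => hcomp (h j) (cdiff Z erefl).
  have [|g gE] := @chainmapS k A Z N (fun j => dh j + hd j).
    move=> j x'; have [j' ej] := int_succ j; case: j / ej x' => x'.
    by rewrite !hevE !dhE /hd !hevE homD !cdiff2 hom0 addr0 add0r.
  have ng : nullhom g.
    apply/nullhomS; exists h => j x'.
    by rewrite gE !hevE dhE /hd !hevE.
  have := phi0 g ng; rewrite -PhiE tP.
  have -> : famcomp t (cmap g) = famcomp t dh + famcomp t hd.
    by apply: fam_ext => j; rewrite /famcomp gE; apply: hcompDr.
  have [b bE] : exists b : fam Z Y, forall j,
      b (j + 1) = hcomp (cdiff Y erefl) (hcomp (t j) (h j)).
    exact: (@reindex_succ (fun j => hom (Z j) (Y j))).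
  rewrite traceD [trace (famcomp t hd)](_ : _ = - trace b); last first.
    rewrite (@trace_homotopy (fun j => hcomp (t j) (h j)) (famcomp t hd) b) ?opprK // => j.
    exact: hcompA.
  rewrite -traceB (@trace_single _ (i + 1)).
    rewrite fam_addE fam_oppE /famcomp dhE bE hi.
    by rewrite hcompDl hcompNl !hcompA.
  move=> j nj; have [j' ej] := int_succ j; case: j / ej nj => nj.
  rewrite fam_addE fam_oppE /famcomp dhE bE hj ?hcomp0r ?subrr //.
  by apply: contraNneq nj => ->.
exists t' => g; rewrite -PhiE tP; congr trace; apply: fam_ext => i.
by rewrite /famcomp chE t'E.
Qed.

Lemma tr_null_right N (g : chainmap Z N) :
  (forall t : chainmap N Y, tr (t ** g) = 0) -> nullhom g.
Proof.
move=> tg0; apply: contrapT => ng.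
have [||//|phi [phil phi0 phig]] := @linear_form_separates k _ (@nullhom k A Z N) g.
- exact: nullhom0.
- by move=> c x y; apply: nullhom_lin.
have [t tP] := tr_form phil phi0.
by have /eqP := tg0 t; rewrite -tP phig oner_eq0.
Qed.

(** The forms a |-> th(a b_l), with the b_l spanning End(Z^i), have common kernel 0 by [th_inj].
    Being finitely many, they span all forms on Hom(Z^i, Y^i), in particular a |-> th(s a). *)
Lemma th_transpose i (s : hom (Y i) (Y i)) : finspan (fun _ : hom (Z i) (Z i) => True) ->
  exists f : hom (Z i) (Z i), forall a, th i (hcomp s a) = th i (hcomp a f).
Proof.
move=> [m [b bP]].
have [l c x y|c x y|a ab|c cP] := @linear_form_combination k (hom (Z i) (Y i)) m
  (fun l a => th i (hcomp a (b l))) (fun a => th i (hcomp s a)).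
- by rewrite hcomp_linl th_lin.
- by rewrite hcomp_linr th_lin.
- suff -> : a = 0 by rewrite hcomp0r th0.
  apply: (@th_inj _ _ th) => f; have [c ->] := bP f I.
  have -> : hcomp a (\sum_l c l *: b l) = \sum_l c l *: hcomp a (b l).
    apply: hom_ext => x; rewrite !hevE hom_sum.
    by apply: eq_bigr => l _; rewrite !hevE homZ.
  by rewrite th_sum big1 // => l _; rewrite thZ ab mulr0.
exists (\sum_l c l *: b l) => a.
have -> : hcomp a (\sum_l c l *: b l) = \sum_l c l *: hcomp a (b l).
  apply: hom_ext => x; rewrite !hevE hom_sum.
  by apply: eq_bigr => l _; rewrite !hevE homZ.
by rewrite th_sum cP; apply: eq_bigr => l _; rewrite thZ.
Qed.

(** A polynomial annihilating the transpose of s annihilates s. This gives algebraicity of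
    endomorphisms of injective terms from finiteness on the projective side. *)
Lemma th_algebraic i (s : hom (Y i) (Y i)) : finspan (fun _ : hom (Z i) (Z i) => True) ->
  alg_hom s.
Proof.
move=> fs; have [f fP] := th_transpose s fs.
have [p [np pf]] := finspan_algebraic (@hcomp k A _ _ _) (hid (Z i)) f fs.
exists p; split=> //; apply: (@th_inj _ _ th) => a.
have pw r : forall a, th i (hcomp (vpow (@hcomp k A _ _ _) (hid (Y i)) s r) a) =
    th i (hcomp a (vpow (@hcomp k A _ _ _) (hid (Z i)) f r)).
  elim: r => [|r IH] b; first by rewrite /= hcomp1l hcomp1r.
  by rewrite /= -hcompA fP -hcompA IH -hcompA.
have -> : hcomp (veval (@hcomp k A _ _ _) (hid (Y i)) s p) a =
    \sum_(j < size p) p`_j *: hcomp (vpow (@hcomp k A _ _ _) (hid (Y i)) s j) a.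
  by apply: hom_ext => x; rewrite !hevE; apply: eq_bigr => j _; rewrite !hevE.
rewrite th_sum; under eq_bigr => j _ do rewrite thZ pw -thZ.
rewrite -th_sum.
have -> : \sum_(j < size p) p`_j *:
      hcomp a (vpow (@hcomp k A _ _ _) (hid (Z i)) f j) =
    hcomp a (veval (@hcomp k A _ _ _) (hid (Z i)) f p).
  apply: hom_ext => x; rewrite !hevE hom_sum.
  by apply: eq_bigr => j _; rewrite !hevE homZ.
by rewrite pf hcomp0r th0.
Qed.

Lemma tr_transpose (t : chainmap Y Y) :
  (forall i, finspan (fun _ : hom (Z i) (Z i) => True)) ->
  exists f : chainmap Z Z, forall a, tr (t ** a) = tr (a ** f).
Proof.
move=> fs; pose f i := sval (boolp.cid (th_transpose (t i) (fs i))).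
have fP i a : th i (hcomp (t i) a) = th i (hcomp a (f i)).
  by move: a; apply: (svalP (boolp.cid (th_transpose (t i) (fs i)))).
have [|f' f'E] := @chainmapS k A Z Z f.
  move=> i x; suff /(congr1 (fun f => hfun f x)) :
      hcomp (f (i + 1)) (cdiff Z erefl) - hcomp (cdiff Z erefl) (f i) = 0.
    by rewrite !hevE => /eqP; rewrite subr_eq0 => /eqP.
  apply: th_nondeg => b; rewrite hcompDr hcompNr thD thN; apply/eqP.
  rewrite subr_eq0; apply/eqP.
  have thd u : th i (hcomp u (cdiff Z erefl)) = - th (i + 1) (hcomp (cdiff Y erefl) u).
    by rewrite th_d opprK.
  rewrite [in LHS]hcompA thd hcompA -fP hcompA cmap_hcomp -hcompA th_d opprK.
  by rewrite -hcompA fP hcompA.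
exists f' => a; apply: eq_bigr => m _.
by rewrite !chE f'E fP.
Qed.

(** In this direction t is obtained globally from [tr_form], as the map representing a |-> tr(a
    f). *)
Lemma tr_transpose_right (f : chainmap Z Z) :
  exists t : chainmap Y Y, forall a, tr (t ** a) = tr (a ** f).
Proof.
have [c x y|g ng|t tP] := @tr_form Y (fun a => tr (a ** f)).
- by rewrite chcompDl chcompZl tr_lin.
- by apply/tr_null/nullhom_compr.
by exists t.
Qed.

Section KInjective.
Hypothesis KZ : Kprojective Z.

Lemma serre_null_comp N N' (s : chainmap N N') (t : chainmap N' Y) :
  quasi_iso s -> nullhom (t ** s) -> nullhom t.
Proof.
move=> qs nts; apply: tr_null_left => g; have [g' eg] := Kprojective_lift KZ g qs.
have e : t ** g ~~ t ** s ** g' by rewrite eg chcompA; reflexivity.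
by rewrite (tr_homotopic e); apply/tr_null/nullhom_compr.
Qed.

(** A map g : Z -> N' lifts through s uniquely up to homotopy, so the trace of t after the lift is a
    well-defined form in g; t' represents it. *)
Lemma serre_extend N N' (s : chainmap N N') (t : chainmap N Y) :
  quasi_iso s -> exists t' : chainmap N' Y, t ~~ t' ** s.
Proof.
move=> qs.
have /choice[l lP] g := Kprojective_lift (N := N) KZ g qs.
have lift_eq (g g' : chainmap Z N) : s ** g ~~ s ** g' -> tr (t ** g) = tr (t ** g').
  move=> /homotopic_nullhom; rewrite -chcompNr -chcompDr => /(Kprojective_null KZ qs) n0.
  apply/tr_homotopic/nullhom_homotopic; rewrite -chcompNr -chcompDr.
  exact: nullhom_compl.
have [c x y|g ng|t' t'P] := @tr_form N' (fun g => tr (t ** l g)).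
- rewrite -tr_lin -chcompZr -chcompDr; apply: lift_eq.
  rewrite -lP chcompDr chcompZr; apply: homotopicD; last exact: lP.
  by apply: nullhom_homotopic; rewrite -scalerBr; apply/nullhomZ/homotopic_nullhom.
- rewrite -[RHS]tr0 -[0 in RHS](chcomp0r Z t); apply: lift_eq.
  by rewrite -lP chcomp0r.
exists t'; apply: nullhom_homotopic; apply: tr_null_left => g.
rewrite chcompDl chcompNl addrC -scaleN1r tr_lin -chcompA -t'P mulN1r addrC.
apply/eqP; rewrite subr_eq0; apply/eqP; apply: lift_eq.
exact: lP.
Qed.
End KInjective.
End Forms.
End Serre.

(** * The radical of a local endomorphism ring *)

Section Local.
Variables (k : fieldType) (A : lualgebra k).
Local Notation "g ** f" := (chcomp g f) (at level 40, left associativity).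
Local Notation "f ~~ g" := (homotopic f g) (at level 70).

Definition nilpotent (Z : complex A) (f : chainmap Z Z) := exists n, nullhom (cpow f n).

Lemma cpowS (Z : complex A) (f : chainmap Z Z) n : cpow f n.+1 = f ** cpow f n.
Proof. by []. Qed.

Lemma cpowSr (Z : complex A) (f : chainmap Z Z) n : cpow f n.+1 = cpow f n ** f.
Proof.
elim: n => [|n IH]; first by rewrite /cpow /= chcomp1l chcomp1r.
by rewrite cpowS {1}IH chcompA -cpowS.
Qed.

Lemma nilpotent_null (Z : complex A) (f : chainmap Z Z) : nullhom f -> nilpotent f.
Proof. by move=> nf; exists 1%N; rewrite cpowS; apply: nullhom_compr. Qed.

Lemma nilpotentZ (Z : complex A) c (f : chainmap Z Z) : nilpotent f -> nilpotent (c *: f).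
Proof.
move=> [n nf]; exists n; suff -> : cpow (c *: f) n = c ^+ n *: cpow f n.
  exact: nullhomZ.
elim: n {nf} => [|n IH]; first by rewrite expr0 scale1r.
by rewrite !cpowS IH chcompZl chcompZr scalerA exprS.
Qed.

Lemma nilpotent_swap (X Y : complex A) (f : chainmap X Y) (g : chainmap Y X) :
  nilpotent (g ** f) -> nilpotent (f ** g).
Proof.
move=> [n nf]; exists n.+1.
have sw m : cpow (f ** g) m ** f = f ** cpow (g ** f) m.
  elim: m => [|m IH]; first by rewrite /cpow /= chcomp1l chcomp1r.
  by rewrite !cpowS -chcompA IH !chcompA.
rewrite cpowSr chcompA sw.
by apply/nullhom_compr/nullhom_compl.
Qed.

Lemma nilpotent_not_left_invertible (Z : complex A) (f g : chainmap Z Z) :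
  ~ nullhom (chid Z) -> nilpotent f -> ~ g ** f ~~ chid Z.
Proof.
move=> nz [n nf] gf; apply: nz; elim: n nf => // n IH; rewrite cpowS => nf.
apply: IH; rewrite -[cpow f n]chcomp1l -gf -chcompA.
exact: nullhom_compl.
Qed.

Lemma nilpotent_geometric (Z : complex A) (f : chainmap Z Z) :
  nilpotent f -> homotopy_equiv (chid Z - f).
Proof.
move=> [n nf].
pose S := fix S m := if m is m'.+1 then chid Z + f ** S m' else 0.
have Sl m : S m ** (chid Z - f) = chid Z - cpow f m.
  elim: m => [|m IH] /=; first by rewrite chcomp0l subrr.
  rewrite chcompDl chcomp1l -chcompA IH chcompDr chcompNr chcomp1r -cpowS.
  by rewrite addrA subrK.
have Sr m : (chid Z - f) ** S m = chid Z - cpow f m.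
  elim: m => [|m IH] /=; first by rewrite chcomp0r subrr.
  rewrite chcompDr chcomp1r chcompA.
  have -> : (chid Z - f) ** f = f ** (chid Z - f).
    by rewrite chcompDl chcompDr chcompNl chcompNr chcomp1l chcomp1r.
  rewrite -chcompA IH chcompDr chcompNr chcomp1r -cpowS.
  by rewrite addrA subrK.
exists (S n); rewrite Sl Sr; split; apply: nullhom_homotopic;
  by rewrite addrAC subrr add0r; apply: nullhomN.
Qed.

(** If u inverts f + g, then u f and u g are nilpotent, since otherwise f or g would be left
    invertible. But u g is homotopic to 1 - u f, which is invertible. *)
Lemma nilpotentD (Z : complex A) (f g : chainmap Z Z) :
  ~ nullhom (chid Z) -> fitting_end Z -> nilpotent f -> nilpotent g -> nilpotent (f + g).
Proof.
move=> nz fit nf ng; have [//|[u [ufg _]]] := fit (f + g); exfalso.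
have nuf (h : chainmap Z Z) : nilpotent h -> nilpotent (u ** h).
  move=> nh; have [//|[v [vuh _]]] := fit (u ** h).
  by case: (@nilpotent_not_left_invertible _ h (v ** u) nz nh); rewrite -chcompA.
have [v [vu _]] := nilpotent_geometric (nuf _ nf).
have e : u ** g ~~ chid Z - u ** f.
  by rewrite -ufg chcompDr [u ** f + _]addrC addrK; reflexivity.
apply: (@nilpotent_not_left_invertible _ (u ** g) v nz (nuf _ ng)).
by rewrite e.
Qed.

Lemma nilpotent_id (Z : complex A) : nilpotent (chid Z) -> nullhom (chid Z).
Proof.
move=> [n]; suff -> : cpow (chid Z) n = chid Z by [].
by elim: n => // n IH; rewrite cpowS IH chcomp1l.
Qed.

Lemma local_form (Z : complex A) : ~ nullhom (chid Z) -> fitting_end Z ->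
  exists phi : chainmap Z Z -> k,
    [/\ scalar phi, forall f, nilpotent f -> phi f = 0 & phi (chid Z) = 1].
Proof.
move=> nz fit; apply: linear_form_separates.
- exact/nilpotent_null/nullhom0.
- by move=> c f g nf ng; apply: nilpotentD => //; apply: nilpotentZ.
- by move/nilpotent_id.
Qed.

Lemma cpow_shift (X : complex A) (f : chainmap X X) n :
  shift_map 1 (cpow f n) = cpow (shift_map 1 f) n.
Proof.
elim: n => [|n IH]; first exact: shift_map_id.
by rewrite !cpowS shift_map_comp IH.
Qed.

Lemma nilpotent_shift (X : complex A) (f : chainmap X X) :
  nilpotent f -> nilpotent (shift_map 1 f).
Proof. by move=> [n nf]; exists n; rewrite -cpow_shift; apply: nullhom_shift. Qed.

Lemma fitting_unshift (X : complex A) : fitting_end (shift 1 X) -> fitting_end X.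
Proof.
move=> fit f; have [[n]|[g [gf fg]]] := fit (shift_map 1 f).
  by rewrite -cpow_shift => /nullhom_unshift nf; left; exists n.
right; have [g' eg] := shift_map_full g; exists g'.
by split; apply: homotopic_unshift; rewrite shift_map_comp eg shift_map_id.
Qed.

Lemma fitting_shift (X : complex A) : fitting_end X -> fitting_end (shift 1 X).
Proof.
move=> fit f; have [f' <-] := shift_map_full f; have [[n nf]|[g [gf fg]]] := fit f'.
  by left; exists n; rewrite -cpow_shift; apply: nullhom_shift.
right; exists (shift_map 1 g).
by split; rewrite -shift_map_comp -shift_map_id; apply: homotopic_shift.
Qed.

Section SerreFitting.
Variables (Z Y : complex A) (th : serre_data Z Y) (n : nat).
Hypothesis nZ : forall i : int, (n < `|i|)%N -> is_zero_module (Z i).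
Hypothesis fs : forall i, finspan (fun _ : hom (Z i) (Z i) => True).
Local Notation tr := (tr th n).

Lemma tr_cpow (t : chainmap Y Y) (f : chainmap Z Z) m :
  (forall a, tr (t ** a) = tr (a ** f)) ->
  forall a, tr (cpow t m ** a) = tr (a ** cpow f m).
Proof.
move=> tf; elim: m => [|m IH] a; first by rewrite /cpow /= chcomp1l chcomp1r.
by rewrite cpowS -chcompA tf -chcompA IH -chcompA cpowS.
Qed.

Lemma nilpotent_transpose (t : chainmap Y Y) (f : chainmap Z Z) :
  (forall a, tr (t ** a) = tr (a ** f)) -> nilpotent t <-> nilpotent f.
Proof.
move=> tf; split=> -[m nm]; exists m.
  apply: (tr_null_right nZ (th := th)) => a; rewrite -(tr_cpow _ tf).
  by apply: (tr_null th nZ); apply: nullhom_compr.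
apply: (tr_null_left nZ (th := th)) => a; rewrite (tr_cpow _ tf).
by apply: (tr_null th nZ); apply: nullhom_compl.
Qed.

(** Transposition keeps the order of factors: tr(t1 t2 a) = tr(t2 a f1) = tr(a f1 f2). Hence
    inverses correspond to inverses. *)
Lemma homotopy_equiv_transpose (t : chainmap Y Y) (f : chainmap Z Z) :
  (forall a, tr (t ** a) = tr (a ** f)) -> homotopy_equiv t <-> homotopy_equiv f.
Proof.
move=> tf.
have inv (t1 t2 : chainmap Y Y) (f1 f2 : chainmap Z Z) :
    (forall a, tr (t1 ** a) = tr (a ** f1)) -> (forall a, tr (t2 ** a) = tr (a ** f2)) ->
    t1 ** t2 ~~ chid Y <-> f1 ** f2 ~~ chid Z.
  move=> tf1 tf2.
  have e a : tr ((t1 ** t2) ** a) = tr (a ** (f1 ** f2)).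
    by rewrite -chcompA tf1 -chcompA tf2 -chcompA.
  have trBl (u v : chainmap Z Y) : tr (u - v) = tr u - tr v.
    by rewrite addrC -scaleN1r (tr_lin th n) mulN1r addrC.
  split=> h; apply: nullhom_homotopic.
    apply: (tr_null_right nZ (th := th)) => a; rewrite chcompDr chcompNr trBl -e.
    rewrite (tr_homotopic th nZ (g := a)) ?chcomp1r ?subrr //.
    by rewrite h chcomp1l; reflexivity.
  apply: (tr_null_left nZ (th := th)) => a; rewrite chcompDl chcompNl trBl e.
  rewrite (tr_homotopic th nZ (g := a)) ?chcomp1l ?subrr //.
  by rewrite h chcomp1r; reflexivity.
split=> -[g [gl gr]].
  have [f' ff'] := tr_transpose th n g fs.
  by exists f'; split; [apply/(inv _ _ _ _ ff' tf) | apply/(inv _ _ _ _ tf ff')].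
have [t' tt'] := tr_transpose_right th nZ g.
by exists t'; split; [apply/(inv _ _ _ _ tt' tf) | apply/(inv _ _ _ _ tf tt')].
Qed.

Lemma fitting_transpose : fitting_end Z -> fitting_end Y.
Proof.
move=> fit t; have [f tf] := tr_transpose th n t fs.
have [nf|isof] := fit f; [left|right].
  exact/(nilpotent_transpose tf).
exact/(homotopy_equiv_transpose tf).
Qed.

Lemma fitting_transpose_inv : fitting_end Y -> fitting_end Z.
Proof.
move=> fit f; have [t tf] := tr_transpose_right th nZ f.
have [nt|isot] := fit t; [left|right].
  exact/(nilpotent_transpose tf).
exact/(homotopy_equiv_transpose tf).
Qed.

Lemma nullhom_id_transpose : nullhom (chid Z) -> nullhom (chid Y).
Proof.
move=> nz; apply: (tr_null_left nZ (th := th)) => a.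
rewrite chcomp1l -[a]chcomp1r; apply: (tr_null th nZ).
exact: nullhom_compl.
Qed.
End SerreFitting.
End Local.

(** * Almost split triangles *)

Section CategoryLemmas.
Variable C : category.

Lemma ciso_id (X : C) : ciso (cid X).
Proof. by exists (cid X); split; apply: ccomp1l. Qed.

Lemma ciso_factor_right (X X' Y E : C) (g : chom X Y) (r : chom X' X)
    (v : chom E Y) (a : chom X' E) :
  ciso r -> heq (ccomp g r) (ccomp v a) -> exists h, heq g (ccomp v h).
Proof.
move=> [r' [_ rr]] e; exists (ccomp a r').
by rewrite ccompA -e -ccompA rr ccomp1r; reflexivity.
Qed.

Lemma ciso_factor_left (X Y Y' E : C) (g : chom X Y) (s : chom Y Y')
    (u : chom X E) (a : chom E Y') :
  ciso s -> heq (ccomp s g) (ccomp a u) -> exists h, heq g (ccomp h u).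
Proof.
move=> [s' [ss _]] e; exists (ccomp s' a).
by rewrite -ccompA -e ccompA ss ccomp1l; reflexivity.
Qed.

Lemma retraction_of_comp (X X' Y : C) (g : chom X Y) (r : chom X' X) (a : chom X' Y) b :
  heq (ccomp g r) a -> heq (ccomp a b) (cid Y) -> is_retraction g.
Proof.
by move=> e ab; exists (ccomp r b); rewrite ccompA e.
Qed.

Lemma section_of_comp (X Y Y' : C) (g : chom X Y) (s : chom Y Y') (a : chom X Y') b :
  heq (ccomp s g) a -> heq (ccomp b a) (cid X) -> is_section g.
Proof.
by move=> e ab; exists (ccomp b s); rewrite -ccompA e.
Qed.

Lemma ciso_heq (X Y : C) (f g : chom X Y) : heq f g -> ciso g -> ciso f.
Proof. by move=> e [h [hg gh]]; exists h; rewrite e. Qed.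
End CategoryLemmas.

(** * Derived morphisms from K-projective and to K-injective complexes *)

Section InDerived.
Variables (k : fieldType) (A : lualgebra k) (B : complex_class A).
Hypothesis BE : ext_closed B.
Local Notation "g ** f" := (chcomp g f) (at level 40, left associativity).
Local Notation "f ~~ g" := (homotopic f g) (at level 70).
Local Notation ob := (cob (complexes_in B)).
Local Notation D := (derived B).
Local Notation ch X Y := (chainmap (sval X) (sval Y)).
Local Notation L X Y f := (@dmap k A B X Y f).

Lemma dmap_iso (X Y : ob) (f : ch X Y) : homotopy_equiv f -> ciso (L X Y f).
Proof.
move=> [g [gf fg]]; exists (L Y X g); split.
  apply: heq_trans (heq_sym (@dmap_comp _ _ _ X Y X g f)) _.
  exact: (@dmap_homotopic _ _ _ BE X X _ _ gf).
apply: heq_trans (heq_sym (@dmap_comp _ _ _ Y X Y f g)) _.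
exact: (@dmap_homotopic _ _ _ BE Y Y _ _ fg).
Qed.

Lemma dmap_comp_homotopic (X Y Z : ob) (g : ch Y Z) (f : ch X Y) (h : ch X Z) :
  g ** f ~~ h -> heq (ccomp (L Y Z g) (L X Y f)) (L X Z h).
Proof.
move=> e; apply: heq_trans (heq_sym (@dmap_comp _ _ _ X Y Z g f)) _.
exact: (@dmap_homotopic _ _ _ BE X Z).
Qed.

Lemma dmap_eq_right (X Y : ob) (f g : ch X Y) : heq (L X Y f) (L X Y g) ->
  exists (X' : ob) (r : ch X' X), quasi_iso r /\ f ** r ~~ g ** r.
Proof.
move=> /(dmap_eq_left BE)[Y' [t [qt e]]].
have [|X' [r [bX' qr nr]]] := qis_kill_right (f := f - g) BE (svalP X) (svalP Y) (svalP Y') qt.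
  by rewrite chcompDr chcompNr; apply: homotopic_nullhom.
exists (exist _ X' bX'), r; split=> //.
by apply: nullhom_homotopic; rewrite -chcompNl -chcompDl.
Qed.

Section FromKprojective.
Variable Z : ob.
Hypothesis KZ : Kprojective (sval Z).

Lemma Kprojective_full (N : ob) (f : @chom D Z N) : exists a : ch Z N, heq f (L Z N a).
Proof.
have [N' [s [g [qs e]]]] := @left_fraction k A B BE Z N f.
have [a ea] := Kprojective_lift KZ g qs; exists a.
apply: ciso_cancell (dmap_qis qs) _; apply: heq_trans e _; apply: heq_sym.
exact/dmap_comp_homotopic/homotopic_sym.
Qed.

Lemma Kprojective_faithful (N : ob) (f g : ch Z N) :
  heq (L Z N f) (L Z N g) -> f ~~ g.
Proof.
move=> /(dmap_eq_left BE)[N' [t [qt /homotopic_nullhom e]]].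
apply/nullhom_homotopic/(Kprojective_null KZ qt).
by rewrite chcompDr chcompNr.
Qed.
End FromKprojective.

(** Phrased through quasi-isomorphisms rather than acyclic complexes, which is the form that Serre
    duality delivers. *)
Definition Kinjective (X : complex A) := forall N N' (s : chainmap N N'), quasi_iso s ->
  (forall t : chainmap N' X, nullhom (t ** s) -> nullhom t) /\
  (forall t : chainmap N X, exists t' : chainmap N' X, t ~~ t' ** s).

Section ToKinjective.
Variable X : ob.
Hypothesis KX : Kinjective (sval X).

Lemma Kinjective_full (N : ob) (f : @chom D N X) : exists a : ch N X, heq f (L N X a).
Proof.
have [N' [r [g [qr e]]]] := @right_fraction k A B BE N X f.
have [_ /(_ g)[a ea]] := KX qr; exists a.
apply: ciso_cancelr (dmap_qis qr) _; apply: heq_trans e _; apply: heq_sym.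
exact/dmap_comp_homotopic/homotopic_sym.
Qed.

Lemma Kinjective_faithful (N : ob) (f g : ch N X) :
  heq (L N X f) (L N X g) -> f ~~ g.
Proof.
move=> /dmap_eq_right[N' [r [qr /homotopic_nullhom e]]].
have [inj _] := KX qr; apply/nullhom_homotopic/inj.
by rewrite chcompDl chcompNl.
Qed.
End ToKinjective.
End InDerived.

(** * Comparison of the extension triangle with a cone triangle *)

Section ExactTriangle.
Variables (k : fieldType) (A : lualgebra k).
Local Notation "g ** f" := (chcomp g f) (at level 40, left associativity).
Local Notation "f ~~ g" := (homotopic f g) (at level 70).
Variables (Z X : complex A) (w : chainmap Z (shift 1 X)).

Definition ext_cone_map : chainmap Z (cone (ext_in w)).
Proof.
exists (fun i => hpair (w i) (ext_fst w i)) => i j e z; case: j / e.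
apply: pair_eq => /=.
  by rewrite ext_w_diff (cdiff_irr _ (addr1_shift 1 erefl) erefl).
have /= -> := ext_diff_fst w z.
by rewrite addrCA subrr addr0.
Defined.

Definition cone_ext_map : chainmap (cone (ext_in w)) Z.
Proof.
exists (fun i => hcomp (hfst (Z i) (X i)) (hsnd (X (i + 1)) (ext w i))) => i j e p.
by case: j / e => /=; rewrite add0r.
Defined.

Lemma cone_ext_mapK : cone_ext_map ** ext_cone_map = chid Z.
Proof. exact: chainmap_ext. Qed.

(** The cone contains X twice, in [ext w] and shifted; the homotopy sends the first copy to the
    second and so cancels both. *)
Lemma ext_cone_mapK : ext_cone_map ** cone_ext_map ~~ chid _.
Proof.
apply/homotopic_sym/nullhom_homotopic/nullhomS.
exists (fun i => hpair
  (hcomp (hsnd (Z (i + 1)) (X (i + 1))) (hsnd (X (i + 1 + 1)) (ext w (i + 1))))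
  (hzero _ (ext w i))).
move=> i [x' [z x]]; rewrite chsubE; apply: pair_eq => /=.
  rewrite (cdiff_irr _ (addr1_shift 1 erefl) erefl).
  by rewrite scale1r scaleN1r addr0 [RHS]addrCA addKr.
by apply: pair_eq; rewrite /= ?hom0 ?scaler0 ?subrr ?subr0 ?addr0.
Qed.

Section Triangle.
Variables (B : complex_class A) (BE : ext_closed B) (bZ : B Z) (bX : B X) (bE : B (ext w)).
Local Notation ob := (cob (complexes_in B)).
Local Notation D := (derived B).
Let Zo : ob := exist _ Z bZ.
Let Xo : ob := exist _ X bX.
Let Eo : ob := exist _ (ext w) bE.
Local Notation L X Y f := (@dmap k A B X Y f).

(** The third map is left free and later only required to equal w in the derived category: in (1) it
    is a composite with [Db_shiftVK]. *)
Definition ext_triangle (W : @chom D Zo (dshift B 1 Xo)) : triangle B :=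
  @Triangle k A B Xo Eo Zo (L Xo Eo (ext_in w)) (L Eo Zo (ext_out w)) W.

Lemma ext_triangle_exact (W : @chom D Zo (dshift B 1 Xo)) :
  heq W (L Zo (dshift_ob 1 Xo) w) -> exact_triangle (ext_triangle W).
Proof.
move=> eW; pose Co : ob := @dcone k A B Xo Eo (ext_in w).
exists Xo, Eo, (ext_in w), (cid (Xo : D)), (cid (Eo : D)), (L Zo Co ext_cone_map).
split; first split; [exact: ciso_id | exact: ciso_id | |].
  apply: (@dmap_iso k A B BE Zo Co); exists cone_ext_map.
  by rewrite cone_ext_mapK; split; [apply: homotopic_refl | apply: ext_cone_mapK].
split.
- apply: heq_trans (ccomp1l _) _; apply: heq_sym; exact: ccomp1r.
- apply: heq_trans (@dmap_comp_homotopic k A B BE Eo Zo Co _ _ (cone_in (ext_in w)) _) _.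
    have -> : ext_out w = cone_ext_map ** cone_in (ext_in w) by apply: chainmap_ext.
    by rewrite chcompA ext_cone_mapK chcomp1l; reflexivity.
  by apply: heq_sym; apply: ccomp1r.
- apply: heq_trans (heq_comp (@Fmap_id _ _ (dshift B 1) Xo) (heq_refl _)) _.
  apply: heq_trans (ccomp1l _) _; apply: heq_trans eW _.
  apply/heq_sym/(@dmap_comp_homotopic k A B BE Zo Co (dshift_ob 1 Xo)).
  by rewrite (_ : _ ** _ = w); [reflexivity | apply: chainmap_ext].
Qed.
End Triangle.
End ExactTriangle.

(** * Almost splitness and minimality in the extension triangle *)

Section AlmostSplit.
Variables (k : fieldType) (A : lualgebra k).
Local Notation "g ** f" := (chcomp g f) (at level 40, left associativity).
Local Notation "f ~~ g" := (homotopic f g) (at level 70).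
Variables (Z X : complex A) (th : serre_data Z (shift 1 X)) (n : nat).
Hypothesis nZ : forall i : int, (n < `|i|)%N -> is_zero_module (Z i).
Hypothesis KZ : Kprojective Z.
Hypothesis fs : forall i, finspan (fun _ : hom (Z i) (Z i) => True).
Hypothesis fitZ : fitting_end Z.
Hypothesis nullZ : ~ nullhom (chid Z).
Local Notation tr := (tr th n).

Lemma serre_Kinjective : Kinjective X.
Proof.
move=> N N' s /quasi_iso_shift qs; split=> t.
  move=> /nullhom_shift; rewrite shift_map_comp => /(serre_null_comp th nZ KZ qs).
  exact: nullhom_unshift.
have [t1 e1] := serre_extend th nZ KZ (shift_map 1 t) qs.
have [t' et'] := shift_map_full t1; exists t'; apply: homotopic_unshift.
by rewrite shift_map_comp et'.
Qed.

Lemma serre_fitting : fitting_end X.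
Proof. exact/fitting_unshift/(fitting_transpose th nZ fs). Qed.

(* The map representing a form on End(Z) that is 1 at the identity and kills
   the radical. *)
Lemma almost_split_map : exists w : chainmap Z (shift 1 X),
  [/\ ~ nullhom w,
      forall N (a : chainmap N Z), (forall b : chainmap Z N, nilpotent (a ** b)) ->
        nullhom (w ** a) &
      forall N (a : chainmap X N), (forall b : chainmap N X, nilpotent (b ** a)) ->
        nullhom (shift_map 1 a ** w)].
Proof.
have [phi [phil phin phi1]] := local_form nullZ fitZ.
have [w wP] := tr_form th nZ phil (fun g ng => phin g (nilpotent_null ng)).
exists w; split.
- move=> nw; have := wP (chid Z); rewrite phi1 chcomp1r (tr_null th nZ nw) => /eqP.
  by rewrite oner_eq0.
- move=> N a ab; apply: (tr_null_left nZ (th := th)) => b.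
  by rewrite -chcompA -wP phin.
- move=> N a ab; apply: (tr_null_right nZ (th := th)) => t.
  have [b eb] := shift_map_full t; rewrite chcompA -eb -shift_map_comp.
  (* Transposing moves b a from X to an endomorphism f of Z that is nilpotent as well, and the trace
     becomes phi f = 0. *)
  have [f tf] := tr_transpose th n (shift_map 1 (b ** a)) fs.
  rewrite tf -wP phin //; apply/(nilpotent_transpose nZ tf).
  exact: nilpotent_shift.
Qed.

Section Class.
Variables (w : chainmap Z (shift 1 X)).
Hypothesis nw : ~ nullhom w.
Hypothesis w_right : forall N (a : chainmap N Z),
  (forall b : chainmap Z N, nilpotent (a ** b)) -> nullhom (w ** a).
Hypothesis w_left : forall N (a : chainmap X N),
  (forall b : chainmap N X, nilpotent (b ** a)) -> nullhom (shift_map 1 a ** w).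
Variables (B : complex_class A) (BE : ext_closed B) (bZ : B Z) (bX : B X) (bE : B (ext w)).
Local Notation ob := (cob (complexes_in B)).
Local Notation D := (derived B).
Let Zo : ob := exist _ Z bZ.
Let Xo : ob := exist _ X bX.
Let Eo : ob := exist _ (ext w) bE.
Local Notation L X Y f := (@dmap k A B X Y f).
Let u := L Xo Eo (ext_in w).
Let v := L Eo Zo (ext_out w).
Let KX := serre_Kinjective.

Lemma ext_out_not_split (s : chainmap Z (ext w)) : ~ ext_out w ** s ~~ chid Z.
Proof.
move=> e; apply: nw; rewrite -[w]chcomp1r -e chcompA.
exact/nullhom_compr/ext_w_out_null.
Qed.

Lemma ext_in_not_split (r : chainmap (ext w) X) : ~ r ** ext_in w ~~ chid X.
Proof.
move=> e; apply: nw; rewrite -[w]chcomp1l -shift_map_id -(homotopic_shift e).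
by rewrite shift_map_comp -chcompA; apply/nullhom_compl/ext_in_w_null.
Qed.

Lemma ext_out_nilpotent (s : chainmap Z (ext w)) : nilpotent (ext_out w ** s).
Proof.
have [//|[g [_ e]]] := fitZ (ext_out w ** s).
by case: (@ext_out_not_split (s ** g)); rewrite chcompA.
Qed.

Lemma ext_in_nilpotent (r : chainmap (ext w) X) : nilpotent (r ** ext_in w).
Proof.
have [//|[g [e _]]] := serre_fitting (r ** ext_in w).
by case: (@ext_in_not_split (g ** r)); rewrite -chcompA.
Qed.

(** Write g as a fraction with numerator a : N' -> Z. If some a b is invertible in End(Z), then g is
    a retraction; otherwise all a b are nilpotent, and the vanishing of w a lets a lift. *)
Lemma ext_right_almost_split : @right_almost_split D Eo Zo v.
Proof.
split.
  move=> [s es]; have [s0 es0] := @Kprojective_full k A B BE Zo KZ Eo s.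
  apply: (@ext_out_not_split s0); apply: (@Kprojective_faithful k A B BE Zo KZ Zo).
  apply: heq_trans (@dmap_comp k A B Zo Eo Zo _ _) _.
  exact: heq_trans (heq_comp (heq_refl _) (heq_sym es0)) es.
move=> N g ng; have [N' [r [a [qr e]]]] := @right_fraction k A B BE N Zo g.
have na : nullhom (w ** a).
  apply: w_right => b; have [//|[c [_ abc]]] := fitZ (a ** b).
  case: ng; apply: (retraction_of_comp e (b := L Zo N' (b ** c))).
  by apply: (@dmap_comp_homotopic k A B BE Zo N' Zo _ _ (chid Z)); rewrite chcompA.
have [a' ea] := ext_lift_out na.
apply: (@ciso_factor_right D N N' Zo Eo g _ v (L N' Eo a') (dmap_qis qr)).
apply: heq_trans e _; apply/heq_sym/(@dmap_comp_homotopic k A B BE N' Eo Zo).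
by rewrite ea; apply: homotopic_refl.
Qed.

Lemma ext_left_almost_split : @left_almost_split D Xo Eo u.
Proof.
split.
  move=> [r er]; have [r0 er0] := @Kinjective_full k A B BE Xo KX Eo r.
  apply: (@ext_in_not_split r0); apply: (@Kinjective_faithful k A B BE Xo KX Xo).
  apply: heq_trans (@dmap_comp k A B Xo Eo Xo _ _) _.
  exact: heq_trans (heq_comp (heq_sym er0) (heq_refl _)) er.
move=> N g ng; have [N' [s [a [qs e]]]] := @left_fraction k A B BE Xo N g.
have na : nullhom (shift_map 1 a ** w).
  apply: w_left => b; have [//|[c [cba _]]] := serre_fitting (b ** a).
  case: ng; apply: (section_of_comp e (b := L N' Xo (c ** b))).
  by apply: (@dmap_comp_homotopic k A B BE Xo N' Xo _ _ (chid X)); rewrite -chcompA.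
have [a' ea] := ext_desc_in na.
apply: (@ciso_factor_left D Xo N N' Eo g _ u (L Eo N' a') (dmap_qis qs)).
apply: heq_trans e _; apply/heq_sym/(@dmap_comp_homotopic k A B BE Xo Eo N').
by rewrite ea; apply: homotopic_refl.
Qed.

(** Write h as s^-1 h'. After a quasi-isomorphism t, the map t (h' - s) vanishes on X, hence factors
    as b [ext_out], and b lifts to t s c. So h = 1 + c [ext_out], where c [ext_out] is nilpotent
    because [ext_out] c is. *)
Lemma ext_left_minimal : @left_minimal D Xo Eo u.
Proof.
move=> h hu; have [M [s [h' [qs e]]]] := @left_fraction k A B BE Eo Eo h.
have : heq (L Xo M (h' ** ext_in w)) (L Xo M (s ** ext_in w)).
  apply: heq_trans (@dmap_comp k A B Xo Eo M _ _) _.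
  apply: heq_trans (heq_comp (heq_sym e) (heq_refl _)) _.
  apply: heq_trans (heq_sym (ccompA _ _ _)) _.
  apply: heq_trans (heq_comp (heq_refl _) hu) _.
  exact: (heq_sym (@dmap_comp k A B Xo Eo M _ _)).
move=> /(dmap_eq_left BE)[M' [t [qt /homotopic_nullhom et]]].
have [|b eb] := @ext_factor_out k A Z X w _ (t ** (h' - s)).
  by rewrite -chcompA chcompDl chcompNl chcompDr chcompNr.
have qts : quasi_iso (t ** s) by apply: quasi_iso_comp.
have [c ec] := Kprojective_lift KZ b qts.
have nc : nilpotent (- (c ** ext_out w)).
  by rewrite -scaleN1r; apply/nilpotentZ/nilpotent_swap/ext_out_nilpotent.
have ik := nilpotent_geometric nc.
rewrite opprK in ik.
apply: ciso_heq (@dmap_iso k A B BE Eo Eo _ ik).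
apply: ciso_cancell (dmap_qis qs) _; apply: heq_trans e _.
apply: ciso_cancell (dmap_qis qt) _.
apply: heq_trans (heq_sym (@dmap_comp k A B Eo M M' _ _)) _.
apply: heq_trans _ (heq_comp (heq_refl _) (@dmap_comp k A B Eo Eo M _ _)).
apply: heq_trans _ (@dmap_comp k A B Eo M M' _ _).
apply: (@dmap_homotopic k A B BE Eo M').
rewrite chcompDr chcomp1r chcompDr !chcompA -ec -eb.
by rewrite chcompDr chcompNr addrC subrK; apply: homotopic_refl.
Qed.

Lemma ext_right_minimal : @right_minimal D Eo Zo v.
Proof.
move=> h vh; have [M [r [h' [qr e]]]] := @right_fraction k A B BE Eo Eo h.
have : heq (L M Zo (ext_out w ** h')) (L M Zo (ext_out w ** r)).
  apply: heq_trans (@dmap_comp k A B M Eo Zo _ _) _.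
  apply: heq_trans (heq_comp (heq_refl _) (heq_sym e)) _.
  apply: heq_trans (ccompA _ _ _) _.
  apply: heq_trans (heq_comp vh (heq_refl _)) _.
  exact: (heq_sym (@dmap_comp k A B M Eo Zo _ _)).
move=> /(dmap_eq_right BE)[M' [q [qq /homotopic_nullhom eq]]].
have [|b eb] := @ext_factor_in k A Z X w _ ((h' - r) ** q).
  by rewrite chcompA chcompDr chcompNr chcompDl chcompNl.
have qrq : quasi_iso (r ** q) by apply: quasi_iso_comp.
have [_ /(_ b)[c ec]] := KX qrq.
have nc : nilpotent (- (ext_in w ** c)).
  by rewrite -scaleN1r; apply/nilpotentZ/nilpotent_swap/ext_in_nilpotent.
have ik := nilpotent_geometric nc.
rewrite opprK in ik.
apply: ciso_heq (@dmap_iso k A B BE Eo Eo _ ik).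
apply: ciso_cancelr (dmap_qis qr) _; apply: heq_trans e _.
apply: ciso_cancelr (dmap_qis qq) _.
apply: heq_trans (heq_sym (@dmap_comp k A B M' M Eo _ _)) _.
apply: heq_trans _ (heq_comp (@dmap_comp k A B M Eo Eo _ _) (heq_refl _)).
apply: heq_trans _ (@dmap_comp k A B M' M Eo _ _).
apply: (@dmap_homotopic k A B BE M' Eo).
rewrite !chcompDl chcomp1l -!chcompA -ec -eb.
by rewrite chcompDl chcompNl addrC subrK; apply: homotopic_refl.
Qed.

Lemma ext_triangle_almost_split (W : @chom D Zo (dshift B 1 Xo)) :
  heq W (L Zo (dshift_ob 1 Xo) w) ->
  almost_split_triangle (@ext_triangle k A Z X w B bZ bX bE W).
Proof.
move=> eW; split; first exact: ext_triangle_exact.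
  by split; [exact: ext_left_minimal | exact: ext_left_almost_split].
by split; [exact: ext_right_minimal | exact: ext_right_almost_split].
Qed.
End Class.
End AlmostSplit.

(** * The Nakayama functor *)

Section Nakayama.
Variables (k : fieldType) (A : lualgebra k).
Local Notation "g ** f" := (chcomp g f) (at level 40, left associativity).
Local Notation "f ~~ g" := (homotopic f g) (at level 70).

Lemma sign_succ (i : int) : (-1 : k) ^+ absz (i + 1) = - (-1) ^+ absz i.
Proof.
case: i => n; first by rewrite -PoszD addn1 exprS mulN1r.
have -> : absz (Negz n + 1) = n by lia.
by rewrite exprS mulN1r opprK.
Qed.

Section NakayamaSerre.
Variables (nu : kfunctor (@in_proj k A)).
Variable pair : forall M (sM : in_proj M) X, hom X (fobj nu sM) -> hom M X -> k.
Hypothesis nak : nakayama_pairing pair.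

Lemma pair_linear M (sM : in_proj M) X (u : hom X (fobj nu sM)) : scalar (pair u).
Proof. by case: nak => h _ _ _ _ c f g; rewrite -hlinE h. Qed.

Lemma pair_inj M (sM : in_proj M) X (u : hom X (fobj nu sM)) :
  (forall f : hom M X, pair u f = 0) -> u = 0.
Proof.
case: nak => _ h2 h3 _ _ u0.
have [|u1 [_ u1U]] := h3 M sM X (fun=> 0); first by move=> c f g; rewrite mulr0 addr0.
rewrite -(u1U u u0); apply: u1U => f.
have := h2 M sM X (-1) 0 0 f; rewrite hlinE scaler0 addr0 => ->.
by rewrite mulN1r addNr.
Qed.

Variables (Z Y : complex A) (sZ : forall i, in_proj (Z i)).
Variable kap : forall i, hom (Y i) (fobj nu (sZ i)).
Hypothesis kap_iso : forall i, hiso (kap i).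
Hypothesis kap_d : forall i, hcomp (kap (i + 1)) (cdiff Y erefl) =
  hcomp (fmor nu (sZ i) (sZ (i + 1)) (cdiff Z erefl)) (kap i).

(** Binaturality gives equal pairings for d u and u d; the sign, which changes from i to i + 1,
    produces the minus of [th_d]. *)
Let npair i (f : hom (Z i) (Y i)) := (-1) ^+ absz i * pair (kap i) f.

Lemma npair_comp i N (u : hom N (Y i)) (f : hom (Z i) N) :
  npair (hcomp u f) = (-1) ^+ absz i * pair (hcomp (kap i) u) f.
Proof. by rewrite /npair; case: nak => _ _ _ -> _. Qed.

(** Y is identified with the Nakayama transform only through [kap], which is the inverse of
    [shiftVK] in (1) and of the counit of the equivalence in (2). *)
Definition nakayama_serre : serre_data Z Y.
Proof.
exists npair.
- by move=> i c f g; rewrite /npair pair_linear mulrDr !mulrA [_ * c]mulrC.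
- move=> i N u uf; have [l [lk _]] := kap_iso i.
  rewrite -[u]hcomp1l -lk -hcompA.
  suff -> : hcomp (kap i) u = 0 by rewrite hcomp0r.
  apply: pair_inj => f; have := uf f; rewrite npair_comp => /eqP.
  by rewrite mulf_eq0 signr_eq0 /= => /eqP.
- move=> i N phi phil; have [l [_ kl]] := kap_iso i.
  case: (nak) => _ _ h3 _ _.
  have [|u [uP _]] := h3 _ (sZ i) N (fun f => (-1) ^+ absz i * phi f).
    by move=> c f g; rewrite hlinE phil mulrDr mulrCA.
  exists (hcomp l u) => f; rewrite npair_comp hcompA kl hcomp1l uP mulrA.
  by rewrite -expr2 sqrr_sign mul1r.
- move=> i u; rewrite [LHS]npair_comp kap_d sign_succ mulNr; congr (- (_ * _)).
  by case: nak => _ _ _ _ ->.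
Defined.
End NakayamaSerre.

Lemma in_proj_summand (M N : module A) (i : hom N M) (r : hom M N) :
  hcomp r i = hid N -> in_proj M -> in_proj N.
Proof. exact: add_summand. Qed.
Lemma in_inj_summand (M N : module A) (i : hom N M) (r : hom M N) :
  hcomp r i = hid N -> in_inj M -> in_inj N.
Proof. exact: add_summand. Qed.

Lemma fmor_scale S (F : kfunctor (A := A) S) M N (sM : S M) (sN : S N) c (f : hom M N) :
  fmor F sM sN (c *: f) = c *: fmor F sM sN f.
Proof.
have F0 : fmor F sM sN 0 = 0.
  have := fmor_lin F sM sN (-1) 0 0; rewrite !hlinE scaler0 addr0 => ->.
  by rewrite scaleN1r addNr.
by have := fmor_lin F sM sN c f 0; rewrite !hlinE F0 !addr0.
Qed.

Hypothesis lfd : locally_finite_dim A.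
Variables (nu : kfunctor (@in_proj k A)).
Hypothesis nu_nak : nakayama_functor nu.

Lemma proj_almost_split (P : kb_object (@in_proj k A)) : kb_indecomposable P ->
  exists (M : DbMod A)
    (u : chom (Db_shift (-1) (kfun_Db nu P)) M)
    (v : chom M (kb_Db P))
    (w : chom (kb_Db P) (kfun_Db nu P)),
    let T := Triangle u v (ccomp (Db_shiftVK (kfun_Db nu P)) w) in
    almost_split_triangle T /\ almost_split_triangle (triangle_image T).
Proof.
move=> indec; have [_ [pair nak]] := nu_nak.
pose Z := kb_complex P; pose nuP := kfun_kb nu P.
have th : serre_data Z (shift 1 (shift (-1) nuP)).
  apply: (nakayama_serre nak (sZ := @kb_mem k A _ P) (kap := shiftVK_inv nuP)) => i.
    exists (shiftVK nuP i); split.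
      by have /(congr1 (fun f : chainmap _ _ => f i)) := shiftVK_invK nuP.
    by have /(congr1 (fun f : chainmap _ _ => f i)) := shiftVKK nuP.
  exact: (cmap_hcomp (shiftVK_inv nuP)).
have bZ : bounded Z := kb_bounded P; have [n nZ] := bZ.
have pZ i : in_proj (Z i) by apply: kb_mem.
have fs i : finspan (fun _ : hom (Z i) (Z i) => True) by apply: in_proj_finspan.
have KZ : Kprojective Z.
  by apply: bounded_projective_Kprojective => // i; apply: in_proj_projective.
have fit : fitting_end Z.
  apply: (kb_indecomposable_fitting in_proj_summand indec) => i a.
  exact: finspan_algebraic.
have nz : ~ nullhom (chid Z) by case: indec.
have [w [nw wr wl]] := almost_split_map th nZ fs fit nz.
have bX : bounded_complexes A (shift (-1) nuP).
  exact: (svalP (Db_shift (-1) (kfun_Db nu P))).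
have bE : bounded_complexes A (ext w) by apply: bounded_ext_closed.
(* The map w ends in the double shift of [nuP], whereas the third map of the triangle must be
   [shiftVK] after a map to [nuP]. *)
pose w0 := shiftVK_inv nuP ** w.
have ew : shiftVK nuP ** w0 ~~ w.
  by rewrite /w0 chcompA shiftVK_invK chcomp1l; apply: homotopic_refl.
exists (exist _ (ext w) bE).
exists (@dmap k A (bounded_complexes A) (Db_shift (-1) (kfun_Db nu P))
  (exist _ (ext w) bE) (ext_in w)).
exists (@dmap k A (bounded_complexes A) (exist _ (ext w) bE) (kb_Db P) (ext_out w)).
exists (@dmap k A (bounded_complexes A) (kb_Db P) (kfun_Db nu P) w0).
split.
- apply: (@ext_triangle_almost_split k A Z _ th n nZ KZ fs fit w nw wr wl _
    (@bounded_ext_closed k A) (kb_bounded P) (inclass_shift (-1) (svalP (kfun_Db nu P))) bE).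
  exact: (@dmap_comp_homotopic k A (bounded_complexes A) (@bounded_ext_closed k A)
    (kb_Db P) (kfun_Db nu P) (Db_shift 1 (Db_shift (-1) (kfun_Db nu P)))).
- pose Po : complexes_in (all_complexes A) := exist _ Z I.
  pose No : complexes_in (all_complexes A) := exist _ nuP I.
  pose So : complexes_in (all_complexes A) := exist _ (shift 1 (shift (-1) nuP)) I.
  exact: (@ext_triangle_almost_split k A Z _ th n nZ KZ fs fit w nw wr wl _
    (@all_ext_closed k A) I I I (ccomp (@dmap k A (all_complexes A) No So (shiftVK nuP))
      (@dmap k A (all_complexes A) Po No w0))
    (@dmap_comp_homotopic k A (all_complexes A) (@all_ext_closed k A) Po No So _ _ _ ew)).
Qed.

(** The given complex plays the role of X and its inverse transform, shifted, that of Z. Everything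
    known of Z beyond projectivity of its terms and boundedness is transposed from X. *)
Lemma inj_almost_split (nui : kfunctor (@in_inj k A)) :
  nakayama_quasi_inverse nu nui ->
  forall I : kb_object (@in_inj k A), kb_indecomposable I ->
  exists (M : DbMod A)
    (u : chom (kb_Db I) M)
    (v : chom M (Db_shift 1 (kfun_Db nui I)))
    (w : chom (Db_shift 1 (kfun_Db nui I)) (Db_shift 1 (kb_Db I))),
    let T := Triangle u v w in
    almost_split_triangle T /\ almost_split_triangle (triangle_image T).
Proof.
move=> [_ [nuI [nuiP [_ [eps [eps_iso eps_nat]]]]]] In indec.
have [_ [pair nak]] := nu_nak.
pose X := kb_complex In; pose Z := shift 1 (kfun_kb nui In).
pose sI i : in_inj (In i) := @kb_mem k A _ In i.
pose sZ i : in_proj (Z i) := nuiP _ (sI (i + 1)).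
pose kap i : hom (In i) _ := sval (boolp.cid (eps_iso _ (sI i))).
have [kapl kapr] : (forall i, hcomp (kap i) (eps _ (sI i)) = hid _) /\
    (forall i, hcomp (eps _ (sI i)) (kap i) = hid _).
  by split=> i; have [] := svalP (boolp.cid (eps_iso _ (sI i))).
have th : serre_data Z (shift 1 X).
  apply: (@nakayama_serre nu pair nak Z (shift 1 X) sZ (fun i => kap (i + 1))) => i.
    exists (eps _ (sI (i + 1))).
    by split; [exact: (kapr (i + 1)) | exact: (kapl (i + 1))].
  pose d : hom (In (i + 1)) (In (i + 1 + 1)) := cdiff X (addr1_shift 1 (erefl (i + 1))).
  have nat := eps_nat _ _ (sI (i + 1)) (sI (i + 1 + 1)) d.
  have nat' : hcomp (kap (i + 1 + 1)) d =
      hcomp (fmor nu (sZ i) (sZ (i + 1)) (fmor nui (sI (i + 1)) (sI (i + 1 + 1)) d)) (kap (i + 1)).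
    rewrite -[d in LHS]hcomp1r -(kapr (i + 1)) [hcomp d _]hcompA -nat.
    by rewrite !hcompA kapl hcomp1l.
  (* Both shifted differentials carry the same sign, which linearity of the functor lets cancel. *)
  have -> : cdiff (shift 1 X) (erefl (i + 1)) = (-1) ^+ 1 *: d by [].
  have -> : cdiff Z (erefl (i + 1)) = (-1) ^+ 1 *: fmor nui (sI (i + 1)) (sI (i + 1 + 1)) d by [].
  rewrite fmor_scale; apply: hom_ext => x.
  rewrite !hcompE !hscaleE homZ; congr (_ *: _).
  exact: (congr1 (fun f => hfun f x) nat').
have bZ : bounded Z := svalP (Db_shift 1 (kfun_Db nui In)); have [n nZ] := bZ.
have fs i : finspan (fun _ : hom (Z i) (Z i) => True) by apply: in_proj_finspan.
have KZ : Kprojective Z.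
  by apply: bounded_projective_Kprojective => // i; apply: in_proj_projective.
(* The terms of X occur in the duality as those of X[1], hence the passage to a degree i' + 1. *)
have fitX : fitting_end X.
  apply: (kb_indecomposable_fitting in_inj_summand indec) => i.
  have [i' ei] := int_succ i; case: i / ei => a.
  exact: (th_algebraic th (i := i') (a : hom (shift 1 X i') (shift 1 X i')) (fs i')).
have fit : fitting_end Z := fitting_transpose_inv th nZ fs (fitting_shift fitX).
have nz : ~ nullhom (chid Z).
  move=> /(nullhom_id_transpose th nZ); rewrite -shift_map_id => /nullhom_unshift.
  by case: indec.
have [w [nw wr wl]] := almost_split_map th nZ fs fit nz.
have bX : bounded_complexes A X := kb_bounded In.
have bE : bounded_complexes A (ext w) by apply: bounded_ext_closed.
exists (exist _ (ext w) bE).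
exists (@dmap k A (bounded_complexes A) (kb_Db In) (exist _ (ext w) bE) (ext_in w)).
exists (@dmap k A (bounded_complexes A) (exist _ (ext w) bE)
  (Db_shift 1 (kfun_Db nui In)) (ext_out w)).
exists (@dmap k A (bounded_complexes A) (Db_shift 1 (kfun_Db nui In)) (Db_shift 1 (kb_Db In)) w).
split.
- apply: (@ext_triangle_almost_split k A Z X th n nZ KZ fs fit w nw wr wl _
    (@bounded_ext_closed k A) (inclass_shift 1 (svalP (kfun_Db nui In))) (kb_bounded In) bE).
  exact: heq_refl.
- apply: (@ext_triangle_almost_split k A Z _ th n nZ KZ fs fit w nw wr wl _
    (@all_ext_closed k A) I I I).
  exact: heq_refl.
Qed.
End Nakayama.

Theorem corollary5p9 (k : fieldType) (Q : quiver) (J : ideal k Q)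
  (Q_lf : locally_finite_quiver Q)
  (J_wa : weakly_admissible J)
  (L_lfd : locally_finite_dim (path_quotient J))
  (nu : kfunctor (@in_proj k (path_quotient J)))
  (nu_nak : nakayama_functor nu) :
  (forall P : kb_object (@in_proj k (path_quotient J)), kb_indecomposable P ->
     exists (M : DbMod (path_quotient J))
       (u : chom (Db_shift (-1) (kfun_Db nu P)) M)
       (v : chom M (kb_Db P))
       (w : chom (kb_Db P) (kfun_Db nu P)),
       let T := Triangle u v (ccomp (Db_shiftVK (kfun_Db nu P)) w) in
       almost_split_triangle T /\ almost_split_triangle (triangle_image T))
  /\
  (forall nui : kfunctor (@in_inj k (path_quotient J)),
     nakayama_quasi_inverse nu nui ->
   forall I : kb_object (@in_inj k (path_quotient J)), kb_indecomposable I ->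
     exists (M : DbMod (path_quotient J))
       (u : chom (kb_Db I) M)
       (v : chom M (Db_shift 1 (kfun_Db nui I)))
       (w : chom (Db_shift 1 (kfun_Db nui I)) (Db_shift 1 (kb_Db I))),
       let T := Triangle u v w in
       almost_split_triangle T /\ almost_split_triangle (triangle_image T)).
Proof.
split=> [P|nui nuiP I]; first exact: (proj_almost_split L_lfd nu_nak).
exact: (inj_almost_split L_lfd nu_nak nuiP).
Qed.
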